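(* If $8\mid n$, then the number $\nu(n)$ of isomorphism classes of regular embeddings of $K_{n,n}$ in orientable surfaces is \[\nu(n)=\sum_{\Gamma\preceq\Pi_n}\Biggl(\Bigl(\sum_{f=2}^{e_2}\phi(2^{e_2-f})\prod_{2\to p\ \text{in}\ \Gamma}\bigl(2^{f_{2,p}}-1\bigr)+4\Bigr)\prod_{2\ne q\in N(\Gamma)}\Bigl(\sum_{f=1}^{e_q}\phi(q^{e_q-f})\prod_{q\to p\ \text{in}\ \Gamma}\bigl(q^{f_{q,p}}-1\bigr)\Bigr)\Biggr).\]
   Context: A regular embedding of $K_{n,n}$ is an embedding in a closed orientable surface whose orientation-preserving automorphism group acts transitively on arcs; isomorphism means orientation-preserving isomorphism. $\Pi_n$ is the directed graph whose vertices are the primes dividing $n$, with an arc $q\to p$ iff $q\mid p-1$. $\Gamma\preceq\Pi_n$ means $\Gamma$ is a short spanning subgraph: a subgraph of $\Pi_n$ containing all its vertices and containing no directed path of length $2$ (no $r\to q\to p$). $N(\Gamma)$ is the set of non-terminal vertices of $\Gamma$ (vertices at which no arc of $\Gamma$ ends). For a prime $q\mid n$, $q^{e_q}\parallel n$; for an arc $q\to p$, $r(q,p)$ is defined by $q^{r(q,p)}\parallel p-1$ and $f_{q,p}=\min\{f,r(q,p)\}$. $\phi$ is Euler's function; the inner product over arcs $q\to p$ of $\Gamma$ starting at $q$ is $1$ if there are none. *)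

(* Defs.v *)
From HB Require Import structures.
From mathcomp Require Import all_boot all_order all_fingroup.
Set Implicit Arguments. Unset Strict Implicit. Unset Printing Implicit Defensive.

(* An orientable map is given combinatorially by its dart set D, a rotation
   permutation R (vertices = cycles of R) and a fixed-point-free involution L
   (edges = cycles of L).  A map with underlying graph K_{n,n} has exactly
   2 n^2 darts, so we fix the dart set to be 'I_(2*n*n). *)
Definition Dart (n : nat) := 'I_(2 * n * n).

Definition side (n : nat) (x : 'I_n + 'I_n) : bool :=
  if x is inl _ then true else false.

(* p = (R, L) is an orientable map whose underlying graph is K_{n,n}:
   L is a fixed-point-free involution, and there is a labelling v of darts by
   the vertices of K_{n,n} (two sides 'I_n + 'I_n) such that darts get the same
   label iff they lie in the same R-cycle (so v identifies R-cycles with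
   vertices), every edge {d, L d} joins opposite sides, and distinct darts give
   distinct ordered vertex pairs (no multiple edges; by counting every pair of
   opposite vertices is joined by exactly one edge). *)
Definition KnnMap (n : nat) (p : {perm Dart n} * {perm Dart n}) : bool :=
  let R := p.1 in let L := p.2 in
  [forall d, (L (L d) == d) && (L d != d)] &&
  [exists v : {ffun Dart n -> 'I_n + 'I_n},
     [forall d, forall d', (v d == v d') == (d' \in porbit R d)] &&
     [forall d, side (v d) != side (v (L d))] &&
     injectiveb (fun d => (v d, v (L d)))].

(* Regular: the orientation-preserving automorphism group (permutations of the
   darts commuting with R and L) acts transitively on darts (= arcs). *)
Definition regular_map (n : nat) (p : {perm Dart n} * {perm Dart n}) : bool :=
  [forall d, forall d', exists g : {perm Dart n},
     [&& (g * p.1 == p.1 * g)%g, (g * p.2 == p.2 * g)%g & g d == d']].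

Definition reg_Knn (n : nat) (p : {perm Dart n} * {perm Dart n}) : bool :=
  KnnMap p && regular_map p.

(* Orientation-preserving isomorphism of maps on the same dart set:
   simultaneous conjugacy of (R, L). *)
Definition map_iso (n : nat) (p q : {perm Dart n} * {perm Dart n}) : bool :=
  [exists g : {perm Dart n}, (q.1 == p.1 ^ g)%g && (q.2 == p.2 ^ g)%g].

Definition nu (n : nat) : nat :=
  #|[set [set q : {perm Dart n} * {perm Dart n} | reg_Knn q && map_iso p q]
      | p in [set p : {perm Dart n} * {perm Dart n} | reg_Knn p]]|.

Definition Pi_arc (n q p : nat) : bool :=
  [&& prime q, prime p, q %| n, p %| n & q %| p.-1].

(* A spanning subgraph of Pi_n is determined by its arc set A (pairs (q,p),
   primes dividing n are <= n so they fit in 'I_n.+1); short = no directed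
   path r -> q -> p of length 2. *)
Definition short_spanning (n : nat) (A : {set 'I_n.+1 * 'I_n.+1}) : bool :=
  [forall a in A, Pi_arc n a.1 a.2] &&
  [forall a in A, forall b in A, nat_of_ord a.2 != nat_of_ord b.1].

Definition nonterminal (n : nat) (A : {set 'I_n.+1 * 'I_n.+1}) (q : nat) : bool :=
  [forall a in A, nat_of_ord a.2 != q].

Definition arc_prod (n : nat) (A : {set 'I_n.+1 * 'I_n.+1}) (q f : nat) : nat :=
  \prod_(a in A | nat_of_ord a.1 == q) (q ^ minn f (logn q (nat_of_ord a.2).-1) - 1).

(* Main.v *)
(** A regular embedding of K_{n,n} amounts to a group G = <x><y> with
    <x> and <y> disjoint cyclic groups of order n, together with an involutory
    automorphism (conjugation by t) exchanging x and y.  Such a G always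
    has a normal subgroup <x ^+ (n %/ p)> with p prime, so it is solvable by
    induction, and Hall's theorems reduce it to the q-parts x_q, y_q.

    A q-part is described by its type.  Lifting relations along the central
    quotients by <x ^+ (n %/ q), y ^+ (n %/ q)> shows that h = x^-1 y satisfies
    h ^ x = h ^+ k.+1 with q | k (and 4 | k if q = 2), or else that q = 2 and one
    of four exceptional presentations holds.  For primes q < p, the elements x_q
    and y_q act on y_p and x_p by a power map with a common exponent l(q, p).
    If l(q, p) <> 1, then q | p - 1, the p-part is abelian, and
    l(q, p) ^ (q ^ f) = 1 modulo the order of x_p, where q ^ f = gcd(k, q ^ e_q)
    (f = 1 for the exceptional types); hence the pairs with l(q, p) <> 1 are
    the arcs of a short subgraph of Pi_n.

    These data determine the embedding up to isomorphism, and all of them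
    occur, in explicit permutation groups.  In the count, totient (q ^ (e_q - f))
    types have gcd(k, q ^ e_q) = q ^ f, the four exceptional types account for
    the summand 4 (each contributes the factor 1), and an arc q -> p admits
    q ^ minn f r - 1 exponents, where q ^ r is the q-part of p - 1. *)
Require Import Defs.
From HB Require Import structures.
From mathcomp Require Import all_boot all_order all_algebra all_fingroup all_solvable.
From mathcomp Require Import zify ring.
Set Implicit Arguments. Unset Strict Implicit. Unset Printing Implicit Defensive.
Import GroupScope.

(** * Isobicyclic triples and solvability *)

(** In the climb from order n/p to order n each step must control which relations lift. The family
    [h ^ x = h ^+ k.+1] lifts only to itself once x has order at least 4. Among the exceptional
    2-groups of order parameter at least 8 only the one with both flags false can lift, and its
    lifts differ by two bits; at order 4 it is the only one present. So four of them arise at each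
    2^e with e >= 3, which explains 8 | n and the summand 4. Across primes the obstacle is to see
    that y_q normalizes <x_p>: induction gives this only up to an error in <y_p>, which is removed
    by comparing orders prime to p ([iso_diag]). That equal invariants give isomorphic embeddings is
    not read off a presentation. The relations pass to direct products and by themselves imply
    <x><y> = <y><x>; applied to (x, x') and (y, y') this gives one rewriting x^i y^j = y^a x^b valid
    in both groups, and these rewritings determine the map. *)

Definition isobicyclic (n : nat) (gT : finGroupType) (x t : gT) :=
  [/\ t * t = 1, #[x] = n, <[x]> :&: <[x ^ t]> = 1
    & commute (<[x]> : {set gT}) <[x ^ t]>].

Definition bigrp (gT : finGroupType) (x y : gT) : {group gT} :=
  (<[x]> <*> <[y]>)%G.

Lemma mem_bigrp_l (gT : finGroupType) (x y : gT) : x \in bigrp x y.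
Proof. by rewrite mem_gen // inE cycle_id. Qed.

Lemma mem_bigrp_r (gT : finGroupType) (x y : gT) : y \in bigrp x y.
Proof. by rewrite mem_gen // inE cycle_id orbT. Qed.

Lemma bigrp_sub (gT : finGroupType) (x y : gT) (H : {group gT}) :
  x \in H -> y \in H -> bigrp x y \subset H.
Proof. by move=> xH yH; rewrite join_subG !cycle_subG xH. Qed.

Section Isobicyclic.
Variables (n : nat) (gT : finGroupType) (x t : gT).
Hypothesis iso : isobicyclic n x t.
Local Notation y := (x ^ t).
Local Notation G := (bigrp x y).

Lemma iso_tK u : (u ^ t) ^ t = u.
Proof. by case: iso => tt _ _ _; rewrite -conjgM tt conjg1. Qed.

Lemma iso_ordx : #[x] = n. Proof. by case: iso. Qed.
Lemma iso_ordy : #[y] = n. Proof. by rewrite orderJ iso_ordx. Qed.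
Lemma iso_gt0 : 0 < n. Proof. by rewrite -iso_ordx order_gt0. Qed.

Lemma iso_ti i j : x ^+ i = y ^+ j -> x ^+ i = 1 /\ y ^+ j = 1.
Proof.
move=> e; have: x ^+ i \in <[x]> :&: <[y]>.
  by rewrite inE mem_cycle e mem_cycle.
by case: iso => _ _ -> _; rewrite -e => /set1P.
Qed.

Lemma iso_Gmul : G = <[x]> * <[y]> :> {set gT}.
Proof. by case: iso => _ _ _ c; rewrite /= comm_joingE. Qed.

Lemma iso_Gmulr : G = <[y]> * <[x]> :> {set gT}.
Proof. by case: iso => _ _ _ c; rewrite iso_Gmul. Qed.

Lemma iso_GP g : g \in G -> exists i j, g = x ^+ i * y ^+ j.
Proof.
by rewrite iso_Gmul => /mulsgP[_ _ /cycleP[i ->] /cycleP[j ->] ->]; exists i, j.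
Qed.

Lemma iso_GrP g : g \in G -> exists i j, g = y ^+ i * x ^+ j.
Proof.
by rewrite iso_Gmulr => /mulsgP[_ _ /cycleP[i ->] /cycleP[j ->] ->]; exists i, j.
Qed.

Lemma iso_card : #|G| = (n * n)%N.
Proof.
case: (iso) => _ ox ti _.
by rewrite iso_Gmul TI_cardMg // -!orderE ox orderJ ox.
Qed.

Lemma iso_Gt : t \in 'N(G).
Proof.
apply/normP; apply/eqP; rewrite eqEcard cardJg leqnn andbT.
apply/subsetP=> _ /imsetP[g gG ->].
have [i [j ->]] := iso_GP gG.
rewrite conjMg !conjXg iso_tK.
by rewrite groupM ?groupX ?mem_bigrp_l ?mem_bigrp_r.
Qed.

(** The subgroup is found inside [C], the intersection of <x> with its conjugate under y. This is
    normal because a cyclic group has one subgroup of each order. Were it trivial, counting would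
    make the group the product of <x> and <x>^y, and solving y = x^i y^-1 x^j y puts y in <x>. *)
Lemma iso_core : 1 < n ->
  exists2 p, prime p & (p %| n) /\ <[x ^+ (n %/ p)]> <| G.
Proof.
move=> n1; case: (iso) => tt ox ti cm.
pose C := (<[x]> :&: <[x]> :^ y)%G.
have Cx : C \subset <[x]> by apply: subsetIl.
have nC : G \subset 'N(C).
  apply: bigrp_sub.
    by apply: (subsetP (sub_abelian_norm (cycle_abelian x) Cx)); rewrite cycle_id.
  rewrite -groupV; apply/normP/eqP.
  rewrite (eq_subG_cyclic (cycle_cyclic x) _ Cx) ?cardJg //=.
  by rewrite conjIg conjsgK subsetIr.
have C1 : #|C| != 1%N.
  apply/negP => /eqP/card1_trivg C1.
  have eG : G = <[x]> * (<[x]> :^ y) :> {set gT}.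
    apply/eqP; rewrite eq_sym eqEcard; apply/andP; split.
      rewrite mul_subG ?cycle_subG ?mem_bigrp_l //.
      by rewrite -cycleJ cycle_subG groupJ ?mem_bigrp_l ?mem_bigrp_r.
    by rewrite (@TI_cardMg _ <[x]> (<[x]> :^ y)%G C1) cardJg iso_card -orderE ox.
  have : y \in G by apply: mem_bigrp_r.
  rewrite eG => /mulsgP[_ _ /cycleP[i ->] /imsetP[_ /cycleP[j ->] ->] e].
  have {}e : y = x ^+ (j + i).
    have e1 : 1 = x ^+ i * (y^-1 * x ^+ j).
      by apply: (mulIg y); rewrite mul1g -!mulgA {1}e conjgE !mulgA.
    have : y = x ^+ j * x ^+ i.
      have := congr1 (fun g => (x ^+ i)^-1 * g * (x ^+ j)^-1) e1.
      by rewrite /= mulg1 mulKg mulgK -invMg => /invg_inj.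
    by rewrite -expgD.
  have := iso_ti (esym e : x ^+ _ = y ^+ 1) => -[_ y1].
  by move: n1; rewrite -iso_ordy -[y]expg1 y1 order1.
have [p pp pC] : exists2 p, prime p & p %| #|C|.
  by exists (pdiv #|C|); rewrite ?pdiv_dvd // pdiv_prime // ltn_neqAle eq_sym C1 cardG_gt0.
have pn : p %| n by rewrite -ox; apply: dvdn_trans pC _; rewrite orderE cardSg.
exists p => //; split=> //.
have [c cC oc] := Cauchy pp pC.
have eC : <[x ^+ (n %/ p)]> = <[c]>.
  apply/eqP; rewrite (eq_subG_cyclic (cycle_cyclic x)) ?cycleX //; last first.
    by rewrite cycle_subG (subsetP Cx).
  rewrite -!orderE oc orderXdiv ox ?dvdn_div //.
  by rewrite divnA // mulKn ?iso_gt0.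
have sC : <[x ^+ (n %/ p)]> \subset C by rewrite eC cycle_subG.
rewrite /normal (subset_trans sC) /=; last first.
  by rewrite (subset_trans Cx) // cycle_subG mem_bigrp_l.
apply: char_norm_trans nC; rewrite sub_cyclic_char //.
exact: cyclicS Cx (cycle_cyclic x).
Qed.
End Isobicyclic.

Section Quotient.
Variables (n : nat) (gT : finGroupType) (x t : gT) (p : nat).
Hypothesis iso : isobicyclic n x t.
Hypotheses (pp : prime p) (pn : p %| n).
Local Notation y := (x ^ t).
Local Notation G := (bigrp x y).
Local Notation z := (x ^+ (n %/ p)).
Local Notation w := (y ^+ (n %/ p)).
Hypothesis nz : <[z]> <| G.
Definition isoker : {group gT} := (<[z]> <*> <[w]>)%G.
Local Notation Z := isoker.

Lemma iso_zt : z ^ t = w. Proof. by rewrite conjXg. Qed.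

Lemma iso_nw : <[w]> <| G.
Proof.
rewrite -iso_zt cycleJ.
have /normP <- := iso_Gt iso.
by rewrite normalJ.
Qed.

Lemma iso_oz : #[z] = p.
Proof.
rewrite orderXdiv (iso_ordx iso) ?dvdn_div // divnA // mulKn //.
exact: iso_gt0 iso.
Qed.

Lemma iso_ow : #[w] = p. Proof. by rewrite -iso_zt orderJ iso_oz. Qed.

Lemma iso_zwti : <[z]> :&: <[w]> = 1.
Proof.
apply/trivgP; case: iso => _ _ <- _.
by rewrite setISS // cycleX.
Qed.

Lemma iso_zw : commute z w.
Proof.
have : <[w]> \subset 'C(<[z]>).
  apply/commG1P/trivgP.
  rewrite -iso_zwti setIC commg_subI // subsetI subxx /=.
    exact: subset_trans (normal_sub iso_nw) (normal_norm nz).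
  exact: subset_trans (normal_sub nz) (normal_norm iso_nw).
move/subsetP/(_ _ (cycle_id _))/centP/(_ _ (cycle_id _)).
exact: commute_sym.
Qed.

Lemma iso_nZ : Z <| G.
Proof. by rewrite normalY ?nz ?iso_nw. Qed.

Lemma iso_NZG : G \subset 'N(Z). Proof. exact: normal_norm iso_nZ. Qed.

Lemma iso_NZx : x \in 'N(Z). Proof. exact: (subsetP iso_NZG _ (mem_bigrp_l _ _)). Qed.
Lemma iso_NZy : y \in 'N(Z). Proof. exact: (subsetP iso_NZG _ (mem_bigrp_r _ _)). Qed.

Lemma isoker_mul : Z = <[z]> * <[w]> :> {set gT}.
Proof.
rewrite /= comm_joingE //; apply: centC.
by rewrite cycle_subG; apply/centP=> _ /cycleP[j ->]; apply/commuteX/iso_zw.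
Qed.

Lemma isoker_z i : z ^+ i \in Z.
Proof. exact: subsetP (joing_subl _ _) _ (mem_cycle _ _). Qed.

Lemma isoker_w i : w ^+ i \in Z.
Proof. exact: subsetP (joing_subr _ _) _ (mem_cycle _ _). Qed.

Lemma isokerP g : g \in Z -> exists i j, g = z ^+ i * w ^+ j.
Proof.
rewrite isoker_mul => /mulsgP[_ _ /cycleP[i ->] /cycleP[j ->] ->].
by exists i, j.
Qed.

Lemma iso_NZt : t \in 'N(Z).
Proof.
rewrite /= norm_joinEr ?(subset_trans _ (normal_norm nz)) //; last first.
  exact: normal_sub iso_nw.
have e : <[z]> * <[w]> = <[z]> <*> <[w]> by rewrite -isoker_mul.
rewrite inE e /=.
rewrite -genJ gen_subG conjUg subUset -!cycleJ iso_zt -iso_zt (iso_tK iso) iso_zt.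
by rewrite !cycle_subG -/Z !mem_gen // inE cycle_id ?orbT.
Qed.

Lemma iso_cosetJ g : g \in 'N(Z) -> coset Z g ^ coset Z t = coset Z (g ^ t).
Proof. by move=> nzg; rewrite morphJ ?iso_NZt. Qed.

Lemma isoker_abelian : abelian Z.
Proof.
rewrite abelianY !cycle_abelian /= cycle_subG; apply/centP=> _ /cycleP[j ->].
exact/commuteX/commute_sym/iso_zw.
Qed.

Lemma isoker_powx k : x ^+ k \in Z -> x ^+ k \in <[z]>.
Proof.
case/isokerP=> i [j e].
have : z ^- i * x ^+ k \in <[x]> :&: <[y]>.
  rewrite inE groupM ?groupV ?groupX ?cycle_id //= e mulKg.
  by rewrite !groupX ?cycle_id.
case: iso => _ _ -> _ /set1P/(canRL (mulKVg _)).
by rewrite mulg1 => ->; rewrite mem_cycle.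
Qed.

Lemma isoker_prodE i j : x ^+ i * y ^+ j \in Z -> x ^+ i \in Z /\ y ^+ j \in Z.
Proof.
case/isokerP=> k [l e0].
have e : y ^+ j * w ^- l = (x ^+ i)^-1 * z ^+ k.
  by apply: (mulgI (x ^+ i)); rewrite mulgA e0 mulKVg mulgK.
have : (x ^+ i)^-1 * z ^+ k \in <[x]> :&: <[y]>.
  rewrite inE groupM ?groupV ?groupX ?cycle_id //=.
  by rewrite -e !groupM ?groupV ?groupX ?cycle_id.
have zZ := isoker_z k.
have wZ := isoker_w l.
move=> h; move: (h) e; case: iso => _ _ ti _.
rewrite ti => /set1P e1; rewrite e1 => e2; split.
  by rewrite -[x ^+ i]mulg1 -e1 mulKVg.
by rewrite -[y ^+ j](mulgKV (w ^+ l)) e2 mul1g.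
Qed.

Lemma iso_ordcoset : #[coset Z x] = n %/ p.
Proof.
have zZ : z \in Z by have := isoker_z 1.
have : coset Z x ^+ (n %/ p) = 1 by rewrite -morphX ?iso_NZx //= coset_id.
move/eqP; rewrite -order_dvdn => d1.
apply/eqP; rewrite eqn_dvd d1 /=.
have /eqP := expg_order (coset Z x); rewrite -morphX ?iso_NZx // => /eqP.
move/coset_idr => /(_ (groupX _ iso_NZx)) /isoker_powx /cycleP[i].
move/eqP; rewrite -expgM eq_expg_mod_order (iso_ordx iso) => /eqP e.
have d : n %/ p %| n by rewrite dvdn_div.
rewrite /dvdn -(modn_dvdm _ d) e modn_dvdm //.
by rewrite modnMr.
Qed.

Lemma iso_quot : isobicyclic (n %/ p) (coset Z x) (coset Z t).
Proof.
case: (iso) => tt ox ti cm; split.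
- by rewrite -morphM ?iso_NZt // tt morph1.
- exact: iso_ordcoset.
- rewrite iso_cosetJ ?iso_NZx //; apply/trivgP/subsetP=> g.
  rewrite inE => /andP[/cycleP[i ->] /cycleP[j]].
  rewrite -!morphX ?iso_NZx ?iso_NZy // => /rcoset_kercosetP.
  case/(_ (groupX _ iso_NZx) (groupX _ iso_NZy))/rcosetP=> k kZ e.
  suff : x ^+ i \in Z by move=> h; apply/set1P; apply: coset_id.
  have : x ^+ i * y ^+ (#[y] - j %% #[y]) \in Z.
    rewrite e -mulgA.
    suff -> : y ^+ j * y ^+ (#[y] - j %% #[y]) = 1 by rewrite mulg1.
    rewrite -expgD; apply/eqP; rewrite -order_dvdn /dvdn -modnDml.
    by rewrite subnKC ?modnn // ltnW // ltn_mod order_gt0.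
  by case/isoker_prodE.
- rewrite iso_cosetJ ?iso_NZx // /commute.
  have e a : a \in 'N(Z) -> <[coset Z a]> = coset Z @* <[a]>.
    by move=> aN; rewrite morphim_cycle.
  rewrite !e ?iso_NZx ?iso_NZy // -!morphimMl ?cycle_subG ?iso_NZx ?iso_NZy //.
  by rewrite cm.
Qed.

Lemma iso_cosetE a b : a \in 'N(Z) -> b \in 'N(Z) -> coset Z a = coset Z b ->
  exists i j, a = b * (z ^+ i * w ^+ j).
Proof.
move=> aN bN /rcoset_kercosetP-/(_ aN bN).
rewrite norm_rlcoset // => /lcosetP[k /isokerP[i [j ->]] ->].
by exists i, j.
Qed.
End Quotient.

Lemma iso_sol (n : nat) (gT : finGroupType) (x t : gT) :
  isobicyclic n x t -> solvable (bigrp x (x ^ t)).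
Proof.
elim/ltn_ind: n gT x t => n IH gT x t iso.
have [n1|n1] := leqP n 1.
  have -> : bigrp x (x ^ t) = 1%G; last exact: solvable1.
  apply/trivGP; rewrite subG1 trivg_card_le1 (iso_card iso).
  exact: (leq_mul n1 n1).
have [p pp [pn nz]] := iso_core iso n1.
have nlt : n %/ p < n by rewrite ltn_Pdiv ?prime_gt1 // ltnW.
rewrite (series_sol (iso_nZ iso nz)) abelian_sol ?(isoker_abelian iso) //=.
have := IH _ nlt _ _ _ (iso_quot iso pn nz).
rewrite (iso_cosetJ iso) ?(iso_NZx iso) //.
congr (is_true (solvable _)).
rewrite /= quotientY ?cycle_subG ?(iso_NZx iso) ?(iso_NZy iso) //.
by rewrite !quotient_cycle ?(iso_NZx iso) ?(iso_NZy iso).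
Qed.

(** Hall's theorems put x_pi in a Hall subgroup and y_pi in a conjugate of it. Writing the
    conjugating element as y^i x^j, the first factor centralizes y_pi and the second x_pi, so one
    conjugate [K] contains both; its order makes it the product of the two cyclic groups in either
    order. *)
Lemma iso_constt (n : nat) (gT : finGroupType) (x t : gT) (pi : nat_pred) :
  isobicyclic n x t -> isobicyclic (n`_pi) x.`_pi t.
Proof.
move=> iso; have sG := iso_sol iso.
case: (iso) => tt ox ti cm; split=> //.
- by rewrite order_constt ox.
- apply/trivgP; rewrite -ti setISS // cycle_subG.
    exact: cycle_constt.
  by rewrite -consttJ cycle_constt.
rewrite -consttJ.
have ga : x.`_pi \in bigrp x (x ^ t).
  by rewrite (subsetP _ _ (cycle_constt _ _)) // cycle_subG mem_bigrp_l.
have gb : (x ^ t).`_pi \in bigrp x (x ^ t).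
  by rewrite (subsetP _ _ (cycle_constt _ _)) // cycle_subG mem_bigrp_r.
have pa : pi.-group <[x.`_pi]> by apply: p_elt_constt.
have pb : pi.-group <[(x ^ t).`_pi]> by apply: p_elt_constt.
have sa : <[x.`_pi]> \subset bigrp x (x ^ t) by rewrite cycle_subG.
have sb : <[(x ^ t).`_pi]> \subset bigrp x (x ^ t) by rewrite cycle_subG.
have [H hH aH] := Hall_superset sG sa pa.
have [g gG bH] := Hall_Jsub sG hH sb pb.
have [i [j eg]] := iso_GrP iso gG.
have ax : x.`_pi ^ x ^+ j = x.`_pi.
  apply/conjg_fixP/commgP; apply: (centsP (cycle_abelian x)).
    exact: cycle_constt.
  exact: mem_cycle.
have byy : (x ^ t).`_pi ^ (x ^ t) ^+ i = (x ^ t).`_pi.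
  apply/conjg_fixP/commgP; apply: (centsP (cycle_abelian (x ^ t))).
    exact: cycle_constt.
  exact: mem_cycle.
pose K := (H :^ (x ^- j))%G.
have aK : x.`_pi \in K by rewrite mem_conjgV ax -cycle_subG.
have bK : (x ^ t).`_pi \in K.
  have : (x ^ t).`_pi ^ g \in H by rewrite -cycle_subG cycleJ.
  by rewrite mem_conjgV eg conjgM byy.
have oK : #|K| = (n`_pi * n`_pi)%N.
  rewrite cardJg (card_Hall hH) (iso_card iso) partnM ?(iso_gt0 iso) //.
have tiab : <[x.`_pi]> :&: <[(x ^ t).`_pi]> = 1.
  by apply/trivgP; rewrite -ti setISS // cycle_subG cycle_constt.
have cK A B : A \in K -> B \in K -> <[A]> :&: <[B]> = 1 ->
    #[A] = (n`_pi)%N -> #[B] = (n`_pi)%N -> <[A]> * <[B]> = K.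
  move=> AK BK tiAB oA oB; apply/eqP.
  by rewrite eqEcard mul_subG ?cycle_subG //= TI_cardMg // -!orderE oA oB oK.
by rewrite /commute !cK // 1?setIC // order_constt ?orderJ ox.
Qed.

(** * Isobicyclic triples of prime power order *)

(** If h ^ x = h^c u with u central, these are the exponents of h and of u in (x h)^m; see
    [mulXgeo]. *)
Definition geo (c m : nat) := (\sum_(i < m) c ^ i)%N.
Definition geo2 (c m : nat) := (\sum_(i < m) geo c i)%N.

Lemma geoS c m : geo c m.+1 = (c * geo c m + 1)%N.
Proof.
rewrite /geo big_ord_recl expn0 addnC big_distrr /=.
by congr (_ + _)%N; apply: eq_bigr => i _; rewrite -expnS.
Qed.

Lemma geoSr c m : geo c m.+1 = (geo c m + c ^ m)%N.
Proof. by rewrite /geo big_ord_recr. Qed.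

Lemma geo0 c : geo c 0 = 0%N. Proof. by rewrite /geo big_ord0. Qed.

Lemma geoD c a b : geo c (a + b) = (geo c a + c ^ a * geo c b)%N.
Proof.
elim: b => [|b IH]; first by rewrite geo0 muln0 !addn0.
by rewrite addnS !geoSr IH mulnDr expnD addnA.
Qed.

Lemma geoM c a b : geo c (a * b) = (geo c a * geo (c ^ a) b)%N.
Proof.
elim: b => [|b IH]; first by rewrite muln0 !geo0 muln0.
rewrite mulnS addnC geoD IH geoSr -expnM mulnDr.
by rewrite [(c ^ _ * _)%N]mulnC.
Qed.

Lemma geo_mod p c m : c = 1 %[mod p] -> geo c m = m %[mod p].
Proof.
move=> c1; elim: m => [|m IH]; first by rewrite geo0.
rewrite geoS -modnDml -modnMm c1 IH modnMm mul1n modnDml addn1 //.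
Qed.

Lemma geo2_mod p c m : c = 1 %[mod p] -> geo2 c m = 'C(m, 2) %[mod p].
Proof.
move=> c1; rewrite -bin2_sum big_mkord /geo2.
elim: m => [|m IH]; first by rewrite !big_ord0.
by rewrite !big_ord_recr /= -modnDm IH (geo_mod _ c1) modnDm.
Qed.

Lemma exp1p_mod p s i : exists r, ((1 + p * s) ^ i = 1 + i * p * s + p * p * r)%N.
Proof.
elim: i => [|i [r IH]]; first by exists 0%N; rewrite expn0 !mul0n !addn0 muln0.
exists (r * (1 + p * s) + i * s * s)%N; rewrite expnSr IH; nia.
Qed.

Lemma geo1p_mod p s m :
  exists r, (geo (1 + p * s) m = m + 'C(m, 2) * p * s + p * p * r)%N.
Proof.
elim: m => [|m [r IH]]; first by exists 0%N; rewrite geo0 bin0n; lia.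
have [r' e] := exp1p_mod p s m.
exists (r + r')%N; rewrite geoSr IH e binS bin1; nia.
Qed.

(* The condition modulo 4 cannot be dropped: geo 3 2 = 4. *)
Lemma geo_prime p c : prime p -> c = 1 %[mod p] -> (p = 2 -> c = 1 %[mod 4]) ->
  exists2 u, geo c p = (p * u)%N & ~~ (p %| u).
Proof.
move=> pp c1 c2.
have c0 : 0 < c by case: c c1 {c2} => //; rewrite mod0n modn_small // prime_gt1.
have [p2|p2] := eqVneq p 2.
  exists ((1 + c) %/ 2)%N; first by rewrite p2 geoSr geoSr geo0 expn0 expn1; lia.
  by have := c2 p2; rewrite p2; lia.
have [s es] : exists s, c = (1 + p * s)%N.
  exists (c.-1 %/ p); rewrite mulnC divnK; first by rewrite add1n prednK.
  by move/eqP: c1; rewrite eqn_mod_dvd // subn1.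
have [r er] := geo1p_mod p s p.
have op : odd p by case: (even_prime pp) p2 => [->|].
have e2 := bin2odd op.
exists (1 + p * (p.-1./2 * s + r))%N; first by rewrite es er e2; nia.
rewrite /dvdn -modnDmr modnMr addn0 modn_small ?prime_gt1 //.
Qed.

(** Lifting the exponent: by [geoM] each factor p of d contributes a factor [geo (c ^ d') p], which
    is p times a number prime to p. *)
Lemma lte p c d j : prime p -> c = 1 %[mod p] -> (p = 2 -> c = 1 %[mod 4]) ->
  (p ^ j %| geo c d) = (p ^ j %| d).
Proof.
move=> pp; elim: j c d => [|j IH] c d c1 c2; first by rewrite !dvd1n.
have ep : (p %| geo c d) = (p %| d) by rewrite /dvdn (geo_mod _ c1).
have [/dvdnP[d' ->]|npd] := boolP (p %| d); last first.
  transitivity false; [|symmetry]; apply/negbTE; apply: contra npd.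
    by rewrite -ep expnS; apply: dvdn_trans; rewrite dvdn_mulr.
  by rewrite expnS; apply: dvdn_trans; rewrite dvdn_mulr.
rewrite geoM.
have c1' : c ^ d' = 1 %[mod p] by rewrite -modnXm c1 modnXm exp1n.
have c2' : p = 2 -> c ^ d' = 1 %[mod 4].
  by move=> /c2 e; rewrite -modnXm e modnXm exp1n.
have [u -> pu] := geo_prime pp c1' c2'.
rewrite expnS mulnCA [(d' * p)%N]mulnC !dvdn_pmul2l ?prime_gt0 //.
  by rewrite Gauss_dvdl ?IH // coprimeXl // prime_coprime.
Qed.

(** By [geo2_mod] this is, modulo p, the exponent of the central error in (x h)^(p^e); its vanishing
    is the divisibility hypothesis of [relC_step]. For p = 2 it takes e > 1, so the induction on
    2-groups starts at order 4. *)
Lemma p_dvd_bin2 p e : prime p -> odd p -> 0 < e -> p %| 'C(p ^ e, 2).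
Proof.
move=> pp op e0; rewrite bin2odd ?oddX ?op ?orbT // -(prednK e0) expnS -mulnA.
by rewrite dvdn_mulr.
Qed.

Lemma even_bin2 e : 1 < e -> 2 %| 'C(2 ^ e, 2).
Proof.
case: e => [|[|e]] // _; rewrite bin2 !expnS mulnA -[(2 * 2)%N]/4.
by have := expn_gt0 2 e; set m := (2 ^ e)%N; nia.
Qed.

Definition relC (N k : nat) (gT : finGroupType) (x y : gT) :=
  [/\ x ^+ N = 1, y ^+ N = 1, (x^-1 * y) ^+ N = 1
    & (x^-1 * y) ^ x = (x^-1 * y) ^+ k.+1].

(** In the groups intended, [s] is the product of the involutions of <x> and <y>, and is central;
    [a] and [b] tell whether it twists (x y)^2 = 1 and (y^2)^x = y^-2. *)
Definition relE (N : nat) (a b : bool) (gT : finGroupType) (x y : gT) :=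
  let s := x ^+ N./2 * y ^+ N./2 in
  [/\ x ^+ N = 1 /\ y ^+ N = 1,
      commute (x ^+ N./2) y /\ commute (y ^+ N./2) x,
      (x * y) ^+ 2 = s ^+ a
    & (y ^+ 2) ^ x = y ^- 2 * s ^+ b /\ (x ^+ 2) ^ y = x ^- 2 * s ^+ b].

Lemma mulXgeo (gT : finGroupType) (x h u : gT) (c m : nat) :
  commute u x -> commute u h -> h ^ x = h ^+ c * u ->
  (x * h) ^+ m = x ^+ m * h ^+ geo c m * u ^+ geo2 c m.
Proof.
move=> ux uh hx.
elim: m => [|m IH]; first by rewrite /geo2 geo0 big_ord0 !expg0 !mulg1.
set A := geo c m in IH *; set B := geo2 c m in IH *.
have -> : geo2 c m.+1 = (A + B)%N by rewrite /geo2 big_ord_recr addnC.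
have uxh : commute (u ^+ B) (x * h).
  exact: commute_sym (commuteX B (commute_sym (commuteM ux uh))).
have hu : commute (u ^+ A) h by apply/commute_sym/commuteX/commute_sym.
have hAx : h ^+ A * x = x * (h ^+ (c * A) * u ^+ A).
  rewrite conjgC conjXg hx expgMn ?expgM //.
  exact/commute_sym/commuteX.
rewrite expgSr IH -(mulgA _ _ (x * h)) uxh -!mulgA [h ^+ A * _]mulgA hAx.
by rewrite geoS expgD expg1 expgSr expgD -!mulgA [u ^+ A * (h * _)]mulgA hu !mulgA.
Qed.

Lemma expg_dvd (gT : finGroupType) (u : gT) a b : u ^+ a = 1 -> a %| b -> u ^+ b = 1.
Proof. by move=> u1 /dvdnP[k ->]; rewrite mulnC expgM u1 expg1n. Qed.

Lemma commute_conj (gT : finGroupType) (u g : gT) : commute u g -> u ^ g = u.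
Proof. by move=> c; rewrite conjgE c mulKg. Qed.

(** The first relation expresses y^x as x^-2 y^-1 S; squaring this and using the second gives
    (y^2)^x. Compared with the relations transported by t, the result forces the central errors in
    [relE_step] to be fixed by t. *)
Lemma sq_relations (gT : finGroupType) (x y S D : gT) :
  commute S x -> commute S y -> commute D x -> commute D y ->
  (x * y) ^+ 2 = S -> (x ^+ 2) ^ y = x ^- 2 * D ->
  (y * x) ^+ 2 = S /\ (y ^+ 2) ^ x = D^-1 * y ^- 2 * S ^+ 2.
Proof.
move=> Sx Sy Dx Dy e1 e2; split.
  rewrite -[RHS](commute_conj Sx) -e1 conjXg; congr (_ ^+ 2).
  by rewrite conjMg conjgE mulKg conjgE mulKVg.
have yx : y ^ x = (x ^- 2 * y^-1) * S.
  rewrite -mulgA -(commuteV Sy) -e1 conjgE.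
  by rewrite !expgS !expg0 !mulg1 !invMg -!mulgA !mulKg mulgV mulg1.
have Sxy : commute (x ^- 2 * y^-1) S.
  by apply/commute_sym/commuteM; apply: commuteV => //; apply: commuteX.
rewrite conjXg yx expgMn //; congr (_ * _).
have -> : (x ^- 2 * y^-1) ^+ 2 = x ^- 2 * ((x ^+ 2) ^ y)^-1 * y ^- 2.
  by rewrite conjgE !expgS !expg0 !mulg1 !invMg !invgK -!mulgA mulKVg.
have Dx2 : commute D (x ^- 2) by apply/commuteV/commuteX.
by rewrite e2 -Dx2 (invMg D) mulKVg.
Qed.

(** * Obstruction to lifting the exceptional 2-groups *)

Section NoLift.
Variables (gT : finGroupType) (G : {group gT}) (x y u v c d : gT).
Hypotheses (xG : x \in G) (yG : y \in G) (uG : u \in G) (vG : v \in G).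
Hypothesis (cinG : c \in G).
Hypotheses (cG : {in G, forall g, commute c g}) (dG : {in G, forall g, commute d g}).
Hypotheses (ux : u ^ x = u) (vx : v ^ x = v^-1 * c) (uv : commute u v).

(** The element x y commutes with its square u v d, but conjugation by it sends u v d to u^-1 v^-1
    d. In the application u and v are square roots of z and w, so the conclusion contradicts z w <>
    1 and excludes [a]. *)
Lemma nolift_sq : v ^ y = v -> u ^ y = u^-1 * c -> c * c = 1 ->
  (x * y) ^+ 2 = u * v * d -> u * u * (v * v) = 1.
Proof.
move=> vy uy cc e.
have cxy : commute (u * v * d) (x * y).
  by rewrite -e; apply/commute_sym/commuteX.
have dxy : commute d (x * y) by apply: dG; rewrite groupM.
have := commute_conj cxy.
rewrite !conjMg (commute_conj dxy) => /mulIg.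
rewrite !conjgM ux uy vx conjMg conjVg vy (commute_conj (cG yG)).
have -> : u^-1 * c * (v^-1 * c) = u^-1 * v^-1.
  rewrite -mulgA; congr (_ * _); rewrite mulgA (cG (groupVr vG)).
  by rewrite -mulgA cc mulg1.
move=> e'; rewrite -mulgA [u * (v * v)]mulgA -e' -mulgA mulVg mulg1.
exact: mulgV.
Qed.

(** This computes the commutator of y^2 with x^2. Applying t gives the commutator in the other
    order; the two are mutually inverse, which would force u^2 v^2 = 1. This excludes [b]. *)
Lemma nolift_conj : commute (y ^+ 2) u -> commute (y ^+ 2) v ->
    (y ^+ 2) ^ x = y ^- 2 * (u * v) * d ->
  (y ^+ 2) ^ (x ^+ 2) = y ^+ 2 * (v ^- 2 * c).
Proof.
move=> yu yv e.
have yB : commute (y ^+ 2) (u * v * d).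
  by do 2?[apply: commuteM => //]; apply/commute_sym/dG; rewrite groupX.
rewrite [x ^+ 2]expgS expg1 conjgM e -mulgA conjMg conjVg e !conjMg ux vx.
rewrite (commute_conj (dG xG)) -mulgA invMg invgK -(commuteV yB) -mulgA.
congr (_ * _).
have K : (u * v)^-1 * (u * (v^-1 * c)) = v ^- 2 * c.
  by rewrite invMg -!mulgA mulKg expgS expg1 invMg -!mulgA.
have dK : commute d (v ^- 2 * c).
  by apply: dG; rewrite groupM ?groupV ?groupX.
rewrite (invMg (u * v)) -mulgA.
by rewrite [(u * v)^-1 * _]mulgA K -dK mulKg.
Qed.
End NoLift.

Section CentralStep.
Variables (n : nat) (gT : finGroupType) (x t : gT) (p : nat).
Hypothesis iso : isobicyclic n x t.
Hypotheses (pp : prime p) (pn : p %| n).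
Local Notation y := (x ^ t).
Local Notation G := (bigrp x y).
Local Notation z := (x ^+ (n %/ p)).
Local Notation w := (y ^+ (n %/ p)).
Hypothesis nz : <[z]> <| G.
Hypothesis cz : forall g, g \in G -> commute z g.
Local Notation Z := (isoker n x t p).
Local Notation h := (x^-1 * y).

Lemma iso_cw g : g \in G -> commute w g.
Proof.
move=> gG; have gtG : g ^ t \in G by rewrite memJ_norm // (iso_Gt iso).
have := cz gtG; rewrite /commute => /(congr1 (conjg^~ t)).
by rewrite /= (conjMg z) (conjMg _ z) (iso_tK iso) (iso_zt n x t p).
Qed.

Lemma iso_zwX i j k l : z ^+ i * w ^+ j = z ^+ k * w ^+ l ->
  z ^+ i = z ^+ k /\ w ^+ j = w ^+ l.
Proof.
move=> e.
have e' : (z ^+ k)^-1 * z ^+ i = w ^+ l * (w ^+ j)^-1.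
  by apply: (mulgI (z ^+ k)); rewrite mulKVg mulgA -e mulgK.
have : (z ^+ k)^-1 * z ^+ i \in <[z]> :&: <[w]>.
  by rewrite inE {2}e' !groupM ?groupV ?mem_cycle.
rewrite (iso_zwti _ iso) => /set1P e1; split.
  by rewrite -[LHS](mulKVg (z ^+ k)) e1 mulg1.
by rewrite -[RHS](mulgKV (w ^+ j)) -e' e1 mul1g.
Qed.

Lemma iso_zp : z ^+ p = 1. Proof. by have := expg_order z; rewrite (iso_oz iso pn). Qed.
Lemma iso_wp : w ^+ p = 1. Proof. by have := expg_order w; rewrite (iso_ow iso pn). Qed.

Lemma iso_ht : h ^ t = h^-1.
Proof. by rewrite conjMg conjVg (iso_tK iso) [RHS]invMg invgK. Qed.

Lemma iso_coseth : (coset Z x)^-1 * coset Z x ^ coset Z t = coset Z h.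
Proof.
have xN := iso_NZx iso nz; have yN := iso_NZy iso nz.
by rewrite (iso_cosetJ iso nz xN) [RHS]morphM ?groupV // morphV.
Qed.

(** Lifting leaves a central error u in h ^ x. Since t inverts h it also inverts u, so u is a power
    of s = z^-1 w. Taking (n/p)-th powers in y = x h, where the divisibility hypothesis removes u,
    shows that s is a power of h. The error is then absorbed in k. *)
Lemma relC_step k : relC (n %/ p) k (coset Z x) (coset Z x ^ coset Z t) ->
    p %| geo2 k.+1 (n %/ p) ->
  exists j, relC n (k + j * geo k.+1 (n %/ p)) x y.
Proof.
move=> [_ _]; rewrite iso_coseth.
have xN := iso_NZx iso nz; have yN := iso_NZy iso nz.
have hN : h \in 'N(Z) by rewrite groupM ?groupV.
have xG : x \in G by apply: mem_bigrp_l.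
have yG : y \in G by apply: mem_bigrp_r.
have hG : h \in G by rewrite groupM ?groupV.
rewrite -!morphX // -morphJ // => hm hx pT.
have hmZ : h ^+ (n %/ p) \in Z by apply: coset_idr => //; rewrite groupX.
have [i [j]] := iso_cosetE iso nz (groupJ hN xN) (groupX k.+1 hN) hx.
set u := z ^+ i * w ^+ j => eh.
have cu g : g \in G -> commute u g.
  move=> gG; apply/commute_sym/commuteM; apply/commute_sym/commute_sym/commuteX.
    exact/commute_sym/cz.
  exact/commute_sym/iso_cw.
have hy : h ^ (x * h) = h ^+ k.+1 * u.
  by rewrite conjgM eh conjMg (commute_conj (cu _ hG)) conjXg conjgE mulKg.
rewrite mulKVg in hy.
have ut : u ^ t = z ^+ j * w ^+ i.
  rewrite conjMg !(conjXg _ t) (iso_tK iso).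
  exact/commuteX2/commute_sym/iso_zw.
have uu : u * (z ^+ j * w ^+ i) = 1.
  have e1 : (h ^ x) ^ t = u^-1 * (h ^+ k.+1)^-1.
    by rewrite conjJg iso_ht conjVg hy invMg.
  have e2 : (h ^+ k.+1 * u) ^ t = (h ^+ k.+1)^-1 * (z ^+ j * w ^+ i).
    by rewrite (conjMg _ u t) ut (conjXg h t) iso_ht expgVn.
  have {e1 e2} e : u^-1 * (h ^+ k.+1)^-1 = (z ^+ j * w ^+ i) * (h ^+ k.+1)^-1.
    rewrite -e1 eh e2.
    have hkG : (h ^+ k.+1)^-1 \in G by rewrite groupV groupX.
    apply: commuteM; apply: commuteX; apply: commute_sym; first exact: cz.
    exact: iso_cw.
  by move/mulIg: e => <-; rewrite mulgV.
have zij : z ^+ (i + j) = 1.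
  have : z ^+ (i + j) * w ^+ (i + j) = z ^+ 0 * w ^+ 0.
    rewrite !expg0 mulg1 -uu /u !expgD -!mulgA; congr (_ * _).
    rewrite [w ^+ j * _]mulgA -(commuteX2 j j (iso_zw iso nz)).
    by rewrite -!mulgA -!expgD addnC.
  by case/iso_zwX.
set s := z^-1 * w.
have us : u = s ^+ j.
  have sw : commute z^-1 w by apply/commute_sym/commuteV/commute_sym/iso_zw.
  rewrite expgMn // /u; congr (_ * _).
  by apply: (mulIg (z ^+ j)); rewrite -expgD zij expgVn mulVg.
have up : u ^+ p = 1.
  rewrite /u expgMn; last exact/commuteX2/iso_zw.
  by rewrite expgAC [(w ^+ j) ^+ p]expgAC iso_zp iso_wp !expg1n mulg1.
have sE : s = h ^+ geo k.+1 (n %/ p).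
  have := mulXgeo (n %/ p) (cu _ xG) (cu _ hG) eh.
  rewrite mulKVg (expg_dvd up pT) mulg1 => e.
  by rewrite /s e mulKg.
exists j; split.
- by rewrite -(iso_ordx iso) expg_order.
- by rewrite -(iso_ordy iso) expg_order.
- rewrite -{1}(divnK pn) expgM; case/(isokerP iso nz): hmZ => a [b ->].
  rewrite expgMn; last exact/commuteX2/iso_zw.
  by rewrite expgAC [(w ^+ b) ^+ p]expgAC iso_zp iso_wp !expg1n mulg1.
by rewrite eh us sE -expgM -expgD mulnC.
Qed.

Lemma iso_xG : x \in G. Proof. exact: mem_bigrp_l. Qed.
Lemma iso_yG : y \in G. Proof. exact: mem_bigrp_r. Qed.

Lemma iso_cZ i j g : g \in G -> commute (z ^+ i * w ^+ j) g.
Proof.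
move=> gG; apply/commute_sym/commuteM; apply/commuteX/commute_sym.
  exact: cz.
exact: iso_cw.
Qed.

Lemma iso_Zt i j : (z ^+ i * w ^+ j) ^ t = z ^+ j * w ^+ i.
Proof.
rewrite conjMg !(conjXg _ t) (iso_tK iso).
exact/commuteX2/commute_sym/iso_zw.
Qed.

Lemma iso_Zp i j : (z ^+ i * w ^+ j) ^+ p = 1.
Proof.
rewrite expgMn; last exact/commuteX2/iso_zw.
by rewrite expgAC [(w ^+ j) ^+ p]expgAC iso_zp iso_wp !expg1n mulg1.
Qed.

Lemma iso_z1 : z <> 1.
Proof. by move=> z1; have := iso_oz iso pn; rewrite z1 order1; case: (p) pp => [|[]]. Qed.

Hypothesis p2 : p = 2.

Lemma iso_ZV i j : (z ^+ i * w ^+ j)^-1 = z ^+ i * w ^+ j.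
Proof.
have := iso_Zp i j; move: (_ * _) => a; rewrite p2 => e.
by apply: (mulgI a); rewrite mulgV.
Qed.

Lemma iso_zwodd i : z ^+ i * w ^+ i = (z * w) ^+ odd i.
Proof.
rewrite -expgMn; last exact: iso_zw.
rewrite -{1}[i]odd_double_half expgD -muln2 mulnC expgM.
have := iso_Zp 1 1; rewrite !expg1; move: (_ * _) => a; rewrite p2 => ->.
by rewrite expg1n mulg1.
Qed.

(** By [sq_relations] the two errors in the kernel are fixed by t, hence are powers of z w with
    exponent 0 or 1: these are the two bits. *)
Lemma relE_step : relE (n %/ p) false false (coset Z x) (coset Z x ^ coset Z t) ->
  exists a b, relE n a b x y.
Proof.
have xN := iso_NZx iso nz; have yN := iso_NZy iso nz.
have [xG yG] := (iso_xG, iso_yG).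
move=> [_ _]; rewrite !expg0 !mulg1 (iso_cosetJ iso nz xN).
rewrite -morphM // -!(morphX _ _ xN, morphX _ _ yN, morphX _ _ (groupM xN yN)).
rewrite -!morphV ?groupX // -!morphJ ?groupX // => e1 [e2 e3].
have [i [j]] := iso_cosetE iso nz (groupX 2 (groupM xN yN)) (group1 _)
  (etrans e1 (esym (morph1 _))).
have [k [l]] := iso_cosetE iso nz (groupJ (groupX 2 yN) xN) (groupVr (groupX 2 yN)) e2.
rewrite mul1g => {e1 e2 e3} e2 e1.
have e1t : (y * x) ^+ 2 = z ^+ j * w ^+ i.
  by rewrite -iso_Zt -e1 (conjXg _ t) (conjMg _ _ t) (iso_tK iso).
have e2t : (x ^+ 2) ^ y = x ^- 2 * (z ^+ l * w ^+ k).
  have := congr1 (fun g => g ^ t) e2.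
  rewrite /= conjJg (conjMg _ (z ^+ k * _)) iso_Zt conjVg.
  by rewrite !(conjXg y t) (iso_tK iso).
have [e1x e2x] := sq_relations (iso_cZ i j xG) (iso_cZ i j yG) (iso_cZ l k xG)
  (iso_cZ l k yG) e1 e2t.
have [zij _] : z ^+ i = z ^+ j /\ w ^+ j = w ^+ i by apply: iso_zwX; rewrite -e1x.
have {}e1 : (x * y) ^+ 2 = z ^+ j * w ^+ j by rewrite e1 zij.
have S2 : (z ^+ i * w ^+ j) ^+ 2 = 1.
  by have := iso_Zp i j; move: (_ * _) => a; rewrite p2.
have [zkl wkl] : z ^+ k = z ^+ l /\ w ^+ l = w ^+ k.
  apply: iso_zwX; rewrite -[RHS]iso_ZV.
  apply: (mulgI (y ^- 2)); rewrite -e2 e2x S2 mulg1.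
  by apply/commuteV/commute_sym/commuteV/commute_sym/commuteX/iso_cZ.
exists (odd j), (odd l).
have n2 : n./2 = (n %/ p)%N by rewrite p2 divn2.
rewrite /relE n2; split.
- split; first by rewrite -(iso_ordx iso) expg_order.
  by rewrite -(iso_ordy iso) expg_order.
- by split; [apply: cz | apply: iso_cw].
- by rewrite e1 iso_zwodd.
- by rewrite e2 e2t zkl -wkl !iso_zwodd.
Qed.

Lemma iso_zw1 : z * w <> 1.
Proof.
by move=> e; have [|/iso_z1 //] := @iso_zwX 1 1 0 0; rewrite !expg1 !expg0 mulg1.
Qed.

Lemma relE_nolift a b : 16 %| n ->
    relE (n %/ p) a b (coset Z x) (coset Z x ^ coset Z t) ->
  a = false /\ b = false.
Proof.
have xN := iso_NZx iso nz; have yN := iso_NZy iso nz.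
have [xG yG] := (iso_xG, iso_yG).
move=> n16 [_ []]; rewrite (iso_cosetJ iso nz xN) /=.
(* k = n/8 is even because 16 | n. Raising the relations for x^2 and y^2 to the k-th power therefore
   kills the unknown errors, which lie in a central kernel of exponent 2, and leaves only the
   central element [c] below. *)
pose k := ((n %/ p)./2./2)%N.
have [ek kE] : ((n %/ p)./2 = 2 * k)%N /\ (k = 2 * k./2)%N.
  by rewrite /k p2; move: n16; clear; lia.
have em : (n %/ p = 2 * (n %/ p)./2)%N by rewrite p2; move: n16; clear; lia.
rewrite -!(morphX _ _ xN, morphX _ _ yN).
set u := x ^+ (n %/ p)./2; set v := y ^+ (n %/ p)./2.
have uN : u \in 'N(Z) by rewrite groupX.
have vN : v \in 'N(Z) by rewrite groupX.
have uG : u \in G by rewrite groupX.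
have vG : v \in G by rewrite groupX.
have ut : u ^ t = v by rewrite conjXg.
have vt : v ^ t = u by rewrite -ut (iso_tK iso).
have uu : u * u = z by rewrite -expgD {3}em mul2n addnn.
have vv : v * v = w by rewrite -expgD {3}em mul2n addnn.
rewrite -(morphM _ uN vN) -(morphM _ xN yN) -(morphX _ _ (groupM xN yN)).
rewrite -!(morphX _ _ (groupM uN vN)) -!morphV ?groupX // -!morphJ ?groupX //.
have uvN := groupX b (groupM uN vN).
rewrite -(morphM _ (groupVr (groupX 2 yN)) uvN).
rewrite -(morphM _ (groupVr (groupX 2 xN)) uvN).
move=> /commute_conj + _; rewrite -morphJ // => e4 e1 [e2 e3].
have [i4 [j4 {}e4]] := iso_cosetE iso nz (groupJ uN yN) uN e4.
have [i1 [j1 {}e1]] := iso_cosetE iso nz (groupX 2 (groupM xN yN))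
  (groupX a (groupM uN vN)) e1.
have [i2 [j2 {}e2]] := iso_cosetE iso nz (groupJ (groupX 2 yN) xN)
  (groupM (groupVr (groupX 2 yN)) (groupX b (groupM uN vN))) e2.
have [i3 [j3 {}e3]] := iso_cosetE iso nz (groupJ (groupX 2 xN) yN)
  (groupM (groupVr (groupX 2 xN)) (groupX b (groupM uN vN))) e3.
have cu2 : commute u (y ^+ 2).
  apply/commgP/conjg_fixP; rewrite [y ^+ 2]expgS expg1 conjgM e4 conjMg e4.
  rewrite (commute_conj (iso_cZ _ _ yG)) -mulgA.
  have := iso_Zp i4 j4; move: (_ * _) => g; rewrite p2 expgS expg1 => ->.
  by rewrite mulg1.
have cv2 : commute v (x ^+ 2).
  apply/commgP/conjg_fixP; rewrite -ut -[x in x ^+ 2](iso_tK iso) -conjXg -conjJg.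
  by congr (_ ^ _); apply/conjg_fixP/commgP.
have xk : u = (x ^+ 2) ^+ k by rewrite -expgM -ek.
have yk : v = (y ^+ 2) ^+ k by rewrite -expgM -ek.
have cuv : commute u v by rewrite yk; apply: commuteX.
pose c := (z * w) ^+ (b * k./2).
have cE : c = z ^+ (b * k./2) * w ^+ (b * k./2).
  by rewrite -expgMn //; apply: iso_zw.
have cG : {in G, forall g, commute c g} by move=> g gG; rewrite cE; apply: iso_cZ.
have cinG : c \in G by rewrite groupX // groupM // groupX.
have cc : c * c = 1.
  have := iso_Zp (b * k./2) (b * k./2); rewrite -cE.
  by move: (c) => g; rewrite p2 expgS expg1.
have uv2 : (u * v) ^+ 2 = z * w by rewrite expgMn // !expgS !expg0 !mulg1 uu vv.
have uy : u ^ y = u^-1 * c.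
  rewrite {1}xk conjXg e3.
  rewrite expgMn; last first.
    apply/commute_sym/iso_cZ; rewrite groupM ?groupV ?groupX ?groupM //.
  have -> : (z ^+ i3 * w ^+ j3) ^+ k = 1.
    rewrite kE; have := iso_Zp i3 j3; move: (_ * _) => g; rewrite p2 => g2.
    by rewrite expgM g2 expg1n.
  rewrite mulg1 expgMn; last first.
    apply/commuteX/commute_sym/commuteV/commute_sym/commuteM.
      exact: commuteX2.
    exact: commute_sym.
  rewrite expgVn -xk; congr (_ * _).
  by rewrite -expgM kE mulnCA expgM uv2.
have ct : c ^ t = c by rewrite cE iso_Zt.
have vx : v ^ x = v^-1 * c.
  have := congr1 (fun g => g ^ t) uy.
  by rewrite /= conjJg (conjMg _ c) ct conjVg ut (iso_tK iso).
have ux : u ^ x = u by apply/conjg_fixP/commgP/commute_sym/commuteX.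
have vy : v ^ y = v by apply/conjg_fixP/commgP/commute_sym/commuteX.
have dG i j : {in G, forall g, commute (z ^+ i * w ^+ j) g}.
  by move=> g gG; apply: iso_cZ.
split; apply/negbTE/negP.
  move=> aT; rewrite aT expg1 in e1.
  have := nolift_sq xG yG vG cG (dG i1 j1) ux vx vy uy cc e1.
  by rewrite uu vv; apply: iso_zw1.
move=> bT; rewrite bT expg1 in e2.
have cyu : commute (y ^+ 2) u by apply: commute_sym.
have cyv : commute (y ^+ 2) v by apply: commuteX2.
have ey := nolift_conj xG yG vG cinG (dG i2 j2) ux vx cyu cyv e2.
have vz : v ^- 2 = w^-1 by rewrite expgS expg1 vv.
rewrite vz in ey.
have ex : (x ^+ 2) ^ (y ^+ 2) = x ^+ 2 * (z^-1 * c).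
  have := congr1 (fun g => g ^ t) ey.
  rewrite /= conjJg (conjMg _ (w^-1 * c)) (conjMg _ c) ct (conjVg w).
  by rewrite -(iso_zt n x t p) !(iso_tK iso) !(conjXg _ t) !(iso_tK iso).
have e5 := conjgC (y ^+ 2) (x ^+ 2); rewrite ey [RHS]mulgA in e5.
have e6 := conjgC (x ^+ 2) (y ^+ 2); rewrite ex [RHS]mulgA in e6.
have {e5 e6} : (z^-1 * c) * (w^-1 * c) = 1.
  apply: (mulgI (y ^+ 2 * x ^+ 2)).
  by rewrite mulg1 mulgA -e6 -e5.
have wiG : w^-1 \in G by rewrite groupV groupX.
rewrite -mulgA (mulgA c) (cG _ wiG) -!mulgA cc mulg1 -invMg.
move/(congr1 invg); rewrite invgK invg1 -(iso_zw iso nz).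
exact: iso_zw1.
Qed.
End CentralStep.

Lemma iso_pcore (p e : nat) (gT : finGroupType) (x t : gT) (n := (p ^ e.+1)%N) :
    prime p -> isobicyclic n x t ->
  [/\ p %| n, <[x ^+ (n %/ p)]> <| bigrp x (x ^ t)
    & {in bigrp x (x ^ t), forall g, commute (x ^+ (n %/ p)) g}].
Proof.
move=> pp iso.
have pn : p %| n by rewrite /n expnS dvdn_mulr.
have n1 : 1 < n by rewrite (leq_trans (prime_gt1 pp)) // dvdn_leq ?expn_gt0 ?prime_gt0.
have [q qp [qn nz]] := iso_core iso n1.
have qE : q = p.
  by move: qn; rewrite Euclid_dvdX // dvdn_prime2 // => /andP[/eqP].
rewrite {q qp qn}qE in nz; split=> //.
set z := x ^+ _ in nz *.
have pG : p.-group (bigrp x (x ^ t)).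
  by rewrite /pgroup (iso_card iso) -expnD pnatX pnat_id.
have : <[z]> \subset 'Z(bigrp x (x ^ t)).
  have oz : #|<[z]>| = p by rewrite -orderE; apply: (iso_oz iso pn).
  apply: prime_meetG; first by rewrite oz.
  apply: meet_center_nil => //; first exact: pgroup_nil pG.
  by rewrite -cardG_gt1 oz prime_gt1.
rewrite cycle_subG => /centerP[_ cz] g gG; exact: cz.
Qed.

Lemma iso_prime (p : nat) (gT : finGroupType) (x t : gT) :
  prime p -> isobicyclic p x t -> relC p 0 x (x ^ t).
Proof.
move=> pp iso; have iso1 : isobicyclic (p ^ 1)%N x t by rewrite expn1.
have [_ _] := iso_pcore pp iso1.
rewrite expn1 divnn prime_gt0 // expg1 => cx.
have {}cx : commute x (x ^ t) by apply/cx/mem_bigrp_r.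
have xp : x ^+ p = 1 by rewrite -(iso_ordx iso) expg_order.
have yp : (x ^ t) ^+ p = 1 by rewrite -(iso_ordy iso) expg_order.
split=> //.
  by rewrite expgMn ?expgVn ?xp ?yp ?invg1 ?mulg1 //; apply/commute_sym/commuteV/commute_sym.
rewrite expg1; apply/commute_conj/commute_sym/commuteM => //.
exact/commuteV.
Qed.

Theorem pclass_odd (p e : nat) (gT : finGroupType) (x t : gT) :
    prime p -> odd p -> isobicyclic (p ^ e) x t ->
  exists2 k, p %| k & relC (p ^ e) k x (x ^ t).
Proof.
move=> pp op; elim: e gT x t => [|e IH] gT x t iso.
  have x1 : x = 1 by apply/eqP; rewrite -order_eq1 (iso_ordx iso).
  by exists 0%N => //; rewrite x1 conj1g /relC invg1 mulg1 conj1g !expg1n.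
have [pn nz cz] := iso_pcore pp iso.
have [e0|e0] := posnP e.
  by exists 0%N => //; move: iso; rewrite e0 expn1; apply: iso_prime.
have nE : (p ^ e.+1 %/ p = p ^ e)%N by rewrite expnS mulKn ?prime_gt0.
have := iso_quot iso pn nz; rewrite nE => /IH[k pk].
rewrite -{1}nE => /(relC_step iso pn nz cz).
have k1 : k.+1 = 1 %[mod p] by rewrite -add1n -modnDmr (eqP pk) addn0.
rewrite nE; case.
  by rewrite /dvdn (geo2_mod _ k1); apply: p_dvd_bin2.
move=> j rel; exists (k + j * geo k.+1 (p ^ e))%N => //.
rewrite dvdn_add // dvdn_mull // /dvdn (geo_mod _ k1) -(prednK e0) expnS.
by rewrite modnMr.
Qed.

(** With z = x^2 and w = y^2, comparing y x with x y forces (z w)^(i+j) = 1, so i = j. The value 0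
    gives the abelian group, the value 1 the exceptional one. *)
Lemma rel_four (gT : finGroupType) (x y : gT) (i j : bool) :
    x ^+ 4 = 1 -> y ^+ 4 = 1 -> commute (x ^+ 2) y -> commute (y ^+ 2) x ->
    x ^+ 2 * y ^+ 2 <> 1 ->
    y ^ x = y * ((x ^+ 2) ^+ i * (y ^+ 2) ^+ j) ->
    x ^ y = x * ((x ^+ 2) ^+ j * (y ^+ 2) ^+ i) ->
  relC 4 0 x y \/ relE 4 false false x y.
Proof.
move=> x4 y4 zy wx zw yx xy.
have z2 : x ^+ 2 * x ^+ 2 = 1 by rewrite -expgD.
have w2 : y ^+ 2 * y ^+ 2 = 1 by rewrite -expgD.
have czw : commute (x ^+ 2) (y ^+ 2) by apply: commuteX.
have e1 := conjgC y x; have e2 := conjgC x y.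
rewrite yx [RHS]mulgA in e1; rewrite xy [RHS]mulgA in e2.
have : (x ^+ 2) ^+ j * (y ^+ 2) ^+ i * ((x ^+ 2) ^+ i * (y ^+ 2) ^+ j) = 1.
  apply: (mulgI (y * x)); rewrite mulg1 mulgA -e2 -e1 //.
case: i j {e2} yx xy e1 => [] [] /=; rewrite ?expg1 ?expg0 ?mulg1 ?mul1g //; first last.
- move=> yx xy _ _; left; have cxy : commute x y by rewrite /commute conjgC xy.
  split=> //; last by apply/commute_conj/commute_sym/commuteM => //; apply: commuteV.
  rewrite expgMn ?expgVn ?x4 ?y4 ?invg1 ?mulg1 //.
  exact/commute_sym/commuteV/commute_sym.
- by move=> _ _ _ e; case: zw; rewrite czw.
move=> _ _ e1 e; right.
have cy : commute (x ^+ 2 * y ^+ 2) y.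
  by apply/commute_sym/commuteM; [apply: commute_sym | apply: commuteX].
have inv2 (g : gT) : g * g = 1 -> g^-1 = g.
  by move=> g2; apply: (mulgI g); rewrite mulgV.
split; rewrite -?[4./2]/2 ?expg0 ?mulg1 //.
  rewrite expgS expg1 -mulgA [y * _]mulgA e1 -[x * y * _ * y]mulgA cy.
  have sq (g : gT) : g * g = g ^+ 2 by [].
  by rewrite -(mulgA x y) (mulgA x x) (sq x) (mulgA y y) (sq y) (mulgA (x ^+ 2)) e.
by rewrite !commute_conj ?inv2.
Qed.

Lemma iso_four (gT : finGroupType) (x t : gT) : isobicyclic 4 x t ->
  relC 4 0 x (x ^ t) \/ relE 4 false false x (x ^ t).
Proof.
move=> iso.
have p2 : prime 2 by [].
have [] := @iso_pcore 2 1 _ _ _ p2 iso.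
rewrite -[(2 ^ 2)%N]/4 => pn nz cz.
have xN := iso_NZx iso nz; have yN := iso_NZy iso nz.
have [_ _ _] := iso_prime p2 (iso_quot iso pn nz).
have hN : x^-1 * x ^ t \in 'N(isoker 4 x t 2) by rewrite groupM ?groupV.
rewrite (iso_coseth iso nz) expg1 -morphJ // => e0.
have [i [j]] := iso_cosetE iso nz (groupJ hN xN) hN e0.
have [xG yG] := (iso_xG x t, iso_yG x t).
have wE k : ((x ^ t) ^+ 2) ^+ k = ((x ^ t) ^+ 2) ^+ odd k.
  rewrite -{1}[k]odd_double_half expgD -muln2 mulnC expgM.
  by rewrite (iso_wp iso pn) expg1n mulg1.
have zE k : (x ^+ 2) ^+ k = (x ^+ 2) ^+ odd k.
  rewrite -{1}[k]odd_double_half expgD -muln2 mulnC expgM.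
  by rewrite (iso_zp iso pn) expg1n mulg1.
have zw1 := iso_zw1 iso p2 pn.
have cw := iso_cw iso cz.
rewrite -[(4 %/ 2)%N]/2 zE wE in zw1 cw cz *.
set c := (_ ^+ odd i * _) => eh.
have yx : (x ^ t) ^ x = x ^ t * c.
  have := conjMg x (x^-1 * x ^ t) x.
  by rewrite mulKVg eh (conjgE x x) mulKg (mulgA x) mulKVg.
have xy : x ^ (x ^ t) = x * ((x ^+ 2) ^+ odd j * ((x ^ t) ^+ 2) ^+ odd i).
  have := congr1 (fun g => g ^ t) yx.
  rewrite /= conjJg (conjMg _ c) (iso_tK iso) => ->; congr (_ * _).
  by rewrite /c -zE -wE (iso_Zt iso nz) -zE -wE.
apply: rel_four yx xy => //.
- by rewrite -(iso_ordx iso) expg_order.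
- by rewrite -(iso_ordy iso) expg_order.
- exact: (cz _ yG).
exact: (cw _ xG).
Qed.

Theorem pclass_two (e : nat) (gT : finGroupType) (x t : gT) :
    1 < e -> isobicyclic (2 ^ e) x t ->
  (exists2 k, 4 %| k & relC (2 ^ e) k x (x ^ t)) \/
  (exists a b, relE (2 ^ e) a b x (x ^ t) /\ (e = 2 -> ~~ (a || b))).
Proof.
have p2 : prime 2 by [].
case: e => [|[|e]] // _; elim: e gT x t => [|e IH] gT x t iso.
  have [rel|rel] := iso_four iso; first by left; exists 0%N.
  by right; exists false, false.
have [pn nz cz] := iso_pcore p2 iso.
have nE : (2 ^ e.+3 %/ 2 = 2 ^ e.+2)%N by rewrite expnS mulKn.
have := iso_quot iso pn nz; rewrite nE => /IH[[k k4 rel]|[a [b [rel ab]]]].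
  left; rewrite -{1}nE in rel; have := relC_step iso pn nz cz rel.
  have k1 : k.+1 = 1 %[mod 4] by rewrite -add1n -modnDmr (eqP k4) addn0.
  have k2 : k.+1 = 1 %[mod 2] by rewrite -(@modn_dvdm 4 _ 2) // k1.
  rewrite nE; case.
    by rewrite /dvdn (geo2_mod _ k2); apply: even_bin2.
  move=> j rel'; exists (k + j * geo k.+1 (2 ^ e.+2))%N => //.
  rewrite dvdn_add // dvdn_mull // -[4]/(2 ^ 2)%N lte //.
  by rewrite dvdn_exp2l.
right.
have rel0 : relE (2 ^ e.+3 %/ 2) false false
    (coset (isoker (2 ^ e.+3) x t 2) x)
    (coset (isoker (2 ^ e.+3) x t 2) x ^ coset (isoker (2 ^ e.+3) x t 2) t).
  (* For a quotient of order parameter 4 the side condition on [e = 2] already makes both flags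
     false; beyond it 16 | n and [relE_nolift] applies. *)
  case: e {IH} => [|e] in iso pn nz cz nE rel ab *.
    by move: rel; rewrite -nE; case: a b ab => [] [] /(_ erefl).
  rewrite -nE in rel.
  have [|a0 b0] := relE_nolift iso p2 pn nz cz erefl _ rel.
    by rewrite -[16]/(2 ^ 4)%N dvdn_exp2l.
  by move: rel; rewrite a0 b0.
have [a' [b' rel']] := relE_step iso pn nz cz erefl rel0.
by exists a', b'.
Qed.

(** * Exponents by which one Sylow part acts on another *)

Lemma eqmod1P m c : 0 < c -> (c = 1 %[mod m]) <-> (m %| c.-1).
Proof.
move=> c0; rewrite -subn1; split; first by move/eqP; rewrite eqn_mod_dvd.
by move=> d; apply/eqP; rewrite eqn_mod_dvd.
Qed.

Lemma pow_geo c m : 0 < c -> ((c ^ m).-1 = c.-1 * geo c m)%N.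
Proof. by move=> c0; rewrite predn_exp. Qed.

(** c^k - 1 is (c - 1) times [geo c k], and the second factor is congruent to k modulo p, hence
    prime to p. *)
Lemma eqmod1_lift p a c k : prime p -> coprime k p -> c = 1 %[mod p] ->
  c ^ k = 1 %[mod p ^ a] -> c = 1 %[mod p ^ a].
Proof.
move=> pp kp c1; have c0 : 0 < c.
  by case: c c1 => //; rewrite mod0n modn_small // prime_gt1.
have ck0 : 0 < c ^ k by rewrite expn_gt0 c0.
rewrite !eqmod1P // pow_geo // Gauss_dvdl //.
rewrite coprime_sym coprimeXr //.
by rewrite coprime_sym prime_coprime // /dvdn (geo_mod _ c1) -/(dvdn p k)
  -prime_coprime // coprime_sym.
Qed.

Lemma expmod_gcd m c a b : 0 < a -> c ^ a = 1 %[mod m] -> c ^ b = 1 %[mod m] ->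
  c ^ gcdn a b = 1 %[mod m].
Proof.
move=> a0 ca cb; have [u v e _] := egcdnP b a0.
have h : c ^ (v * b + gcdn a b) = 1 %[mod m].
  by rewrite -e mulnC expnM -modnXm ca modnXm exp1n.
have h2 : c ^ (v * b) = 1 %[mod m] by rewrite mulnC expnM -modnXm cb modnXm exp1n.
by move: h; rewrite expnD -modnMml h2 modnMml mul1n.
Qed.

Lemma conj_expg_iter (gT : finGroupType) (u g : gT) k m :
  u ^ g = u ^+ k -> u ^ (g ^+ m) = u ^+ (k ^ m).
Proof.
move=> e; elim: m => [|m IH]; first by rewrite expg0 conjg1 expn0 expg1.
by rewrite expgSr conjgM IH conjXg e -expgM -expnS.
Qed.

Lemma conj_stab (gT : finGroupType) (x u g : gT) m :
  x ^ g = x * u -> u ^ g = u -> x ^ (g ^+ m) = x * u ^+ m.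
Proof.
move=> ex eu; elim: m => [|m IH]; first by rewrite expg0 conjg1 mulg1.
by rewrite expgSr conjgM IH conjMg ex conjXg eu -mulgA -expgS.
Qed.

(** The exponent by which g acts on u has order dividing both p^m and r - 1, which are coprime. *)
Lemma conj_prime_fix (gT : finGroupType) (u g : gT) (r p m : nat) :
    prime r -> prime p -> #[u] = r -> g ^+ (p ^ m) = 1 -> u ^ g \in <[u]> ->
  ~~ (p %| r.-1) -> u ^ g = u.
Proof.
move=> rp pp ou g1 /cycleP[k e] npr.
have kr : coprime k r.
  rewrite coprime_sym prime_coprime //; apply: contraL isT => /dvdnP[j ej].
  have : u ^ g = 1 by rewrite e ej mulnC expgM -ou expg_order expg1n.
  move/(congr1 (fun a => a ^ g^-1)); rewrite conjgK conj1g => u1.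
  by move: rp; rewrite -ou u1 order1.
have k1 : k ^ (p ^ m) = 1 %[mod r].
  apply/eqP; rewrite -ou -eq_expg_mod_order -(conj_expg_iter _ e) g1 conjg1 expg1.
  by [].
have k2 : k ^ r.-1 = 1 %[mod r].
  by have := Euler_exp_totient kr; rewrite totient_prime.
have := expmod_gcd _ k1 k2; rewrite expn_gt0 prime_gt0 // => /(_ isT).
have -> : gcdn (p ^ m) r.-1 = 1%N by apply/eqP; rewrite -/(coprime _ _) coprimeXl // prime_coprime.
rewrite expn1 => k3; rewrite e -[RHS]expg1; apply/eqP.
by rewrite eq_expg_mod_order ou k3.
Qed.

Lemma constt_expg (gT : finGroupType) (x : gT) (p : nat) :
  x.`_p ^+ (p ^ logn p #[x]) = 1.
Proof. by rewrite -p_part -order_constt expg_order. Qed.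

Lemma mem_constt_l (gT : finGroupType) (x y : gT) (p : nat) : x.`_p \in bigrp x y.
Proof. by rewrite (subsetP _ _ (cycle_constt _ _)) // cycle_subG mem_bigrp_l. Qed.

Lemma mem_constt_r (gT : finGroupType) (x y : gT) (p : nat) : y.`_p \in bigrp x y.
Proof. by rewrite (subsetP _ _ (cycle_constt _ _)) // cycle_subG mem_bigrp_r. Qed.

Lemma normal_cycleJ (gT : finGroupType) (G : {group gT}) (u g : gT) :
  <[u]> <| G -> g \in G -> u ^ g \in <[u]>.
Proof.
move=> /andP[_ /subsetP nu] /nu /normP e.
have : u ^ g \in <[u]> :^ g by rewrite memJ_conjg cycle_id.
by rewrite e.
Qed.

Lemma commute_cycle (gT : finGroupType) (x u v : gT) :
  u \in <[x]> -> v \in <[x]> -> commute u v.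
Proof. by move=> ux vx; apply: (centsP (cycle_abelian x)). Qed.

Lemma expg_coprime1 (gT : finGroupType) (u : gT) a b :
  u ^+ a = 1 -> u ^+ b = 1 -> coprime a b -> u = 1.
Proof.
move=> /eqP ua /eqP ub cab; apply/eqP; rewrite -order_eq1 -dvdn1 -(eqP cab).
by rewrite dvdn_gcd !order_dvdn ua ub.
Qed.

Lemma conj_geo (gT : finGroupType) (x v g : gT) k m :
    x ^ g = x ^+ k * v -> v ^ g = v -> commute x v ->
  x ^ (g ^+ m) = x ^+ (k ^ m) * v ^+ geo k m.
Proof.
move=> ex ev cxv; elim: m => [|m IH].
  by rewrite expg0 conjg1 expn0 geo0 expg1 mulg1.
rewrite expgSr conjgM IH conjMg !conjXg ex ev expgMn; last first.
  exact/commute_sym/commuteX/commute_sym.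
by rewrite -expgM -expnS -mulgA -expgD geoSr [(geo k m + _)%N]addnC.
Qed.

(** Induction through the quotient by the kernel for a prime r of [iso_core] gives x_p ^ y_q = x_p^k
    z^i w^j. For r = q the error is a q-element and disappears in the p-part. For r = p the power of
    z is absorbed in x_p; then either w^j = 1 or the exponent K is 1 modulo p, and in that case the
    order of y_q, prime to p, kills w^j. *)
Lemma iso_diag (p q n : nat) (gT : finGroupType) (x t : gT) :
    prime p -> prime q -> q < p -> isobicyclic n x t ->
    (forall r, prime r -> r %| n -> r = p \/ r = q) ->
  x.`_p ^ (x ^ t).`_q \in <[x.`_p]>.
Proof.
move=> pp qp qltp; elim/ltn_ind: n gT x t => n IH gT x t iso nE.
have [n1|n1] := leqP n 1.
  have -> : x = 1.
    apply/eqP; rewrite -order_eq1 (iso_ordx iso).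
    by rewrite eqn_leq n1 -(iso_ordx iso) order_gt0.
  by rewrite constt1 conj1g.
have n0 := ltnW n1.
have [r rp [rn nz]] := iso_core iso n1.
have npr : ~~ (p %| r.-1).
  have rp' : r <= p by case: (nE r rp rn) => -> //; apply: ltnW.
  apply/negP=> /dvdn_leq; rewrite -subn1 subn_gt0 prime_gt1 // => /(_ isT).
  by rewrite subn1 leqNgt (leq_trans _ rp') // ltn_predL prime_gt0.
have cz := iso_NZx iso nz; have yN := iso_NZy iso nz.
have nw := iso_nw iso nz.
set y := x ^ t in nz yN nw *.
set z := x ^+ (n %/ r) in nz; set w := y ^+ (n %/ r) in nw.
set xp := x.`_p; set yq := y.`_q; set xq := x.`_q; set yp := y.`_p.
have yqG : yq \in bigrp x y by apply: mem_constt_r.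
have xpG : xp \in bigrp x y by apply: mem_constt_l.
have xqG : xq \in bigrp x y by apply: mem_constt_l.
have xpN : xp \in 'N(isoker n x t r) by apply: (subsetP (iso_NZG iso nz)).
have yqN : yq \in 'N(isoker n x t r) by apply: (subsetP (iso_NZG iso nz)).
have oz : #[z] = r by apply: iso_oz iso rn.
have ow : #[w] = r by apply: iso_ow iso rn.
have zw : commute z w by apply: iso_zw iso nz.
have xp1 : xp ^+ (p ^ logn p n) = 1 by rewrite -(iso_ordx iso) constt_expg.
have xq1 : xq ^+ (q ^ logn q n) = 1 by rewrite -(iso_ordx iso) constt_expg.
have yq1 : yq ^+ (q ^ logn q n) = 1 by rewrite -(iso_ordy iso) constt_expg.
have xpz : commute xp z.
  by apply: (@commute_cycle _ x); [apply: cycle_constt | apply: mem_cycle].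
have xpw : commute xp w.
  apply/commute_sym/commgP/conjg_fixP.
  apply: (@conj_prime_fix _ _ _ r p (logn p n)) => //.
    exact: normal_cycleJ nw xpG.
have [i [j [k e]]] : exists i j k, xp ^ yq = xp ^+ k * (z ^+ i * w ^+ j).
  have lt : n %/ r < n by rewrite ltn_Pdiv ?prime_gt1.
  have H r' : prime r' -> r' %| n %/ r -> r' = p \/ r' = q.
    by move=> r'p r'n; apply: nE => //; apply: dvdn_trans r'n _; apply: dvdn_div.
  have := IH _ lt _ _ _ (iso_quot iso rn nz) H.
  rewrite (iso_cosetJ iso nz cz) -/y -!morph_constt // -morphJ //.
  case/cycleP=> k.
  rewrite -morphX // => e0.
  have [i [j e]] := iso_cosetE iso nz (groupJ xpN yqN) (groupX k xpN) e0.
  by exists i, j, k.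
have [rq|rp'] : r = q \/ r = p by case: (nE r rp rn); [right | left].
  rewrite rq in z w nz nw oz ow zw xpz xpw i j e {npr cz yN xpN yqN}.
  set u := _ ^+ i * _ in e.
  have qu : p^'.-elt u.
    rewrite /p_elt (@pnat_dvd _ q) //; last by rewrite pnatE // !inE ltn_eqF.
    rewrite order_dvdn expgMn; last exact: commuteX2.
    by rewrite expgAC -oz expg_order expg1n mul1g oz -ow expgAC expg_order expg1n.
  have cu : commute (xp ^+ k) u.
    by apply: commute_sym; apply: commuteX; apply: commute_sym; apply: commuteM; apply: commuteX.
  have pe : p.-elt (xp ^ yq) by rewrite p_eltJ p_elt_constt.
  rewrite -(constt_p_elt pe) e consttM // consttX (constt1P qu) mulg1.
  by rewrite groupX // cycle_constt.
rewrite rp' in rn z w nz nw oz ow zw xpz xpw i j e {npr cz yN xpN yqN}.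
pose m := (n %/ p)%N.
have pelt (v : gT) : #[v] = p -> v.`_p = v.
  by move=> ov; rewrite constt_p_elt // /p_elt ov pnat_id.
have zE : z = xp ^+ m by rewrite -[LHS]pelt // /z consttX.
have wE : w = yp ^+ m by rewrite -[LHS]pelt // /w consttX.
have oxp : #[xp] = (p ^ logn p n)%N by rewrite order_constt (iso_ordx iso) p_part.
have a0 : 0 < logn p n by rewrite logn_gt0 mem_primes pp n0.
have [a1|a1] := eqVneq (logn p n) 1%N.
  suff zxp : <[z]> = <[xp]> by rewrite zxp in nz; apply: normal_cycleJ nz yqG.
  apply/eqP; rewrite eqEcard {1}zE cycleX //= -!orderE oz oxp a1 expn1 leqnn //.
have pm : p %| m.
  have pn2 : p ^ 2 %| n by rewrite pfactor_dvdn //; case: (logn p n) a0 a1 => [|[]].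
  by rewrite /m -(divnK pn2) expnS expn1 mulnA mulnK ?dvdn_mull // prime_gt0.
have xpt : xp ^ t = yp by rewrite -consttJ.
have yqt : yq ^ t = xq by rewrite -consttJ (iso_tK iso).
have ypt : yp ^ t = xp by rewrite -xpt (iso_tK iso).
have zt : z ^ t = w by rewrite conjXg.
have wt : w ^ t = z by rewrite -zt (iso_tK iso).
have {e} [K e] : exists K, xp ^ yq = xp ^+ K * w ^+ j.
  by exists (k + m * i)%N; rewrite e zE expgD (expgM xp) mulgA.
have et : yp ^ xq = yp ^+ K * z ^+ j.
  have := congr1 (fun g => g ^ t) e.
  by rewrite /= conjJg (conjMg (xp ^+ K)) (conjXg xp) (conjXg w) xpt yqt wt.
have ypz : commute yp z.
  by have := congr1 (fun g => g ^ t) xpw; rewrite /= (conjMg w) (conjMg xp) xpt wt.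
have wp : w ^+ p = 1 by rewrite -ow expg_order.
have zp : z ^+ p = 1 by rewrite -oz expg_order.
have wxq : w ^ xq = w ^+ K.
  rewrite {1}wE conjXg et expgMn; last exact: commuteX2.
  rewrite (expgAC yp) -wE (expgAC z) (_ : z ^+ m = 1) ?expg1n ?mulg1 //.
  exact: expg_dvd zp pm.
have wyq : w ^ yq = w.
  apply/commute_conj/(@commute_cycle _ y); [exact: mem_cycle | exact: cycle_constt].
have xpxq : xp ^ xq = xp.
  by apply/commute_conj/(@commute_cycle _ x); apply: cycle_constt.
have isoq := iso_constt q iso; rewrite -/xq in isoq.
(* [c] lies in <x_q><y_q>, whose order is prime to p, yet it multiplies x_p by an element of <w>
   that it fixes. That element is therefore trivial, which gives K j = j modulo p. *)
pose g1 := xq * yq; pose g2 := yq * xq; pose c := g2 * g1^-1.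
have yqE : yq = xq ^ t by rewrite -yqt (iso_tK iso).
pose M := ((n`_q) * (n`_q))%N.
have cM : c ^+ M = 1.
  rewrite /M -(iso_card isoq) -yqE; apply/eqP; rewrite -order_dvdn.
  apply: order_dvdG.
  by rewrite !groupM ?groupV ?groupM ?mem_bigrp_l ?mem_bigrp_r.
have Mp : coprime M p.
  rewrite /M coprimeMl andbb p_part coprimeXl // prime_coprime // dvdn_prime2 //.
  by rewrite ltn_eqF.
have xpg1 : xp ^ g1 = xp ^+ K * w ^+ j by rewrite conjgM xpxq.
have xpg2 : xp ^ g2 = xp ^+ K * w ^+ (K * j).
  by rewrite conjgM e conjMg (conjXg xp) (conjXg w) xpxq wxq expgM.
have wg1 : w ^ g1 = w ^+ K by rewrite conjgM wxq (conjXg w) wyq.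
have wg2 : w ^ g2 = w ^+ K by rewrite conjgM wyq wxq.
have wc : w ^ c = w by rewrite conjgM wg2 -wg1 conjgK.
pose v := w ^- j * w ^+ (K * j).
have xpc : xp ^ c = xp * v ^ g1^-1.
  rewrite conjgM -[in RHS](conjgK g1 xp) -conjMg xpg1 xpg2 /v.
  by rewrite -!mulgA mulKVg.
have vw : v \in <[w]> by rewrite groupM ?groupV ?mem_cycle.
have /cycleP[l vl] : v ^ g1^-1 \in <[w]>.
  case/cycleP: vw => l ->; rewrite (conjXg w) groupX //.
  by apply: normal_cycleJ nw _; rewrite groupV groupM.
have vc : (v ^ g1^-1) ^ c = v ^ g1^-1 by rewrite vl (conjXg w) wc.
have v1 : v = 1.
  have := conj_stab M xpc vc; rewrite cM conjg1 -{1}[xp]mulg1 => /mulgI /esym vM.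
  have := expg_coprime1 vM _ Mp; rewrite vl -expgM mulnC expgM wp expg1n => /(_ erefl) w1.
  by rewrite -[v](conjgKV g1) vl w1 conj1g.
have jK : (K * j = j %[mod p])%N.
  apply/eqP; rewrite -ow -eq_expg_mod_order; apply/eqP.
  by apply: (mulgI (w ^- j)); rewrite mulVg.
have [wj|wj] := eqVneq (w ^+ j) 1; first by rewrite e wj mulg1 mem_cycle.
have pj : coprime j p.
  by rewrite coprime_sym prime_coprime // -ow order_dvdn.
have K0 : 0 < K.
  case: (K) jK => // /esym; rewrite mul0n mod0n => /eqP pdj.
  by move: pj; rewrite coprime_sym prime_coprime // /dvdn pdj.
have K1 : K = 1 %[mod p].
  apply/eqmod1P => //; rewrite -(@Gauss_dvdl _ _ j) ?[coprime p j]coprime_sym //.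
  rewrite -subn1 mulnBl mul1n -eqn_mod_dvd ?leq_pmull //.
  exact/eqP.
have wjq : (w ^+ j) ^ yq = w ^+ j by rewrite (conjXg w) wyq.
have := conj_geo (q ^ logn q n) e wjq (commuteX j xpw).
rewrite yq1 conjg1; set N := (q ^ _)%N in yq1 * => e1.
(* Since y_q^N = 1, an element of <x> equals an element of <y>, so both are trivial. *)
have [xN1 _] : xp ^+ (K ^ N).-1 = 1 /\ (w ^+ j) ^+ geo K N = 1.
  have KN : 0 < K ^ N by rewrite expn_gt0 K0.
  have e2 : xp ^+ (K ^ N).-1 * (w ^+ j) ^+ geo K N = 1.
    apply: (mulgI xp); rewrite mulgA -expgS prednK // mulg1.
    by rewrite -e1.
  have : xp ^+ (K ^ N).-1 \in <[x]> :&: <[y]>.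
    rewrite inE groupX ?cycle_constt //= -[X in X \in _](mulgK ((w ^+ j) ^+ geo K N)).
    by rewrite e2 mul1g groupV !groupX // cycle_id.
  case: (iso) => _ _ -> _ /set1P h; split=> //.
  by rewrite h mul1g in e2.
have Np : coprime N p.
  by rewrite coprimeXl // prime_coprime // dvdn_prime2 // ltn_eqF.
have K2 : K = 1 %[mod p ^ logn p n].
  apply: (eqmod1_lift pp Np K1).
  have KN : 0 < K ^ N by rewrite expn_gt0 K0.
  by apply/eqmod1P => //; rewrite -oxp order_dvdn xN1.
have xK : xp ^+ K = xp.
  by rewrite -[RHS]expg1; apply/eqP; rewrite eq_expg_mod_order oxp K2.
rewrite xK in e.
have := conj_stab N e wjq; rewrite yq1 conjg1 -{1}[xp]mulg1 => /mulgI /esym wN.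
have := expg_coprime1 wN _ Np; rewrite expgAC wp expg1n => /(_ erefl) w1.
by rewrite w1 eqxx in wj.
Qed.

Lemma mod_cancel m c i j : coprime c m -> i <= j -> c ^ i = c ^ j %[mod m] ->
  c ^ (j - i) = 1 %[mod m].
Proof.
move=> cm ij e; have [c0|c0] := posnP c.
  by move: cm; rewrite c0 /coprime gcd0n => /eqP->; rewrite !modn1.
apply/eqmod1P; first by rewrite expn_gt0 c0.
rewrite -(@Gauss_dvdr _ (c ^ i)); last by rewrite coprime_sym coprimeXl.
rewrite -subn1 mulnBr muln1 -expnD subnKC // -eqn_mod_dvd ?leq_pexp2l //.
exact/eqP/esym.
Qed.

Lemma conjX_order (gT : finGroupType) (x g : gT) (c m : nat) :
  x ^ g = x ^+ c -> g ^+ m = 1 -> c ^ m = 1 %[mod #[x]].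
Proof.
move=> e gm; apply/eqP; rewrite -eq_expg_mod_order -(conj_expg_iter _ e) gm.
by rewrite conjg1 expg1.
Qed.

(** * Constraints that the type of a part puts on the actions *)

Section RelC.
Variables (N k : nat) (gT : finGroupType) (x t : gT).
Hypotheses (iso : isobicyclic N x t) (rel : relC N k x (x ^ t)).
Local Notation h := (x^-1 * x ^ t).

Lemma relC_norm : x \in 'N(<[h]>).
Proof.
apply/normP/eqP; rewrite eqEcard cardJg leqnn andbT -cycleJ cycle_subG.
by case: rel => _ _ _ ->; rewrite mem_cycle.
Qed.

(** The group has order N^2 and is the product of <x> and <h>, while h^N = 1: counting leaves no
    room for an intersection. *)
Lemma relC_h : #[h] = N /\ <[x]> :&: <[h]> = 1.
Proof.
have hN : #[h] %| N by rewrite order_dvdn; case: rel => _ _ ->.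
have hx : <[x]> \subset 'N(<[h]>) by rewrite cycle_subG relC_norm.
have eG : bigrp x (x ^ t) = <[x]> * <[h]> :> {set gT}.
  apply/eqP; rewrite eqEsubset -norm_joinEl //; apply/andP; split.
    have xJ : x \in <[x]> <*> <[h]> by rewrite -cycle_subG joing_subl.
    have hJ : h \in <[x]> <*> <[h]> by rewrite -cycle_subG joing_subr.
    have := groupM xJ hJ; rewrite mulKVg => yJ.
    exact: bigrp_sub.
  by rewrite join_subG !cycle_subG mem_bigrp_l groupM ?groupV ?mem_bigrp_l ?mem_bigrp_r.
have := mul_cardG <[x]> <[h]>.
rewrite -eG (iso_card iso) -!orderE (iso_ordx iso).
have N0 := iso_gt0 iso.
have hle := dvdn_leq N0 hN.
have := cardG_gt0 (<[x]> :&: <[h]>)%G => /=; set c := #|_ :&: _|.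
move=> c0 e.
have e' : (#[h] = N * c)%N by apply/eqP; rewrite -(eqn_pmul2l N0) mulnA e.
have c1 : c = 1%N.
  apply/eqP; rewrite eqn_leq c0 andbT -(leq_pmul2l N0) muln1 -e' //.
by split; [rewrite e' c1 muln1 | apply/card1_trivg].
Qed.

(** Modulo <h> the group is cyclic on x, still of order N, and [h ^ g] becomes x^(c-1). Conjugating
    h ^ x = h^(k+1) by g and passing to this abelian quotient gives x^(k(c-1)) = 1. *)
Lemma relC_aut (g : gT) (c : nat) : 0 < c -> x ^ g = x ->
  (x ^ t) ^ g = (x ^ t) ^+ c -> N %| k * c.-1.
Proof.
move=> c0 xg yg; have [oh ti] := relC_h.
have hx : <[x]> \subset 'N(<[h]>) by rewrite cycle_subG relC_norm.
have xN := relC_norm.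
have hN : h \in 'N(<[h]>) by rewrite (subsetP (normG _)) ?cycle_id.
have yN := groupM xN hN; rewrite mulKVg in yN.
have yx : coset <[h]> (x ^ t) = coset <[h]> x.
  have := morphM (coset <[h]>) xN hN.
  by rewrite mulKVg [X in _ = _ * X]coset_id ?cycle_id // mulg1.
have hg : h ^ g = x^-1 * (x ^ t) ^+ c by rewrite conjMg conjVg xg yg.
have ch : coset <[h]> (h ^ g) = coset <[h]> x ^+ c.-1.
  rewrite hg (morphM _ (groupVr xN) (groupX c yN)) (morphV _ xN) (morphX _ c yN) /= yx.
  by rewrite -{1}(prednK c0) expgS mulKg.
have hgN : h ^ g \in 'N(<[h]>) by rewrite hg groupM ?groupV ?groupX.
have : (h ^ g) ^ x = (h ^ g) ^+ k.+1.
  case: rel => _ _ _ /(congr1 (fun a => a ^ g)).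
  by rewrite /= (conjJg h x) (conjXg h) xg.
move/(congr1 (coset <[h]>)).
rewrite (morphJ _ hgN xN) (morphX _ k.+1 hgN) /= ch (conjXg (coset _ x)).
rewrite (conjgE (coset _ x)) mulKg => e.
have {e} : coset <[h]> (x ^+ (k * c.-1)) = 1.
  rewrite (morphX _ _ xN) mulnC expgM; apply: (mulgI (coset <[h]> x ^+ c.-1)).
  by rewrite mulg1 -expgS -e.
move/coset_idr => /(_ (groupX _ xN)) xh.
have : x ^+ (k * c.-1) \in <[x]> :&: <[h]> by rewrite inE mem_cycle.
by rewrite ti => /set1P/eqP; rewrite -order_dvdn (iso_ordx iso).
Qed.
End RelC.

(* The type of a q-part of order q ^ e: [inl k] stands for the relation
   h ^ x = h ^+ k.+1, and the four values [inr (a, b)] for the exceptional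
   2-groups.  The x_q- and y_q-actions on the other parts have exponents l with
   l ^ (q ^ ltexp) = 1. *)
Definition ltype (m : nat) := ('I_m + bool * bool)%type.

Definition relT (m N : nat) (tau : ltype m) (gT : finGroupType) (x y : gT) :=
  match tau with inl k => relC N k x y | inr ab => relE N ab.1 ab.2 x y end.

Definition ltexp (m q e : nat) (tau : ltype m) : nat :=
  match tau with inl k => logn q (gcdn k (q ^ e)) | inr _ => 1 end.

(** The bound [k < q ^ e] makes k unique, since h has order q ^ e. The index bound [m] is later
    always [n], so that one type serves all primes. *)
Definition ltype_ok (m q e : nat) (tau : ltype m) : bool :=
  match tau with
  | inl k => [&& k < q ^ e, q %| k & (q == 2) ==> (4 %| k)]
  | inr _ => q == 2
  end.

Lemma half_mul8 N : 8 %| N -> (N./2 * 2 = N)%N /\ (N./2 = 4 * (N %/ 8))%N.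
Proof.
case/dvdnP=> k ->; rewrite mulnK //.
have -> : (k * 8 = (4 * k).*2)%N by rewrite -mul2n mulnA mulnC.
by rewrite doubleK muln2.
Qed.

Section Action.
Variables (gT : finGroupType) (u x y : gT) (c : nat).
Hypotheses (ux : u ^ x = u) (uy : u ^ y = u ^+ c).
Hypothesis ou : coprime c #[u].

(** As x acts trivially on u, both h and h ^ x act by the exponent c, and h ^ x = h^(k+1) gives
    c^(k+1) = c. *)
Lemma act_relC N k : relC N k x y -> c ^ k = 1 %[mod #[u]].
Proof.
move=> [_ _ _ hx].
have uxV : u ^ x^-1 = u by rewrite -{1}ux conjgK.
have uh : u ^ (x^-1 * y) = u ^+ c by rewrite conjgM uxV.
have : u ^ ((x^-1 * y) ^ x) = u ^+ c by rewrite (conjgE _ x) !conjgM !uxV uy (conjXg u) ux.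
rewrite hx (conj_expg_iter _ uh) => /eqP; rewrite eq_expg_mod_order.
rewrite -{2}[c]expn1 => /eqP/esym/mod_cancel-/(_ ou).
by rewrite subn1; apply.
Qed.

(** The relation (x y)^2 = s^a reads c^2 = c^(a N/2), so c^4 = c^(a N) = 1; as 4 divides N/2, the
    right side is 1. *)
Lemma act_relE N a b : 8 %| N -> c ^ N = 1 %[mod #[u]] -> relE N a b x y ->
  c ^ 2 = 1 %[mod #[u]].
Proof.
move=> N8 cN [_ _ e _].
have us : u ^ (x ^+ N./2 * y ^+ N./2) = u ^+ (c ^ N./2).
  rewrite conjgM (_ : u ^ (x ^+ _) = u) ?(conj_expg_iter _ uy) //.
  by rewrite -[RHS]expg1 -[in RHS](exp1n N./2); apply: conj_expg_iter; rewrite expg1.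
have uxy : u ^ (x * y) = u ^+ c by rewrite conjgM ux.
have := conj_expg_iter 2 uxy; rewrite e (conj_expg_iter _ us) -expnM => /eqP.
rewrite eq_expg_mod_order => /eqP e2.
have c4 : c ^ 4 = 1 %[mod #[u]].
  rewrite -[4]/(2 * 2)%N expnM -modnXm -e2 modnXm -expnM mulnAC.
  by rewrite (half_mul8 N8).1 expnM -modnXm cN modnXm exp1n.
by rewrite -e2 (half_mul8 N8).2 -mulnA expnM -modnXm c4 modnXm exp1n.
Qed.
End Action.

Lemma act_relT (gT : finGroupType) (u x y : gT) (c m q e : nat) (tau : ltype m) :
    prime q -> u ^ x = u -> u ^ y = u ^+ c -> coprime c #[u] ->
    (q = 2 -> 8 %| q ^ e) -> ltype_ok q e tau ->
    c ^ (q ^ e) = 1 %[mod #[u]] -> relT (q ^ e) tau x y ->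
  c ^ (q ^ ltexp q e tau) = 1 %[mod #[u]].
Proof.
move=> qp ux uy cu q8 tok ce; case: tau tok => [k _|ab /eqP q2] /= rel.
  have := expmod_gcd _ ce (act_relC ux uy cu rel).
  rewrite expn_gt0 prime_gt0 // => /(_ isT); rewrite gcdnC.
  suff -> : gcdn k (q ^ e) = (q ^ logn q (gcdn k (q ^ e)))%N by rewrite pfactorK.
  have : gcdn k (q ^ e) %| q ^ e by apply: dvdn_gcdr.
  by case/(dvdn_pfactor _ _ qp)=> i _ ->; rewrite pfactorK.
by rewrite expn1 q2; apply: act_relE rel => //; apply: q8.
Qed.

Lemma relC_mod N k (gT : finGroupType) (x y : gT) :
  relC N k x y -> relC N (k %% N) x y.
Proof.
case=> xN yN hN hx; split=> //; rewrite hx !expgSr; congr (_ * _).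
by rewrite expg_mod.
Qed.

Lemma logn_dvd_gt0 n q : 0 < n -> prime q -> q %| n -> 0 < logn q n.
Proof. by move=> n0 qp qn; rewrite logn_gt0 mem_primes qp n0. Qed.

Lemma coprime_pow1 c k m : 0 < k -> c ^ k = 1 %[mod m] -> coprime c m.
Proof.
by move=> k0 e; rewrite -(coprime_pexpl _ _ k0) -coprime_modl e coprime_modl coprime1n.
Qed.

Section Structure.
Variables (n : nat) (gT : finGroupType) (x t : gT).
Hypothesis iso : isobicyclic n x t.
Hypothesis n8 : 8 %| n.
Local Notation y := (x ^ t).

Let n0 : 0 < n. Proof. exact: iso_gt0 iso. Qed.

Lemma iso_yconstt (q : nat) : x.`_q ^ t = y.`_q.
Proof. by rewrite consttJ. Qed.

Lemma iso_opart (q : nat) : #[x.`_q] = (q ^ logn q n)%N.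
Proof. by rewrite order_constt (iso_ordx iso) p_part. Qed.

Lemma iso_part (q : nat) : isobicyclic (q ^ logn q n) x.`_q t.
Proof. by rewrite -p_part; apply: iso_constt iso. Qed.

Lemma logn2_gt2 : 2 < logn 2 n.
Proof. by rewrite -pfactor_dvdn. Qed.

Lemma iso_type (q : nat) : prime q -> q %| n ->
  exists2 tau : ltype n, ltype_ok q (logn q n) tau
    & relT (q ^ logn q n) tau x.`_q y.`_q.
Proof.
move=> qp qn.
have e0 := logn_dvd_gt0 n0 qp qn.
have qe0 : 0 < q ^ logn q n by rewrite expn_gt0 prime_gt0.
have len : q ^ logn q n <= n by rewrite dvdn_leq // pfactor_dvdnn.
have kn k : k %% q ^ logn q n < n by rewrite (leq_trans _ len) // ltn_mod.
have qk k : q %| k -> q %| k %% q ^ logn q n.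
  by rewrite /dvdn modn_dvdm ?dvdn_exp.
have := iso_part q; have [q2|q2] := eqVneq q 2.
  rewrite q2 in qe0 len kn qk *.
  case/(pclass_two (ltnW logn2_gt2)); rewrite iso_yconstt.
    case=> k k4 /relC_mod rel; exists (inl (Ordinal (kn k))) => //=.
    rewrite ltn_mod qe0 qk ?(dvdn_trans _ k4) //=.
    by rewrite /dvdn modn_dvdm // (@dvdn_exp2l 2 2) // ltnW // logn2_gt2.
  by case=> a [b [rel _]]; exists (inr (a, b)).
case/(pclass_odd qp).
  by case: (even_prime qp) q2 => [->|].
rewrite iso_yconstt => k qdk /relC_mod rel.
exists (inl (Ordinal (kn k))) => //=.
by rewrite ltn_mod qe0 qk //= (negbTE q2).
Qed.

Lemma iso_lam (q p : nat) : prime q -> prime p -> q %| n -> p %| n -> q < p ->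
  exists c, [/\ 0 < c < p ^ logn p n, c ^ (q ^ logn q n) = 1 %[mod p ^ logn p n],
    x.`_p ^ y.`_q = x.`_p ^+ c & y.`_p ^ x.`_q = y.`_p ^+ c].
Proof.
(* Passing to the {p, q}-part meets the two-prime hypothesis of [iso_diag]. *)
move=> qp pp qn pn qltp; pose pi : nat_pred := [pred r | (r == p) || (r == q)].
have isopi := iso_constt pi iso.
have pp' : p \in pi by rewrite inE eqxx.
have qp' : q \in pi by rewrite inE eqxx orbT.
have sub (r : nat) (u : gT) : r \in pi -> (u.`_pi).`_r = u.`_r.
  by move=> rpi; apply: sub_in_constt => s _; rewrite inE => /eqP->.
have npi (r : nat) : prime r -> r %| (n`_pi)%N -> r = p \/ r = q.
  move=> rp rn; have := part_pnat pi n; rewrite /pnat => /andP[_ /allP/(_ r)].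
  rewrite mem_primes rp part_gt0 rn => /(_ isT); rewrite inE.
  by case/orP=> /eqP->; [left | right].
have := iso_diag pp qp qltp isopi npi; rewrite -(consttJ _ x t) !sub //.
case/cycleP=> c e.
have p1 : 1 < p ^ logn p n.
  by rewrite -(exp1n (logn p n)) ltn_exp2r ?prime_gt1 // logn_dvd_gt0.
have {}e : x.`_p ^ y.`_q = x.`_p ^+ (c %% p ^ logn p n).
  by rewrite -iso_opart expg_mod_order.
set c' := (c %% _)%N in e; exists c'.
have ce : c' ^ (q ^ logn q n) = 1 %[mod p ^ logn p n].
  rewrite -(iso_opart p); apply: conjX_order e _.
  rewrite -iso_yconstt -conjXg. by rewrite -iso_opart expg_order conj1g.
split=> //.
  rewrite ltn_mod (ltnW p1) andbT lt0n; apply/eqP=> c0.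
  move: ce; rewrite c0 exp0n ?expn_gt0 ?prime_gt0 // mod0n modn_small //.
have := congr1 (fun g => g ^ t) e.
by rewrite /= conjJg (conjXg x.`_p) !iso_yconstt -(iso_yconstt q) (iso_tK iso).
Qed.

End Structure.

(** * Invariants of an isobicyclic triple *)

Definition ltriv (m : nat) (tau : ltype m) : bool :=
  if tau is inl k then k == 0 :> nat else false.

(** These are relations only, with no exact orders and no trivial intersections. This is what makes
    them pass to images ([brel_morph]) and to direct products ([brel_pair]). *)
Definition brel (n : nat) (g : nat -> ltype n) (l : nat -> nat -> nat)
    (gT : finGroupType) (x y : gT) :=
  [/\ x ^+ n = 1, y ^+ n = 1,
      forall q : nat, q \in primes n -> relT (q ^ logn q n) (g q) x.`_q y.`_q
    & forall q p : nat, q \in primes n -> p \in primes n -> q < p ->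
      x.`_p ^ y.`_q = x.`_p ^+ l q p /\ y.`_p ^ x.`_q = y.`_p ^+ l q p].

(* [l q p <> 1] encodes an arc q -> p of the short subgraph. *)
Definition bgood (n : nat) (g : nat -> ltype n) (l : nat -> nat -> nat) :=
  [/\ forall q : nat, q \in primes n -> ltype_ok q (logn q n) (g q),
      forall q p : nat, q \in primes n -> p \in primes n -> q < p ->
        0 < l q p < p ^ logn p n /\
        l q p ^ (q ^ ltexp q (logn q n) (g q)) = 1 %[mod p ^ logn p n],
      forall q p : nat, q \in primes n -> p \in primes n -> q < p ->
        l q p != 1%N -> q %| p.-1 /\ ltriv (g p)
    & forall r q p : nat, r \in primes n -> q \in primes n -> p \in primes n ->
        r < q -> q < p -> l r q != 1%N -> l q p = 1%N].

Section Analysis.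
Variables (n : nat) (gT : finGroupType) (x t : gT).
Hypothesis iso : isobicyclic n x t.
Hypothesis n8 : 8 %| n.
Local Notation y := (x ^ t).
Let n0 : 0 < n. Proof. exact: iso_gt0 iso. Qed.

Lemma iso_primes2 (q : nat) : q \in primes n -> q = 2 -> 8 %| q ^ logn q n.
Proof.
by move=> _ ->; rewrite -[8]/(2 ^ 3)%N dvdn_exp2l // (logn2_gt2 iso n8).
Qed.

Lemma lam_eq1 (c p : nat) : prime p -> 0 < c < p ^ logn p n ->
  c = 1 %[mod p ^ logn p n] -> c = 1%N.
Proof.
move=> pp /andP[c0 cp]; rewrite modn_small //.
have [a0|a0] := posnP (logn p n).
  by move: cp; rewrite a0 expn0; case: (c) c0.
by rewrite modn_small // (leq_ltn_trans _ cp).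
Qed.

Section Pair.
Variables q p c : nat.
Hypotheses (qn : q \in primes n) (pn : p \in primes n) (qp : q < p).
Hypotheses (cb : 0 < c < p ^ logn p n) (ce : c ^ (q ^ logn q n) = 1 %[mod p ^ logn p n]).
Hypotheses (xy : x.`_p ^ y.`_q = x.`_p ^+ c) (yx : y.`_p ^ x.`_q = y.`_p ^+ c).

Let prp : prime p. Proof. by move: pn; rewrite mem_primes => /andP[]. Qed.
Let prq : prime q. Proof. by move: qn; rewrite mem_primes => /andP[]. Qed.
Let a0 : 0 < logn p n. Proof. by rewrite logn_gt0. Qed.
Let c0 : 0 < c. Proof. by case/andP: cb. Qed.
Let cpq : coprime (q ^ logn q n) p.
Proof. by rewrite coprimeXl // prime_coprime // dvdn_prime2 // ltn_eqF. Qed.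

Lemma lam_coprime : coprime c #[x.`_p].
Proof.
by rewrite (iso_opart iso); apply: coprime_pow1 ce; rewrite expn_gt0 prime_gt0.
Qed.

Lemma xpxq : x.`_p ^ x.`_q = x.`_p.
Proof. by apply/commute_conj/(@commute_cycle _ x); apply: cycle_constt. Qed.

Lemma lam_lift : c = 1 %[mod p] -> c = 1%N.
Proof. by move=> c1; apply: lam_eq1 cb (eqmod1_lift prp cpq c1 ce). Qed.

(** By [relC_aut] the order p^a of x_p divides k(c - 1). If k is not 0, then k < p^a makes p divide
    c - 1, and [lam_lift] gives c = 1. An exceptional type would mean p = 2, impossible for q <
    p. *)
Lemma lam_terminal (tau : ltype n) : ltype_ok p (logn p n) tau ->
  relT (p ^ logn p n) tau x.`_p y.`_p -> c != 1%N -> ltriv tau.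
Proof.
case: tau => [k|ab] /=; last by move/eqP=> p2; move: qp; rewrite p2; case: (q) prq => [|[]].
case/and3P=> kp _ _; rewrite -iso_yconstt => rel.
have := relC_aut (iso_part iso p) rel c0 xpxq; rewrite iso_yconstt => /(_ yx).
move=> d; apply: contraR => k0; apply/eqP/lam_lift.
apply/(eqmod1P _ c0); apply: contraLR isT => npc; apply/negP.
rewrite Gauss_dvdl in d; last by rewrite coprimeXl // prime_coprime.
by move/dvdn_leq: d; rewrite lt0n k0 leqNgt kp => /(_ isT).
Qed.

(** The order of c divides both a power of q and the totient of p^a; if q did not divide p - 1 these
    would be coprime. *)
Lemma lam_arc : c != 1%N -> q %| p.-1.
Proof.
apply: contraR => nqp; apply/eqP/(lam_eq1 prp cb).
have cp : coprime c (p ^ logn p n) by apply: coprime_pow1 ce; rewrite expn_gt0 prime_gt0.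
have := expmod_gcd _ ce (Euler_exp_totient cp).
rewrite expn_gt0 prime_gt0 // => /(_ isT).
suff -> : gcdn (q ^ logn q n) (totient (p ^ logn p n)) = 1%N by rewrite expn1.
apply/eqP; rewrite totient_pfactor //.
rewrite -/(coprime _ _) coprimeMr; apply/andP; split.
  by rewrite coprimeXl // prime_coprime.
by rewrite coprimeXr.
Qed.

Lemma lam_texp (tau : ltype n) : ltype_ok q (logn q n) tau ->
  relT (q ^ logn q n) tau x.`_q y.`_q ->
  c ^ (q ^ ltexp q (logn q n) tau) = 1 %[mod p ^ logn p n].
Proof.
move=> tok rel; rewrite -(iso_opart iso p).
apply: act_relT rel => //; rewrite ?(iso_opart iso p) //.
- exact: xpxq.
- by rewrite -(iso_opart iso p); apply: lam_coprime.
- exact: iso_primes2.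
Qed.
End Pair.

(** As x_r commutes with x_p, conjugating y_q by x_r does not change its action on x_p, so c^b = c.
    By [lam_lift], b <> 1 means that q does not divide b - 1; since c also has q-power order, c =
    1. *)
Lemma lam_nopath (r q p b c : nat) :
  r \in primes n -> q \in primes n -> p \in primes n -> r < q -> q < p ->
  0 < b < q ^ logn q n -> b ^ (r ^ logn r n) = 1 %[mod q ^ logn q n] ->
  0 < c < p ^ logn p n -> c ^ (q ^ logn q n) = 1 %[mod p ^ logn p n] ->
  y.`_q ^ x.`_r = y.`_q ^+ b -> x.`_p ^ y.`_q = x.`_p ^+ c ->
  b != 1%N -> c = 1%N.
Proof.
move=> rn qn pn rq qp bb be cb ce yr xq b1.
have prp : prime p by move: pn; rewrite mem_primes => /andP[].
have prq : prime q by move: qn; rewrite mem_primes => /andP[].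
have b0 : 0 < b by case/andP: bb.
have q0 : 0 < q ^ logn q n by rewrite expn_gt0 prime_gt0.
have xr : x.`_p ^ x.`_r = x.`_p.
  by apply/commute_conj/(@commute_cycle _ x); apply: cycle_constt.
have xrV : x.`_p ^ (x.`_r)^-1 = x.`_p by rewrite -{1}xr conjgK.
have : x.`_p ^ (y.`_q ^ x.`_r) = x.`_p ^+ c.
  by rewrite (conjgE _ x.`_r) !conjgM xrV xq conjXg xr.
rewrite yr (conj_expg_iter _ xq) => /eqP.
rewrite eq_expg_mod_order (iso_opart iso) -{2}[c]expn1 => /eqP/esym cc.
have cp : coprime c (p ^ logn p n) by apply: coprime_pow1 ce.
have {cc} := expmod_gcd q0 ce (mod_cancel cp b0 cc).
suff -> : gcdn (q ^ logn q n) (b - 1) = 1%N.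
  by rewrite expn1; apply: lam_eq1.
apply/eqP; rewrite -/(coprime _ _) coprimeXl // prime_coprime // subn1.
apply: contra b1 => /(eqmod1P _ b0) b1; apply/eqP.
exact: (lam_lift rn qn rq bb be b1).
Qed.

Theorem iso_analysis : exists (g : nat -> ltype n) l, brel g l x y /\ bgood g l.
Proof.
pose P (q : 'I_n.+1) (tau : ltype n) := (q : nat) \in primes n ->
    ltype_ok q (logn q n) tau /\ relT (q ^ logn q n) tau x.`_q y.`_q.
have [G GE] : exists G, forall q, P q (G q).
  apply: (@fin_all_exists _ (fun _ => ltype n) P) => q; rewrite /P.
  have [|nq] := boolP ((q : nat) \in primes n).
    rewrite mem_primes => /and3P[qp _ qn].
    by have [tau h1 h2] := iso_type iso n8 qp qn; exists tau.
  by exists (inl (Ordinal n0)).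
pose Q (a : 'I_n.+1 * 'I_n.+1) (c : nat) :=
    (a.1 : nat) \in primes n -> (a.2 : nat) \in primes n -> a.1 < a.2 ->
    [/\ 0 < c < a.2 ^ logn a.2 n,
        c ^ (a.1 ^ logn a.1 n) = 1 %[mod a.2 ^ logn a.2 n],
        x.`_a.2 ^ y.`_a.1 = x.`_a.2 ^+ c & y.`_a.2 ^ x.`_a.1 = y.`_a.2 ^+ c].
have [L LE] : exists L, forall a, Q a (L a).
  apply: (@fin_all_exists _ (fun _ => nat) Q) => -[q p]; rewrite /Q /=.
  have [/andP[] |nq] := boolP (((q : nat) \in primes n) && ((p : nat) \in primes n)); last first.
    by exists 0%N => qn pn; rewrite qn pn in nq.
  rewrite !mem_primes => /and3P[qp _ qn] /and3P[pp _ pn].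
  have [qltp|] := boolP (q < p); last by exists 0%N.
  by have [c] := iso_lam iso qp pp qn pn qltp; exists c.
have pl (q : nat) : q \in primes n -> (inord q : 'I_n.+1) = q :> nat.
  rewrite mem_primes => /and3P[_ _ qn].
  by rewrite inordK // ltnS dvdn_leq.
pose g q := G (inord q); pose l q p := L (inord q, inord p).
have gE q : q \in primes n ->
    ltype_ok q (logn q n) (g q) /\ relT (q ^ logn q n) (g q) x.`_q y.`_q.
  by move=> qn; have := GE (inord q); rewrite /P pl //; apply.
have lE q p : q \in primes n -> p \in primes n -> q < p ->
    [/\ 0 < l q p < p ^ logn p n,
        l q p ^ (q ^ logn q n) = 1 %[mod p ^ logn p n],
        x.`_p ^ y.`_q = x.`_p ^+ l q p & y.`_p ^ x.`_q = y.`_p ^+ l q p].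
  by move=> qn pn qp; have := LE (inord q, inord p); rewrite /Q /= !pl //; apply.
exists g, l; split; split.
- by rewrite -(iso_ordx iso) expg_order.
- by rewrite -(iso_ordy iso) expg_order.
- by move=> q /gE[].
- by move=> q p qn pn qp; have [] := lE q p qn pn qp.
- by move=> q /gE[].
- move=> q p qn pn qp; have [lb le xy yx] := lE q p qn pn qp; split=> //.
  have [ok rel] := gE q qn.
  exact: (lam_texp qn le xy ok rel).
- move=> q p qn pn qp l1; have [lb le xy yx] := lE q p qn pn qp; split.
    exact: (lam_arc qn pn qp lb le l1).
  have [ok rel] := gE p pn.
  exact: (lam_terminal qn pn qp lb le yx ok rel l1).
- move=> r q p rn qn pn rq qp.
  have [bb be _ by'] := lE r q rn qn rq.
  have [cb ce cx _] := lE q p qn pn qp.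
  exact: (lam_nopath rn qn pn rq qp bb be cb ce by' cx).
Qed.
End Analysis.

(** * The factorization as a consequence of the relations alone *)

Lemma sub_commute (gT : finGroupType) (A B : {group gT}) :
  A * B \subset B * A -> commute (A : {set gT}) B.
Proof.
move=> s; apply/eqP; rewrite eqEcard s /=.
have e : muln #|A * B| #|A :&: B| = muln #|B * A| #|A :&: B|.
  by rewrite -mul_cardG setIC -mul_cardG mulnC.
by move/eqP: e; rewrite eqn_pmul2r ?cardG_gt0 // => /eqP->.
Qed.

Lemma commute_cycles (gT : finGroupType) (x y : gT) :
  (forall i, x ^+ i * y \in <[y]> * <[x]>) -> commute (<[x]> : {set gT}) <[y]>.
Proof.
move=> h; apply: sub_commute; apply/subsetP=> _ /mulsgP[_ _ /cycleP[i ->] /cycleP[j ->] ->].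
elim: j i => [|j IH] i; first by rewrite expg0 mulg1 -[x ^+ i]mul1g mem_mulg ?group1 ?mem_cycle.
rewrite expgS mulgA; have /mulsgP[_ _ /cycleP[a ->] /cycleP[b ->] ->] := h i.
rewrite -mulgA; have /mulsgP[u v uy vx ->] := IH b.
by rewrite mulgA mem_mulg // groupM ?mem_cycle.
Qed.

Lemma commute_constt (gT : finGroupType) (x : gT) (B : {group gT}) :
  (forall p : nat, commute (<[x.`_p]> : {set gT}) B) -> commute (<[x]> : {set gT}) B.
Proof.
move=> h; apply: sub_commute; apply/subsetP=> _ /mulsgP[_ b /cycleP[i ->] bB ->].
rewrite -(prod_constt (x ^+ i)); elim: (index_iota _ _) b bB => [|p s IH] b bB.
  by rewrite big_nil mul1g -[b]mulg1 mem_mulg ?group1.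
rewrite big_cons -mulgA; have /mulsgP[b' v b'B vx ->] := IH b bB.
have : (x ^+ i).`_p * b' \in <[x.`_p]> * B by rewrite mem_mulg // consttX mem_cycle.
rewrite (h p : _ * _ = _) => /mulsgP[b'' u b''B ux e].
rewrite mulgA e -mulgA mem_mulg // groupM //.
by apply: (subsetP _ _ ux); rewrite cycle_subG cycle_constt.
Qed.

(** The map [geo c] is injective modulo p^e, because a difference of two values is c^b times
    [geo c (b' - b)] and [lte] applies. *)
Lemma geo_surj p e c i : prime p -> c = 1 %[mod p] -> (p = 2 -> c = 1 %[mod 4]) ->
  exists b, geo c b = i %[mod p ^ e].
Proof.
move=> pp c1 c2; have N0 : 0 < p ^ e by rewrite expn_gt0 prime_gt0.
pose f (b : 'I_(p ^ e)) : 'I_(p ^ e) := Ordinal (ltn_pmod (geo c b) N0).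
have cp : coprime (p ^ e) c.
  rewrite coprimeXl // coprime_sym /coprime -gcdn_modl c1 gcdn_modl.
  exact: coprime1n.
have finj : injective f.
  have aux (b b' : 'I_(p ^ e)) : b <= b' -> f b = f b' -> b = b'.
    move=> bb' /(congr1 val) /= /eqP; rewrite eq_sym eqn_mod_dvd; last first.
      by rewrite -(subnK bb') addnC geoD leq_addr.
    rewrite -{1}(subnK bb') addnC geoD addKn Gauss_dvdr ?coprimeXr //.
    rewrite lte // => d; apply/val_inj/eqP; rewrite /= eqn_leq bb' /= -subn_eq0.
    rewrite -leqn0 leqNgt; apply/negP=> h; have := dvdn_leq h d.
    by rewrite leqNgt (leq_ltn_trans (leq_subr _ _) (ltn_ord b')).
  move=> b b' e'; case: (leqP b b') => [|/ltnW] h; first exact: aux.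
  exact/esym/aux.
have [g _ gK] := injF_bij finj.
exists (g (Ordinal (ltn_pmod i N0))).
by have /(congr1 val) := gK (Ordinal (ltn_pmod i N0)).
Qed.

(** y^i x lies in x^(i+1)<h>, and y^b = x^b h^(geo b). [geo_surj] chooses b so that the powers of h
    agree. *)
Lemma relC_commute (q e k : nat) (gT : finGroupType) (x y : gT) :
    prime q -> q %| k -> (q = 2 -> 4 %| k) -> relC (q ^ e) k x y ->
  commute (<[x]> : {set gT}) <[y]>.
Proof.
move=> qp qk q2 [xN yN hN hx].
have k1 m : m %| k -> k.+1 = 1 %[mod m].
  by move=> mk; rewrite -add1n -modnDmr (eqP mk) addn0.
apply: commute_sym; apply: commute_cycles => i.
have [b eb] := geo_surj e (k.+1 * geo k.+1 i) qp (k1 _ qk) (fun e2 => k1 _ (q2 e2)).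
have yX m : y ^+ m = x ^+ m * (x^-1 * y) ^+ geo k.+1 m.
  have := @mulXgeo _ x (x^-1 * y) 1 k.+1 m
    (commute_sym (commute1 _)) (commute_sym (commute1 _)).
  by rewrite mulKVg expg1n !mulg1; apply.
have -> : y ^+ i * x = x ^+ i.+1 * x ^- b * y ^+ b.
  have hXx m : (x^-1 * y) ^+ m * x = x * (x^-1 * y) ^+ (k.+1 * m).
    by rewrite conjgC conjXg hx expgM.
  rewrite (yX i) (yX b) -(mulgA (x ^+ i)) hXx (mulgA (x ^+ i)) -expgSr.
  rewrite -(mulgA (x ^+ i.+1)) mulKg.
  congr (_ * _); apply/eqP; rewrite eq_expg_mod_order.
  have d : #[x^-1 * y] %| q ^ e by rewrite order_dvdn hN.
  by rewrite -(modn_dvdm _ d) -eb modn_dvdm.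
by rewrite mem_mulg ?groupM ?groupV ?mem_cycle.
Qed.

(** Conjugation by y inverts even powers of x up to the central s, and x y = s^a y^-1 x^-1 takes
    care of the extra factor in an odd power. *)
Lemma relE_commute (N : nat) (a b : bool) (gT : finGroupType) (x y : gT) :
  8 %| N -> relE N a b x y -> commute (<[x]> : {set gT}) <[y]>.
Proof.
move=> N8 [[xN yN] [cx cy] exy [_ ex]].
set s := x ^+ N./2 * y ^+ N./2 in exy ex.
have sx : commute s x.
  by apply/commute_sym/commuteM; [apply: commuteX | apply/commute_sym].
have sy : commute s y by apply/commute_sym/commuteM; [apply/commute_sym | apply: commuteX].
have sE j : s ^+ j = y ^+ (N./2 * j) * x ^+ (N./2 * j).
  rewrite /s expgMn; last exact: commuteX.
  by rewrite !expgM; apply/commuteX2/commuteX.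
have sM j u v : u \in <[y]> -> v \in <[x]> -> s ^+ j * (u * v) \in <[y]> * <[x]>.
  move=> uy vx.
  have -> : s ^+ j * (u * v) = (y ^+ (N./2 * j) * u) * (x ^+ (N./2 * j) * v).
    rewrite sE -!mulgA; congr (_ * _); rewrite !mulgA; congr (_ * _).
    case/cycleP: uy => m ->; apply: commuteX.
    by rewrite expgM; apply/commute_sym/commuteX/commute_sym.
  by rewrite mem_mulg // groupM ?mem_cycle.
have even k : x ^+ (2 * k) * y = s ^+ (b * k) * (y * x ^- (2 * k)).
  rewrite conjgC expgM conjXg ex expgMn; last first.
    by apply/commuteX/commute_sym/commuteV/commuteX.
  rewrite expgVn -(expgM x) -(expgM s) mulgA; apply/commuteX/commute_sym/commuteM => //.
  exact/commuteV/commuteX.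
apply: commute_cycles => i.
have [k [ik|ik]] : exists k, i = (2 * k)%N \/ i = (2 * k).+1.
  by exists i./2; rewrite mul2n -{1 3}[i]odd_double_half; case: (odd i); [right | left].
  rewrite ik even sM ?cycle_id ?groupV ?mem_cycle //.
have xy : x * y = s ^+ a * (y^-1 * x^-1).
  by rewrite -exy expgS expg1 -invMg mulgK.
have sxx : x * s ^+ (b * k) = s ^+ (b * k) * x by apply/commuteX/commute_sym.
rewrite ik expgS -mulgA even mulgA sxx -!mulgA (mulgA x) xy -!mulgA.
rewrite (mulgA (s ^+ _)) -expgD sM ?groupM ?groupV ?cycle_id ?mem_cycle //.
Qed.

Section Soundness.
Variables (n : nat) (gT : finGroupType) (x y : gT).
Variables (g : nat -> ltype n) (l : nat -> nat -> nat).
Hypotheses (n8 : 8 %| n) (n0 : 0 < n) (rel : brel g l x y).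
Hypothesis gok : forall q : nat, q \in primes n -> ltype_ok q (logn q n) (g q).

Lemma constt_notin (u : gT) (q : nat) : u ^+ n = 1 -> q \notin primes n -> u.`_q = 1.
Proof.
move=> un qn; apply/constt1P; rewrite /p_elt.
have d : #[u] %| n by rewrite order_dvdn un.
apply: pnat_dvd d _; apply/pnatP => // r rp rn; rewrite !inE.
by apply: contraNneq qn => <-; rewrite mem_primes rp n0.
Qed.

(** It is enough to let the p-part of x permute with the q-part of y. For distinct primes the part
    at the smaller prime normalizes the other; for equal primes the type decides. *)
Lemma brel_commute : commute (<[x]> : {set gT}) <[y]>.
Proof.
have [xn yn rT rl] := rel.
apply: commute_constt => p; apply: commute_sym; apply: commute_constt => q.
have [pn|pn] := boolP (p \in primes n); last first.
  by rewrite /= (constt_notin xn pn) cycle1 /commute mulg1 mul1g.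
have [qn|qn] := boolP (q \in primes n); last first.
  by rewrite /= (constt_notin yn qn) cycle1 /commute mulg1 mul1g.
apply: commute_sym.
have norm u v c : u ^ v = u ^+ c -> v \in 'N(<[u]>).
  move=> e; apply/normP/eqP; rewrite eqEcard cardJg leqnn andbT -cycleJ cycle_subG.
  by rewrite e mem_cycle.
case: (ltngtP q p) => [qp|pq|->].
- have [/norm h _] := rl _ _ qn pn qp.
  by apply: commute_sym; apply: normC; rewrite cycle_subG.
- have [_ /norm h] := rl _ _ pn qn pq.
  by apply: normC; rewrite cycle_subG.
have := rT _ pn; have := gok pn; case: (g p) => [k|[a b]] /=.
  case/and3P=> _ pk p2; apply: relC_commute => //.
    by move: pn; rewrite mem_primes => /andP[].
  by move=> e; move: p2; rewrite e.
move=> /eqP p2; apply: relE_commute.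
by rewrite p2 -[8]/(2 ^ 3)%N dvdn_exp2l // -pfactor_dvdn.
Qed.
End Soundness.

(** * Uniqueness of the invariants *)

Section LocalUnique.
Variables (N : nat) (gT : finGroupType) (x t : gT).
Hypotheses (iso : isobicyclic N x t) (N8 : 8 %| N).
Local Notation y := (x ^ t).

Let N0 : 0 < N. Proof. exact: iso_gt0 iso. Qed.
Let N7 : 7 < N. Proof. exact: dvdn_leq. Qed.
Let Nhalf : (N./2 + N./2 = N)%N.
Proof. by rewrite -[RHS](half_mul8 N8).1 muln2 addnn. Qed.

Lemma iso_pow_lt i : 0 < i < N -> x ^+ i <> 1.
Proof.
case/andP=> i0 iN /eqP; rewrite -order_dvdn (iso_ordx iso) => /(dvdn_leq i0).
by rewrite leqNgt iN.
Qed.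

Lemma iso_half_lt : 0 < N./2 < N.
Proof.
by rewrite half_gt0 (leq_trans _ N7) //= -[X in _ < X]Nhalf
  -addn1 leq_add2l half_gt0 (leq_trans _ N7).
Qed.

(** Under [relC], (x y)^2 is x^4 times a power of h, while both values that [relE] allows lie in
    <h>. As <x> meets <h> trivially, x^4 = 1, against N >= 8. *)
Lemma relCE_absurd (k : nat) (a b : bool) : relC N k x y -> ~ relE N a b x y.
Proof.
move=> relc [_ _ e _]; have [_ ti] := relC_h iso relc.
have [xN _ _ hx] := relc.
have yX m : y ^+ m = x ^+ m * (x^-1 * y) ^+ geo k.+1 m.
  have := @mulXgeo _ x (x^-1 * y) 1 k.+1 m
    (commute_sym (commute1 _)) (commute_sym (commute1 _)).
  by rewrite mulKVg expg1n !mulg1; apply.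
have yE : y = x * (x^-1 * y) by rewrite mulKVg.
have [m sm] : exists m, (x ^+ N./2 * y ^+ N./2) ^+ a = (x^-1 * y) ^+ m.
  case: (a); last by exists 0%N; rewrite !expg0.
  by rewrite expg1 yX mulgA -expgD Nhalf xN mul1g; eexists.
have : (x * (x * (x^-1 * y))) ^+ 2 = (x^-1 * y) ^+ m by rewrite -yE e sm.
move: (x^-1 * y) hx ti => h hx ti {}e.
have xyE : (x * (x * h)) ^+ 2 = x ^+ 4 * h ^+ (k.+1 ^ 2).+1.
  rewrite mulgA -[x * x]/(x ^+ 2) expgS expg1 -mulgA (mulgA h) (conjgC h).
  by rewrite (conj_expg_iter 2 hx) -(mulgA (x ^+ 2)) -expgSr (mulgA (x ^+ 2)) -expgD.
have : x ^+ 4 \in <[x]> :&: <[h]>.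
  rewrite inE mem_cycle -(mulgK (h ^+ (k.+1 ^ 2).+1) (x ^+ 4)) -xyE e.
  by rewrite groupM ?groupV ?mem_cycle.
rewrite ti => /set1P; apply: iso_pow_lt.
by rewrite /= (leq_trans _ N7).
Qed.

Lemma iso_s_neq1 : x ^+ N./2 * y ^+ N./2 <> 1.
Proof.
move=> e; have : x ^+ N./2 \in <[x]> :&: <[y]>.
  by rewrite inE mem_cycle -(mulgK (y ^+ N./2) (x ^+ _)) e mul1g groupV mem_cycle.
by case: iso => _ _ -> _ /set1P; apply/iso_pow_lt/iso_half_lt.
Qed.

Lemma iso_s_inj (a b : bool) :
  (x ^+ N./2 * y ^+ N./2) ^+ a = (x ^+ N./2 * y ^+ N./2) ^+ b -> a = b.
Proof.
by case: a b => [] []; rewrite ?expg0 ?expg1 // => e; case: iso_s_neq1.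
Qed.
End LocalUnique.

Lemma eq_modS M k k' : k < M -> k' < M -> k.+1 = k'.+1 %[mod M] -> k = k'.
Proof.
by move=> kM kM' /eqP; rewrite -(addn1 k) -(addn1 k') eqn_modDr !modn_small // => /eqP.
Qed.

Lemma relT_unique (m q e : nat) (tau tau' : ltype m) (gT : finGroupType) (x t : gT) :
    prime q -> isobicyclic (q ^ e) x t -> (q = 2 -> 8 %| q ^ e) ->
    ltype_ok q e tau -> ltype_ok q e tau' ->
    relT (q ^ e) tau x (x ^ t) -> relT (q ^ e) tau' x (x ^ t) ->
  tau = tau'.
Proof.
move=> qp iso q8.
case: tau tau' => [k|[a b]] [k'|[a' b']] /=.
- move=> /and3P[kN _ _] /and3P[kN' _ _] rel [_ _ _]; have [oh _] := relC_h iso rel.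
  case: rel => _ _ _ -> /eqP; rewrite eq_expg_mod_order oh => /eqP.
  by move/(eq_modS kN kN')/val_inj->.
- by move=> _ /eqP/q8 N8 relc rele; case: (relCE_absurd iso N8 relc rele).
- by move=> /eqP/q8 N8 _ rele relc; case: (relCE_absurd iso N8 relc rele).
move=> /eqP/q8 N8 _ [_ _ e1 [e2 _]] [_ _ e1' [e2' _]].
rewrite e1 in e1'; rewrite e2 in e2'.
by rewrite (iso_s_inj iso N8 e1') (iso_s_inj iso N8 (mulgI _ _ _ e2')).
Qed.

Lemma brel_unique (n : nat) (g g' : nat -> ltype n) (l l' : nat -> nat -> nat)
    (gT : finGroupType) (x t : gT) :
    8 %| n -> isobicyclic n x t -> bgood g l -> bgood g' l' ->
    brel g l x (x ^ t) -> brel g' l' x (x ^ t) ->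
  (forall q : nat, q \in primes n -> g q = g' q) /\
  (forall q p : nat, q \in primes n -> p \in primes n -> q < p -> l q p = l' q p).
Proof.
move=> n8 iso [ok lb _ _] [ok' lb' _ _] [_ _ rT rl] [_ _ rT' rl']; split.
  move=> q qn; have qp : prime q by move: qn; rewrite mem_primes => /andP[].
  have := rT q qn; have := rT' q qn; rewrite -iso_yconstt => h' h.
  exact: relT_unique qp (iso_part iso q) (iso_primes2 iso n8 qn) (ok q qn) (ok' q qn) h h'.
move=> q p qn pn qp; have [e _] := rl q p qn pn qp; have [e' _] := rl' q p qn pn qp.
have [/andP[_ b1] _] := lb q p qn pn qp; have [/andP[_ b2] _] := lb' q p qn pn qp.
move/eqP: e; rewrite e' eq_expg_mod_order (iso_opart iso) !modn_small //.
by move/eqP.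
Qed.

(** * Relations in images and direct products *)

Lemma relT_morph (m N : nat) (tau : ltype m) (aT rT : finGroupType)
    (G : {group aT}) (f : {morphism G >-> rT}) (x y : aT) :
  x \in G -> y \in G -> relT N tau x y -> relT N tau (f x) (f y).
Proof.
move=> xG yG.
have fE (u v : aT) : u \in G -> u = v -> f u = f v by move=> _ ->.
case: tau => [k|[a b]] /=.
  have hG : x^-1 * y \in G by rewrite groupM ?groupV.
  case=> xN yN hN hx; rewrite /relC -morphV // -morphM ?groupV // -!morphX //.
  by rewrite xN yN hN morph1 -morphJ // hx.
case=> [[xN yN] [cx cy] e [e1 e2]]; split.
- by rewrite -!morphX // xN yN morph1.
- by rewrite /commute -!morphX // -!morphM ?groupX // cx cy.
- by rewrite -!morphX // -!morphM ?groupX // -!morphX ?groupM ?groupX // e.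
- rewrite -!morphX // -!morphM ?groupX // -!morphX ?groupM ?groupX // -!morphV ?groupX //.
  by rewrite -!morphJ ?groupX // e1 e2 !morphM ?groupV ?groupX ?groupM ?groupX.
Qed.

Lemma brel_morph (n : nat) (g : nat -> ltype n) (l : nat -> nat -> nat)
    (aT rT : finGroupType) (G : {group aT}) (f : {morphism G >-> rT}) (x y : aT) :
  x \in G -> y \in G -> brel g l x y -> brel g l (f x) (f y).
Proof.
move=> xG yG [xn yn rT' rl].
have cG (u : aT) (p : nat) : u \in G -> u.`_p \in G.
  by move=> uG; apply: (subsetP _ _ (cycle_constt _ _)); rewrite cycle_subG.
split.
- by rewrite -morphX // xn morph1.
- by rewrite -morphX // yn morph1.
- move=> q qn; rewrite -(morph_constt f q xG) -(morph_constt f q yG).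
  by apply: relT_morph; [apply: cG | apply: cG | apply: rT'].
move=> q p qn pn qp; have [e1 e2] := rl q p qn pn qp.
by rewrite -!morph_constt // -!morphJ ?cG // -!morphX ?cG // e1 e2.
Qed.

Section Pair.
Variables (aT rT : finGroupType).

Lemma pair_eq (u v : aT * rT) : u.1 = v.1 -> u.2 = v.2 -> u = v.
Proof. by case: u v => [? ?] [? ?] /= -> ->. Qed.

Lemma pair1X (u : aT * rT) i : (u ^+ i).1 = u.1 ^+ i.
Proof. by elim: i => // i IH; rewrite !expgS -IH. Qed.
Lemma pair2X (u : aT * rT) i : (u ^+ i).2 = u.2 ^+ i.
Proof. by elim: i => // i IH; rewrite !expgS -IH. Qed.

Lemma pair1_constt (u : aT * rT) (p : nat) : (u.`_p).1 = u.1.`_p.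
Proof. exact: (morph_constt (@fst_morphism aT rT) p (in_setT u)). Qed.
Lemma pair2_constt (u : aT * rT) (p : nat) : (u.`_p).2 = u.2.`_p.
Proof. exact: (morph_constt (@snd_morphism aT rT) p (in_setT u)). Qed.

Definition pairE := (pair1X, pair2X, pair1_constt, pair2_constt).

Lemma pair_commute (u v : aT * rT) :
  commute u.1 v.1 -> commute u.2 v.2 -> commute u v.
Proof. by move=> c1 c2; apply: pair_eq. Qed.

Lemma relT_pair (m N : nat) (tau : ltype m) (x y : aT * rT) :
  relT N tau x.1 y.1 -> relT N tau x.2 y.2 -> relT N tau x y.
Proof.
case: tau => [k|[a b]] /=.
  move=> [? ? ? e1] [? ? ? e2].
  split; apply: pair_eq; rewrite /= ?pairE //.
move=> [[? ?] [? ?] ? [? ?]] [[? ?] [? ?] ? [? ?]].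
split; [split|split|idtac|split].
1,2,5,6,7: by apply: pair_eq; rewrite /= ?pairE /= ?pairE.
all: by apply: pair_commute; rewrite ?pairE.
Qed.

Lemma brel_pair (n : nat) (g : nat -> ltype n) (l : nat -> nat -> nat) (x y : aT * rT) :
  brel g l x.1 y.1 -> brel g l x.2 y.2 -> brel g l x y.
Proof.
move=> [x1 y1 r1 l1] [x2 y2 r2 l2]; split.
- by apply: pair_eq; rewrite pairE.
- by apply: pair_eq; rewrite pairE.
- by move=> q qn; apply: relT_pair; rewrite pairE pairE; [apply: r1 | apply: r2].
move=> q p qn pn qp; have [e1 f1] := l1 q p qn pn qp; have [e2 f2] := l2 q p qn pn qp.
by split; apply: pair_eq; rewrite !pairE /=; rewrite ?pairE.
Qed.

(** [brel_commute] in the direct product, for (x, x') and (y, y'), rewrites both groups with the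
    same exponents. *)
Lemma brel_same (n : nat) (g : nat -> ltype n) (l : nat -> nat -> nat)
    (x y : aT) (x' y' : rT) i j :
    8 %| n -> 0 < n -> (forall q : nat, q \in primes n -> ltype_ok q (logn q n) (g q)) ->
    brel g l x y -> brel g l x' y' ->
  exists a b, x ^+ i * y ^+ j = y ^+ a * x ^+ b /\
              x' ^+ i * y' ^+ j = y' ^+ a * x' ^+ b.
Proof.
move=> n8 n0 gok r1 r2.
have rel : brel g l (x, x') (y, y') by apply: brel_pair.
have := brel_commute n8 n0 rel gok => c.
have : (x, x') ^+ i * (y, y') ^+ j \in <[(y, y')]> * <[(x, x')]>.
  by rewrite -(c : _ * _ = _ * _) mem_mulg ?mem_cycle.
case/mulsgP=> _ _ /cycleP[a ->] /cycleP[b ->] e; exists a, b.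
split; [have := congr1 fst e | have := congr1 snd e].
  by rewrite /= !pair1X.
by rewrite /= !pair2X.
Qed.
End Pair.

(** * Existence of triples with prescribed invariants *)

Import GRing.Theory.

(** The case j = 0 bounds the order of u below; together with u^N = 1 the condition makes <u> and
    <v> meet trivially. It holds in a direct product as soon as it holds in one factor. *)
Definition indep (gT : finGroupType) (u v : gT) (N : nat) :=
  forall i j, u ^+ i = v ^+ j -> N %| i.

Section TypeC.
Variables (q e k : nat).
Hypotheses (pq : prime q) (e0 : 0 < e) (qk : q %| k) (q2 : q = 2 -> 4 %| k).
Let N := (q ^ e)%N.
Let c := k.+1.
Local Notation R := 'Z_N.

Let N1 : 1 < N.
Proof. by rewrite -(exp1n e) ltn_exp2r ?prime_gt1. Qed.

Let c1 : c = 1 %[mod q].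
Proof. by rewrite /c -add1n -modnDmr (eqP qk) addn0. Qed.

Let c2 : q = 2 -> c = 1 %[mod 4].
Proof. by move=> /q2 d; rewrite /c -add1n -modnDmr (eqP d) addn0. Qed.

Let geoN d : (N %| geo c d) = (N %| d). Proof. exact: lte. Qed.

Let NR : (N%:R : R)%R = 0%R. Proof. exact: pchar_Zp. Qed.

Let natR0 m : ((m%:R : R) == 0)%R = (N %| m).
Proof.
apply/eqP/idP => h; first by rewrite /dvdn -(val_Zp_nat N1) h.
by apply: val_inj; apply: etrans (val_Zp_nat N1 m) (eqP h).
Qed.

Let cN : ((c%:R : R) ^+ N = 1)%R.
Proof.
apply/eqP; rewrite -natrX -(prednK (_ : 0 < c ^ N)) ?expn_gt0 // -natr1.
rewrite -subr_eq0 GRing.addrK natR0 pow_geo //.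
by rewrite dvdn_mull // geoN.
Qed.

Definition gR (i : R) : R := (geo c (nat_of_ord i))%:R%R.

Let gRnat m : gR (m%:R)%R = (geo c m)%:R%R.
Proof.
rewrite /gR val_Zp_nat // {2}(divn_eq m N) addnC geoD.
rewrite natrD natrM; suff /eqP-> : ((geo c (m %/ N * N))%:R == 0 :> R)%R by rewrite mulr0 addr0.
by rewrite natR0 geoN dvdn_mull.
Qed.

Let gRS (i : R) : (gR (i + 1) = c%:R * gR i + 1)%R.
Proof.
by rewrite -[i]natr_Zp natr1 !gRnat geoS natrD natrM.
Qed.

(** The point (i, j) stands for x^i h^j. Right multiplications by x and h are [fx] and [fh]; [ft] is
    the automorphism exchanging x and x h, which sends x^i h^j to x^i h^(geo i) h^-j. *)
Let T := (R * R)%type.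
Let fx (a : T) : T := (a.1 + 1, c%:R * a.2)%R.
Let fx' (a : T) : T := (a.1 - 1, c%:R ^+ N.-1 * a.2)%R.
Let ft (a : T) : T := (a.1, gR a.1 - a.2)%R.
Let fh (a : T) : T := (a.1, a.2 + 1)%R.

Let fxK : cancel fx fx'.
Proof.
case=> i j; congr pair => /=; first by rewrite GRing.addrK.
by rewrite mulrA -exprSr prednK ?cN ?mul1r // ltnW.
Qed.

Let ftK : cancel ft ft.
Proof. by case=> i j; congr pair; rewrite /= subKr. Qed.

Let fhK : cancel fh (fun a : T => (a.1, a.2 - 1)%R).
Proof. by case=> i j; rewrite /fh /= GRing.addrK. Qed.

Let X := perm (can_inj fxK).
Let S := perm (can_inj ftK).
Let H := perm (can_inj fhK).

Let HX m (a : T) : (H ^+ m) a = (a.1, a.2 + m%:R)%R.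
Proof.
elim: m => [|m IH]; first by rewrite expg0 perm1 addr0; case: a.
by rewrite expgSr permM IH permE /fh /= -addrA natr1.
Qed.

Let XX m (a : T) : (X ^+ m) a = (a.1 + m%:R, c%:R ^+ m * a.2)%R.
Proof.
elim: m => [|m IH]; first by rewrite expg0 perm1 addr0 expr0 mul1r; case: a.
by rewrite expgSr permM IH permE /fx /= -addrA natr1 mulrA -exprS.
Qed.

Let S2 : S * S = 1.
Proof. by apply/permP=> a; rewrite permM !permE ftK. Qed.

Let SV : S^-1 = S.
Proof. by apply: (mulgI S); rewrite mulgV S2. Qed.

Let YE : X ^ S = X * H.
Proof.
rewrite conjgE SV; apply/permP=> -[i j]; rewrite !permM !permE /ft /fx /fh /=.
by congr pair; rewrite gRS; ring.
Qed.

Lemma typeC_exists : exists (gT : finGroupType) (x t : gT),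
  [/\ t * t = 1, relC N k x (x ^ t) & indep x (x ^ t) N].
Proof.
have XN : X ^+ N = 1.
  by apply/permP=> a; rewrite XX cN NR perm1 addr0 mul1r; case: a.
exists {perm T}, X, S; split=> //.
  split=> //; first by rewrite -conjXg XN conj1g.
    by rewrite YE mulKg; apply/permP=> a; rewrite HX NR addr0 perm1; case: a.
  rewrite YE mulKg; apply: (mulgI X); rewrite -conjgC; apply/permP=> a.
  by rewrite !permM HX !permE /fx /fh /=; congr pair; rewrite mulrDr mulr1.
move=> i j e1.
have HXc : H ^ X = H ^+ c * 1.
  rewrite mulg1; apply: (mulgI X); rewrite -conjgC; apply/permP=> a.
  by rewrite !permM HX !permE /fx /fh /=; congr pair; rewrite mulrDr mulr1.
have := mulXgeo j (commute_sym (commute1 _)) (commute_sym (commute1 _)) HXc.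
rewrite -YE expg1n mulg1 -e1 => /permP/(_ (0, 0)%R).
rewrite permM HX !XX /= mulr0 !add0r => e2.
have e3 : (i%:R : R)%R = j%:R%R := congr1 fst e2.
have e4 : (geo c j)%:R%R = (0 : R)%R.
  by have := esym (congr1 snd e2); rewrite [LHS]/= mulr0 add0r.
have Nj : N %| j by rewrite -geoN -natR0 e4.
by rewrite -natR0 e3 natR0.
Qed.
End TypeC.

Section DoublePerm.
Variable T : finType.
Implicit Types u v : {perm T}.

Let dfun u v (a : bool * T) := (a.1, if a.1 then u a.2 else v a.2).
Let dfunK u v : cancel (dfun u v) (dfun u^-1 v^-1).
Proof. by case=> -[] i; rewrite /dfun /= permK. Qed.

(** On two copies of [T] the exchange [dswap] can play t for any pair of permutations, without an
    involution of [T] that conjugates one into the other. *)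
Definition dperm u v : {perm bool * T} := perm (can_inj (dfunK u v)).

Let sfun (a : bool * T) := (~~ a.1, a.2).
Let sfunK : involutive sfun.
Proof. by case=> b i; rewrite /sfun /= negbK. Qed.

Definition dswap : {perm bool * T} := perm (inv_inj sfunK).

Lemma dpermE u v a : dperm u v a = (a.1, if a.1 then u a.2 else v a.2).
Proof. by rewrite permE. Qed.

Lemma dpermM u v u' v' : dperm u v * dperm u' v' = dperm (u * u') (v * v').
Proof. by apply/permP=> -[[] i]; rewrite permM !dpermE /= permM. Qed.

Lemma dperm1 : dperm 1 1 = 1.
Proof. by apply/permP=> -[[] i]; rewrite dpermE /= !perm1. Qed.

Lemma dperm_eq1 u v : u = 1 -> v = 1 -> dperm u v = 1.
Proof. by move=> -> ->; apply: dperm1. Qed.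

Lemma dpermV u v : (dperm u v)^-1 = dperm u^-1 v^-1.
Proof. by apply: (mulgI (dperm u v)); rewrite mulgV dpermM !mulgV dperm1. Qed.

Lemma dpermX u v m : dperm u v ^+ m = dperm (u ^+ m) (v ^+ m).
Proof. by elim: m => [|m IH]; rewrite ?expg0 ?dperm1 // !expgS IH dpermM. Qed.

Lemma dpermXl u m : dperm u 1 ^+ m = dperm (u ^+ m) 1.
Proof. by rewrite dpermX expg1n. Qed.

Lemma dpermXr v m : dperm 1 v ^+ m = dperm 1 (v ^+ m).
Proof. by rewrite dpermX expg1n. Qed.

Lemma dpermJ u v u' v' : dperm u v ^ dperm u' v' = dperm (u ^ u') (v ^ v').
Proof. by rewrite !conjgE dpermV !dpermM. Qed.

Lemma dswap2 : dswap * dswap = 1.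
Proof. by apply/permP=> -[b i]; rewrite permM !permE /sfun /= negbK. Qed.

Lemma dpermJs u v : dperm u v ^ dswap = dperm v u.
Proof.
have sV : dswap^-1 = dswap by apply: (mulgI dswap); rewrite mulgV dswap2.
rewrite conjgE sV; apply/permP=> -[b i].
by rewrite !permM !permE /sfun /dfun /= negbK; case: b.
Qed.

Lemma dperm_inj u v u' v' : dperm u v = dperm u' v' -> u = u' /\ v = v'.
Proof.
move/permP=> e; split; apply/permP=> i.
  by have := e (true, i); rewrite !dpermE => -[].
by have := e (false, i); rewrite !dpermE => -[].
Qed.

Definition dpermP := (dpermM, dpermV, dpermX, dpermJ, dpermJs).
End DoublePerm.

Section TypeE.
Variables (N : nat) (a b : bool).
Hypothesis N8 : 8 %| N.
Hypothesis N0 : 0 < N.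
Let M := N./2.
Local Notation R := 'Z_M.
Let kap : R := (M./2)%:R%R.
Let al : R := (a : nat)%:R%R.
Let be : R := (b : nat)%:R%R.

Let ME : (N = M + M)%N.
Proof. by rewrite -[LHS](half_mul8 N8).1 muln2 addnn. Qed.
Let M1 : 1 < M.
Proof. by have := dvdn_leq N0 N8; rewrite ME; case: (M) => [|[]]. Qed.
Let MR : (M%:R : R)%R = 0%R. Proof. exact: pchar_Zp. Qed.
Let K4 : exists r, M./2 = (2 * r)%N /\ M = (4 * r)%N.
Proof.
rewrite /M (half_mul8 N8).2; exists (N %/ 8)%N; split=> //.
by rewrite -(mulnA 2 2) mul2n doubleK.
Qed.
Let kap2 : (kap + kap = 0)%R.
Proof.
have [r [e1 e2]] := K4.
by rewrite /kap -natrD e1 addnn -mul2n mulnA -[(2 * 2)%N]/4 -e2 MR.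
Qed.
Let kapkap : (kap * kap = 0)%R.
Proof.
have [r [e1 e2]] := K4.
rewrite /kap -natrM e1 (_ : (2 * r * (2 * r) = M * r)%N) ?natrM ?MR ?mul0r //.
by rewrite e2 mulnACA -(mulnA 4).
Qed.

(** Read (false, u) as 2u and (true, u) as 2u + 1 modulo N. Then [rho] is the N-cycle adding 1, and
    for both flags false [phi] is the reflection i -> -i of a dihedral group. The flags deform it by
    multiples of [kap], the shift performed by the central involution [rho ^+ M]; the computations
    rest on 2 kap = kap^2 = 0. *)
Let T := (bool * R)%type.
Let fr (x : T) : T := (~~ x.1, if x.1 then x.2 + 1 else x.2)%R.
Let fr' (x : T) : T := (~~ x.1, if x.1 then x.2 else x.2 - 1)%R.
Let frK : cancel fr fr'.
Proof. by case=> -[] u; rewrite /fr /fr' /= ?GRing.addrK. Qed.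
Let ff (x : T) : T :=
  (x.1, if x.1 then - x.2 - 1 + kap * (be * x.2 + al) else - x.2 + kap * be * x.2)%R.
Let ff2 (x : T) : ff (ff x) = (x.1, if x.1 then x.2 + kap * be else x.2)%R.
Proof.
case: x => -[] u; rewrite /ff /=; congr pair.
  transitivity (u + kap * be + (kap + kap) * (- be * u - be) +
    kap * kap * be * (be * u + al))%R; first by ring.
  by rewrite kap2 kapkap; ring.
transitivity (u - (kap + kap) * be * u + kap * kap * be * be * u)%R; first by ring.
by rewrite kap2 kapkap; ring.
Qed.
Let ff4 : cancel ff (fun x => ff (ff (ff x))).
Proof.
move=> x; rewrite !ff2; case: x => -[] u //=; congr pair.
by rewrite -addrA -mulrDl kap2; ring.
Qed.

Let rho := perm (can_inj frK).
Let phi := perm (can_inj ff4).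

Let rho2 m (x : T) : (rho ^+ (m + m)) x = (x.1, x.2 + m%:R)%R.
Proof.
elim: m => [|m IH]; first by rewrite expg0 perm1 addr0; case: x.
rewrite addSn addnS !expgSr !permM IH !permE /fr /=.
by case: (x.1); congr pair; rewrite -addrA natr1.
Qed.

Let phi2 (x : T) : (phi ^+ 2) x = (x.1, if x.1 then x.2 + kap * be else x.2)%R.
Proof. by rewrite expgS expg1 permM !permE ff2. Qed.

Let phi4 : phi ^+ 4 = 1.
Proof.
apply/permP=> x; rewrite -[4]/(2 + 2)%N expgD permM !phi2 perm1.
case: x => -[] u //=; congr pair; rewrite -addrA -mulrDl kap2; ring.
Qed.

Let rhoN : rho ^+ N = 1.
Proof. by rewrite ME; apply/permP=> x; rewrite rho2 MR addr0 perm1; case: x. Qed.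

Let MM : (M = M./2 + M./2)%N.
Proof. by have [r [-> {1}->]] := K4; rewrite addnn -mul2n mulnA. Qed.

Let rhoM (x : T) : (rho ^+ M) x = (x.1, x.2 + kap)%R.
Proof.
have -> : rho ^+ M = rho ^+ (M./2 + M./2) by congr (_ ^+ _); exact: MM.
by rewrite rho2.
Qed.

Let phiM : phi ^+ M = 1.
Proof.
have [r [_ e]] := K4.
have -> : phi ^+ M = phi ^+ (4 * r) by congr (_ ^+ _); exact: e.
by rewrite expgM phi4 expg1n.
Qed.

Let rhoMb (c : bool) (x : T) : ((rho ^+ M) ^+ c) x = (x.1, x.2 + kap * (c : nat)%:R)%R.
Proof. by case: c; rewrite ?expg1 ?expg0 ?rhoM ?mulr1 // perm1 mulr0 addr0; case: x. Qed.

Let c_rp : commute (rho ^+ M) phi.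
Proof.
apply/permP=> x; rewrite !permM !rhoM !permE /ff /=; case: x => -[] u /=; congr pair.
  transitivity (- u - 1 + kap * (be * u + al) + kap + kap * kap * be - (kap + kap))%R.
    by ring.
  by rewrite kap2 kapkap; ring.
transitivity (- u + kap * be * u + kap + kap * kap * be - (kap + kap))%R; first by ring.
by rewrite kap2 kapkap; ring.
Qed.

Let rp2 : (rho * phi) ^+ 2 = (rho ^+ M) ^+ a.
Proof.
apply/permP=> x; rewrite rhoMb expgS expg1 !permM !permE /fr /ff.
case: x => -[] u /=; congr pair; rewrite -/al.
  transitivity (u + kap * al - (kap + kap) * be * (u + 1) + kap * kap * be * be * (u + 1))%R.
    by ring.
  by rewrite kap2 kapkap; ring.
transitivity (u + kap * al - (kap + kap) * (be * u + al) + kap * kap * be * (be * u + al))%R.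
  by ring.
by rewrite kap2 kapkap; ring.
Qed.

Let pr2 : (phi * rho) ^+ 2 = (rho ^+ M) ^+ a.
Proof.
have -> : phi * rho = (rho * phi) ^ rho by rewrite conjgE !mulgA mulVg mul1g.
rewrite -conjXg rp2; apply: commute_conj.
by apply: commute_sym; do 2 apply: commuteX.
Qed.

Let phi2V : phi ^- 2 = phi ^+ 2.
Proof. by apply: (mulgI (phi ^+ 2)); rewrite mulgV -expgD phi4. Qed.

Let phi2r : (phi ^+ 2) ^ rho = phi ^- 2 * (rho ^+ M) ^+ b.
Proof.
rewrite phi2V; apply: (mulgI rho); rewrite -conjgC; apply/permP=> x.
rewrite (permM (phi ^+ 2)) (permM rho) (permM (phi ^+ 2)) rhoMb !phi2 !permE /fr -/be.
case: x => -[] u //=; congr pair.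
  by rewrite addrAC.
by rewrite -addrA -mulrDl kap2; ring.
Qed.

Let rho2f : (rho ^+ 2) ^ phi = rho ^- 2 * (rho ^+ M) ^+ b.
Proof.
suff e : (rho ^+ 2) ^ phi * rho ^+ 2 = (rho ^+ M) ^+ b.
  rewrite -[LHS](mulgK (rho ^+ 2)) e; apply: commute_sym; apply: commuteX.
  by apply: commuteX; apply: commute_sym; apply: commuteV; apply: commuteX.
apply: (mulgI phi); rewrite mulgA -conjgC; apply/permP=> x.
rewrite (permM _ (rho ^+ 2)) (permM (rho ^+ 2)) (permM phi) rhoMb !(rho2 1) !permE /ff -/be /=.
case: x => -[] u /=; congr pair; ring.
Qed.

Lemma typeE_exists : exists (gT : finGroupType) (x t : gT),
  [/\ t * t = 1, relE N a b x (x ^ t) & indep x (x ^ t) N].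
Proof.
exists {perm bool * T}, (dperm rho phi), (dswap _); split; first exact: dswap2.
  rewrite dpermJs /relE -/M !dpermP phiM mul1g mulg1 rhoN.
  have phiN : phi ^+ N = 1.
    have -> : phi ^+ N = phi ^+ (M + M) := congr1 (fun m => phi ^+ m) ME.
    by rewrite expgD phiM mulg1.
  rewrite phiN dperm1 rp2 pr2 phi2r rho2f; split=> //; split=> //.
    by rewrite /commute !dpermM c_rp mulg1 mul1g.
  by rewrite /commute !dpermM c_rp mulg1 mul1g.
move=> i j; rewrite dpermJs !dpermX => /dperm_inj[e _].
(* All powers of [phi] fix (false, 0), while [rho ^+ i] does so only if N divides i. *)
have f0 : (phi ^+ j) (false, 0%R) = (false, 0%R).
  elim: j {e} => [|j IH]; first by rewrite expg0 perm1.
  by rewrite expgSr permM IH permE /ff /=; congr pair; rewrite mulr0 oppr0 addr0.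
have := congr1 (fun s : {perm T} => s (false, 0%R)) e; rewrite /= f0.
rewrite -{1}[i]odd_double_half -addnn addnC expgD permM rho2 add0r.
case: (boolP (odd i)) => oi; first by rewrite expg1 permE /fr /= => /(congr1 fst).
rewrite expg0 perm1 => /(congr1 snd) /= e0.
have Mi : M %| i./2 by rewrite /dvdn -(val_Zp_nat M1) e0.
rewrite -[i]odd_double_half (negbTE oi) add0n -addnn.
have -> : N = (2 * M)%N by rewrite mul2n -addnn; exact: ME.
by rewrite addnn -mul2n dvdn_pmul2l.
Qed.
End TypeE.

Lemma local_exists (m q e : nat) (tau : ltype m) :
    prime q -> 0 < e -> (q = 2 -> 8 %| q ^ e) -> ltype_ok q e tau ->
  exists (gT : finGroupType) (x t : gT),
    [/\ t * t = 1, relT (q ^ e) tau x (x ^ t) & indep x (x ^ t) (q ^ e)].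
Proof.
move=> qp e0 q8; case: tau => [k|[a b]] /=.
  case/and3P=> _ qk k4; apply: typeC_exists => // q2.
  by move: k4; rewrite q2.
by move=> /eqP/q8 N8; apply: typeE_exists => //; rewrite expn_gt0 prime_gt0.
Qed.

Lemma relT1 (m N : nat) (tau : ltype m) (gT : finGroupType) : relT N tau (1 : gT) 1.
Proof.
have c1 : commute (1 : gT) 1 by [].
case: tau => [k|[a b]]; rewrite /= /relC /relE.
  by rewrite !(expg1n, mulg1, invg1, conj1g).
by rewrite !(expg1n, mulg1, mul1g, invg1, conj1g).
Qed.

(** This is the converse to [act_relT] and shows that [ltexp] is exact. For commuting x and y the
    type k only asks for h^k = 1, which exponent gcd(k, q^e) ensures; for the exceptional types
    exponent 2 trivializes s and every relation. *)
Lemma relT_commuting (m q e : nat) (tau : ltype m) (gT : finGroupType) (x y : gT) :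
    prime q -> (q = 2 -> 8 %| q ^ e) -> 0 < e -> ltype_ok q e tau -> commute x y ->
    x ^+ (q ^ ltexp q e tau) = 1 -> y ^+ (q ^ ltexp q e tau) = 1 ->
  relT (q ^ e) tau x y.
Proof.
move=> qp q8 e0 + cxy; case: tau => [k _|[a b] /= /eqP q2] /=.
  have gE : (q ^ logn q (gcdn k (q ^ e)) = gcdn k (q ^ e))%N.
    have : gcdn k (q ^ e) %| q ^ e by apply: dvdn_gcdr.
    by case/(dvdn_pfactor _ _ qp)=> i _ ->; rewrite pfactorK.
  rewrite gE => x1 y1.
  have h1 : (x^-1 * y) ^+ gcdn k (q ^ e) = 1.
    rewrite expgMn ?expgVn ?x1 ?y1 ?invg1 ?mulg1 //.
    exact/commute_sym/commuteV/commute_sym.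
  have dk := dvdn_gcdl k (q ^ e); have dN := dvdn_gcdr k (q ^ e).
  split; rewrite ?(expg_dvd x1 dN) ?(expg_dvd y1 dN) ?(expg_dvd h1 dN) //.
  rewrite expgS (expg_dvd h1 dk) mulg1; apply/commute_conj/commute_sym/commuteM => //.
  exact/commuteV.
rewrite expn1 q2 => x1 y1.
have [N8 d2] : 8 %| 2 ^ e /\ 2 %| (2 ^ e)./2.
  have N8 : 8 %| 2 ^ e by rewrite -[X in (X ^ e)%N]q2; apply: q8.
  by split; rewrite // (half_mul8 N8).2 dvdn_mulr.
have dN : 2 %| 2 ^ e by rewrite (@dvdn_exp2l 2 1).
rewrite /relE (expg_dvd x1 d2) (expg_dvd y1 d2) (expg_dvd x1 dN) (expg_dvd y1 dN).
rewrite x1 y1 !(expg1n, mulg1, mul1g, invg1, conj1g) expgMn // x1 y1 mulg1.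
by split=> //; split; apply/commute_sym/commute1.
Qed.

(** [xi p] is meant as the p-part of x. Independence is required only at the primes of [s]: a model
    faithful at one prime may let the others act through quotients, and a direct product of such
    models is faithful at all of them. *)
Definition family_rel (n : nat) (g : nat -> ltype n) (l : nat -> nat -> nat)
    (s : seq nat) (gT : finGroupType) (xi : nat -> gT) (t : gT) :=
  [/\ t * t = 1,
      forall p q : nat, p \in primes n -> q \in primes n -> commute (xi p) (xi q),
      forall p : nat, p \in primes n -> relT (p ^ logn p n) (g p) (xi p) (xi p ^ t),
      forall p : nat, p \in primes n -> xi p ^+ (p ^ logn p n) = 1 &
      (forall q p : nat, q \in primes n -> p \in primes n -> q < p ->
        xi p ^ (xi q ^ t) = xi p ^+ l q p) /\
      (forall p : nat, p \in primes n -> p \in s -> indep (xi p) (xi p ^ t) (p ^ logn p n))].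

Section Existence.
Variables (n : nat) (g : nat -> ltype n) (l : nat -> nat -> nat).
Hypotheses (n0 : 0 < n) (n8 : 8 %| n) (good : bgood g l).

Let pr (p : nat) : p \in primes n -> prime p.
Proof. by rewrite mem_primes => /andP[]. Qed.

Let logn0 (p : nat) : p \in primes n -> 0 < logn p n.
Proof. by rewrite logn_gt0. Qed.

Let n2 (q : nat) : q \in primes n -> q = 2 -> 8 %| q ^ logn q n.
Proof. by move=> _ ->; rewrite -[8]/(2 ^ 3)%N dvdn_exp2l // -pfactor_dvdn. Qed.

Let texp_le (q : nat) : q \in primes n -> ltexp q (logn q n) (g q) <= logn q n.
Proof.
move=> qn; case: (g q) => [k|ab] /=; last exact: logn0.
have q0 : 0 < q ^ logn q n by rewrite expn_gt0 prime_gt0 ?pr.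
have := dvdn_leq_log q q0 (dvdn_gcdr k (q ^ logn q n)).
by rewrite pfactorK ?pr.
Qed.

(** No smaller prime acts on the r-part, so all other parts may be taken trivial. *)
Lemma source_component (r : nat) : r \in primes n ->
    (forall q : nat, q \in primes n -> q < r -> l q r = 1%N) ->
  exists (gT : finGroupType) (xi : nat -> gT) (t : gT), family_rel g l [:: r] xi t.
Proof.
move=> rn lr; have [ok _ _ _] := good.
have [gT [x [t [tt rel ind]]]] := local_exists (pr rn) (logn0 rn) (@n2 r rn) (ok r rn).
exists gT, (fun p => if p == r then x else 1), t; split=> //.
- by move=> p q _ _; case: eqP => _; case: eqP => _ //;
    [exact: commute1 | exact: commute_sym (commute1 _)].
- by move=> p pn; case: eqP => [-> //|_]; rewrite conj1g; apply: relT1.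
- move=> p pn; case: eqP => [->|_]; last by rewrite expg1n.
  by case: (g r) rel => [k [xN _ _ _]|ab [[xN _] _ _ _]].
split=> [q p qn pn qp|p pn]; last by rewrite inE => /eqP->; rewrite eqxx.
have [pr'|_] := eqVneq p r; last by rewrite conj1g expg1n.
rewrite pr' in qp *.
by rewrite ltn_eqF // conj1g conjg1 lr // expg1.
Qed.

Section Sink.
Variable M : nat.
Hypothesis M1 : 1 < M.
Local Notation R := 'Z_M.
(** The default 1 for non-units makes [zmul] a permutation for every c. *)
Let cst (c : nat) : R := (if coprime M c then c%:R else 1)%R.
Let cstU c : (cst c \is a GRing.unit)%R.
Proof. by rewrite /cst; case: ifP => [cM|_]; rewrite ?unitr1 // unitZpE. Qed.
Definition zmul (c : nat) : {perm R} := perm (can_inj (GRing.mulKr (cstU c))).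
Definition zadd : {perm R} := perm (GRing.addIr (1 : R)%R).

Lemma zmulE c (i : R) : coprime M c -> zmul c i = (c%:R * i)%R.
Proof. by rewrite permE /cst => ->. Qed.

Lemma zaddX m (i : R) : (zadd ^+ m) i = (i + m%:R)%R.
Proof.
elim: m => [|m IH]; first by rewrite expg0 perm1 addr0.
by rewrite expgSr permM IH permE -addrA natr1.
Qed.

Lemma zmulX c m (i : R) : coprime M c -> (zmul c ^+ m) i = ((c ^ m)%:R * i)%R.
Proof.
move=> cM; elim: m => [|m IH]; first by rewrite expg0 perm1 expn0 mul1r.
by rewrite expgSr permM IH zmulE // mulrA -natrM -expnS.
Qed.

Lemma zmul_commute c d : commute (zmul c) (zmul d).
Proof. by apply/permP=> i; rewrite !permM !permE mulrCA. Qed.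

Lemma zmul1 : zmul 1 = 1.
Proof. by apply/permP=> i; rewrite zmulE ?coprimen1 // mul1r perm1. Qed.

Lemma zmul_exp c m : c ^ m = 1 %[mod M] -> coprime M c -> zmul c ^+ m = 1.
Proof.
move=> cm cM; apply/permP=> i; rewrite zmulX // perm1.
have -> : ((c ^ m)%:R = 1 :> R)%R.
  by apply: val_inj; apply: etrans (val_Zp_nat M1 _) _; rewrite cm -(val_Zp_nat M1).
by rewrite mul1r.
Qed.

Lemma zaddJ c : coprime M c -> zadd ^ zmul c = zadd ^+ c.
Proof.
move=> cM; apply: (mulgI (zmul c)); rewrite -conjgC; apply/permP=> i.
by rewrite !permM zaddX !zmulE // permE mulrDr mulr1.
Qed.

Lemma zaddN : zadd ^+ M = 1.
Proof. by apply/permP=> i; rewrite zaddX pchar_Zp // addr0 perm1. Qed.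

Lemma zadd_order m : zadd ^+ m = 1 -> M %| m.
Proof.
move/permP/(_ 0%R); rewrite zaddX perm1 add0r => e.
by rewrite /dvdn -(val_Zp_nat M1) e.
Qed.
End Sink.

(** The model consists of affine maps on two copies of the integers modulo r^a. The part x_r
    translates the first copy, x_p for p < r multiplies the second by [l p r], and t exchanges the
    copies; so y_p acts on x_r with the prescribed exponent. That the r-type is trivial fits with
    x_r and y_r commuting here. *)
Lemma sink_component (r q0 : nat) : r \in primes n -> q0 \in primes n -> q0 < r ->
    l q0 r != 1%N ->
  exists (gT : finGroupType) (xi : nat -> gT) (t : gT), family_rel g l [:: r] xi t.
Proof.
move=> rn q0n q0r l1; have [ok lb ar np] := good.
have [_ gr] := ar q0 r q0n rn q0r l1.
pose M := (r ^ logn r n)%N.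
have M1 : 1 < M by rewrite -(exp1n (logn r n)) ltn_exp2r ?prime_gt1 ?pr ?logn0.
have cl (q : nat) : q \in primes n -> q < r -> coprime M (l q r).
  move=> qn qr; rewrite coprime_sym; have [_] := lb q r qn rn qr.
  by apply: coprime_pow1; rewrite expn_gt0 prime_gt0 ?pr.
have zl (q : nat) : q \in primes n -> q < r ->
    zmul M1 (l q r) ^+ (q ^ ltexp q (logn q n) (g q)) = 1.
  by move=> qn qr; apply: zmul_exp; [have [] := lb q r qn rn qr | apply: cl].
pose xi (p : nat) := if p == r then dperm (zadd M) 1
  else if p < r then dperm 1 (zmul M1 (l p r)) else 1.
have cp u v : commute (dperm u 1) (dperm 1 v : {perm bool * 'Z_M}).
  by rewrite /commute !dpermM !mulg1 !mul1g.
exists {perm bool * 'Z_M}, xi, (dswap _); split.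
- exact: dswap2.
- move=> p q pn qn; rewrite /xi; case: eqP => _; case: eqP => _ //.
  + case: ifP => _; [exact: cp | exact: commute1].
  + case: ifP => _; [exact/commute_sym/cp | exact/commute_sym/commute1].
  case: ifP => _; case: ifP => _; try exact: commute1; last exact/commute_sym/commute1.
  by rewrite /commute !dpermM !mulg1 zmul_commute.
- move=> p pn; rewrite /xi; case: eqP => [->|_].
    case: (g r) gr => [k|//] /= /eqP k0; rewrite dpermJs k0 /relC expg1.
    have zN : zadd M ^+ (r ^ logn r n) = 1 by apply: zaddN.
    rewrite dpermV dpermM invg1 mulg1 mul1g dpermXl dpermXr dpermX expgVn zN invg1.
    split; do ?[by apply: dperm_eq1]; rewrite dpermJ conjg1; congr (dperm _ _).
    exact/commute_conj/commute_sym/commuteV.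
  case: ifP => [pr'|_]; last by rewrite conj1g; apply: relT1.
  rewrite dpermJs; apply: relT_commuting; rewrite ?pr ?logn0 ?ok ?dpermXl ?dpermXr ?zl //.
  - exact: n2.
  - exact/commute_sym/cp.
  - exact: dperm_eq1.
  exact: dperm_eq1.
- move=> p pn; rewrite /xi; case: eqP => [->|_].
    by rewrite dpermXl; apply: dperm_eq1 => //; apply: zaddN.
  case: ifP => [pr'|_]; last by rewrite expg1n.
  by rewrite dpermXr (expg_dvd (zl p pn pr')) ?dvdn_exp2l ?texp_le //; apply: dperm_eq1.
split=> [q p qn pn qp|p pn]; last first.
  rewrite inE => /eqP ->; rewrite /xi eqxx dpermJs => i j.
  by rewrite dpermXl dpermXr => /dperm_inj[/(zadd_order M1)].
rewrite /xi; have [pr'|pr'] := eqVneq p r.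
  rewrite pr' in qp *; rewrite ltn_eqF // qp dpermJs dpermJ zaddJ ?cl // conj1g.
  by rewrite dpermXl.
case: ifP => [plr|_]; last by rewrite conj1g expg1n.
rewrite (ltn_eqF (ltn_trans qp plr)) (ltn_trans qp plr) dpermJs dpermJ conj1g conjg1.
(* For q < p < r with [l q p] different from 1, shortness gives [l p r = 1], so x_p is trivial in
   this model. *)
have [l2|l2] := eqVneq (l q p) 1%N; first by rewrite l2 expg1.
rewrite (np q p r qn pn rn qp plr l2) zmul1.
by rewrite (_ : dperm 1 1 = 1) ?expg1n //; apply: dperm_eq1.
Qed.

Lemma component (r : nat) : r \in primes n ->
  exists (gT : finGroupType) (xi : nat -> gT) (t : gT), family_rel g l [:: r] xi t.
Proof.
move=> rn.
have [/hasP[q qn /andP[qr l1]]|/hasPn h] :=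
    boolP (has (fun q => (q < r) && (l q r != 1%N)) (primes n)).
  exact: sink_component rn qn qr l1.
apply: source_component => // q qn qr; apply/eqP.
by have := h q qn; rewrite qr negbK.
Qed.

Lemma family_exists (s : seq nat) : {subset s <= primes n} ->
  exists (gT : finGroupType) (xi : nat -> gT) (t : gT), family_rel g l s xi t.
Proof.
elim: s => [|r s IH] sub.
  exists {perm 'I_1}, (fun=> 1), 1; split=> //; first by rewrite mulg1.
  - by move=> p pn; rewrite conj1g; apply: relT1.
  - by move=> p pn; rewrite expg1n.
  by split=> // q p *; rewrite conj1g expg1n.
have [|aT [xi [t [tt c1 r1 p1 [l1 i1]]]]] := IH; first by move=> p ps; rewrite sub ?inE ?ps ?orbT.
have [|rT [xi' [t' [tt' c2 r2 p2 [l2 i2]]]]] := @component r; first by rewrite sub ?mem_head.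
exists (aT * rT)%type, (fun p => (xi p, xi' p)), (t, t'); split.
- by apply: pair_eq; rewrite /= ?tt ?tt'.
- by move=> p q pn qn; apply: pair_commute; [apply: c1 | apply: c2].
- by move=> p pn; apply: relT_pair; [apply: r1 | apply: r2].
- by move=> p pn; apply: pair_eq; rewrite !pairE; [apply: p1 | apply: p2].
split=> [q p qn pn qp|p pn].
  by apply: pair_eq; rewrite !pairE; [apply: l1 | apply: l2].
rewrite inE => ps i j e; case/orP: ps => [/eqP pr'|ps].
  apply: (i2 p pn _ i j); first by rewrite inE pr'.
  by have := congr1 snd e; rewrite !pair2X.
apply: (i1 p pn ps i j); by have := congr1 fst e; rewrite !pair1X.
Qed.
End Existence.

(** * Roots of unity of q-power order modulo a prime power *)

Section RootsOfUnity.
Variables (p q a f : nat).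
Hypotheses (pp : prime p) (pq : prime q) (npq : q != p) (a0 : 0 < a).
Let N := (p ^ a)%N.
Let N1 : 1 < N. Proof. by rewrite -(exp1n a) ltn_exp2r ?prime_gt1. Qed.
Local Notation U := {unit 'Z_N}.

Let natZ (i : 'Z_N) : (nat_of_ord i)%:R%R = i. Proof. exact: natr_Zp. Qed.
Let N_lt (i : 'Z_N) : nat_of_ord i < N.
Proof. by rewrite -[X in _ < X](Zp_cast N1). Qed.
Let natE (i j : nat) : (i%:R = j%:R :> 'Z_N)%R <-> i = j %[mod N].
Proof.
by split=> [/(congr1 (@nat_of_ord _))|e]; [|apply: val_inj]; rewrite /= !val_Zp_nat.
Qed.

Let uX (u : U) k : nat_of_ord (FinRing.uval (u ^+ k)) = nat_of_ord (FinRing.uval u) ^ k %[mod N].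
Proof. by apply/natE; rewrite natZ FinRing.val_unitX natrX natZ. Qed.

Let S : {group U} := 'O_q([set: U])%G.

Let Sq : q.-Sylow([set: U]) S.
Proof. exact: nilpotent_pcore_Hall (abelian_nil (units_Zp_abelian N)). Qed.

Let cS : #|S| = (q ^ logn q p.-1)%N.
Proof.
rewrite (card_Hall Sq) (_ : #|[set: U]| = totient N); last first.
  by rewrite -[[set: U]]/(units_Zp N) card_units_Zp // ltnW.
rewrite totient_pfactor // p_part lognM ?expn_gt0 ?(prime_gt0 pp) //; last first.
  by rewrite ltn_predRL prime_gt1.
by rewrite lognX (@logn_prime q p) // (negbTE npq) muln0 addn0.
Qed.

Let natFE (i j : nat) : (i%:R = j%:R :> 'F_p)%R <-> i = j %[mod p].
Proof.
by split=> [/(congr1 (@nat_of_ord _))|e]; [|apply: val_inj]; rewrite /= !val_Fp_nat.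
Qed.

Let dpN : p %| N. Proof. by rewrite dvdn_exp. Qed.

Let modNp (i j : nat) : i = j %[mod N] -> i = j %[mod p].
Proof. by move=> e; rewrite -(modn_dvdm i dpN) e modn_dvdm. Qed.

Let uvalM (u v : U) : nat_of_ord (FinRing.uval (u * v)) =
  nat_of_ord (FinRing.uval u) * nat_of_ord (FinRing.uval v) %[mod N].
Proof. by apply/natE; rewrite natZ FinRing.val_unitM natrM !natZ. Qed.

Let uval1 : nat_of_ord (FinRing.uval (1 : U)) = 1 %[mod N].
Proof. by apply/(natE _ 1); rewrite natZ. Qed.

Let uval_eq1 (u : U) : nat_of_ord (FinRing.uval u) = 1 %[mod N] -> u = 1.
Proof.
move/natE; rewrite natZ => e; apply: val_inj.
by rewrite /= e.
Qed.

(** Reduction modulo p is injective on the Sylow q-subgroup of the units, by [eqmod1_lift], and so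
    embeds it in the multiplicative group of a field. *)
Let S_cyclic : cyclic S.
Proof.
apply: (@field_mul_group_cyclic _ S 'F_p
    (fun u => (nat_of_ord (FinRing.uval u))%:R%R)) => [u v _ _|u uS].
  by rewrite -natrM; apply/natFE/modNp/uvalM.
split=> [/(natFE _ 1) u1|->]; last by apply/(natFE _ 1)/modNp/uval1.
apply: uval_eq1; apply: (eqmod1_lift (k := q ^ logn q p.-1) pp _ u1).
  by rewrite coprimeXl // prime_coprime // dvdn_prime2.
rewrite -uX; have : u ^+ #|S| = 1 by apply: expg_cardG.
by rewrite cS => ->; apply: uval1.
Qed.

Let m := minn f (logn q p.-1).

(** All solutions lie in the cyclic group [S], whose order is the q-part of p - 1; they form its
    unique subgroup of order q^m. *)
Let H_card : #|[set u : U | u ^+ (q ^ f) == 1]| = (q ^ m)%N.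
Proof.
have [s sS] := cyclicP S_cyclic.
have os : #[s] = (q ^ logn q p.-1)%N by rewrite orderE -sS cS.
have mr : m <= logn q p.-1 by apply: geq_minr.
pose K := <[s ^+ (q ^ (logn q p.-1 - m))]>.
have cK : #|K| = (q ^ m)%N.
  rewrite -orderE orderXdiv os ?dvdn_exp2l ?leq_subr //.
  by rewrite -expnB ?prime_gt0 ?leq_subr // subKn.
rewrite -cK; congr #|pred_of_set _|; apply/setP=> u; rewrite inE.
have KS : K \subset S by rewrite sS cycleX.
apply/idP/idP => [u1|uK]; last first.
  rewrite -order_dvdn; apply: dvdn_trans (order_dvdG uK) _.
  by rewrite cK dvdn_exp2l // geq_minl.
have uS : u \in S.
  rewrite (mem_normal_Hall Sq) ?inE ?pcore_normal //.
  rewrite /p_elt; apply: (@pnat_dvd _ (q ^ f)); first by rewrite order_dvdn.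
  by rewrite pnatX pnat_id.
have uS' : <[u]> \subset S by rewrite cycle_subG.
rewrite -cycle_subG -(cardSg_cyclic S_cyclic uS' KS).
rewrite cK -orderE.
have : #[u] %| gcdn (q ^ f) (q ^ logn q p.-1).
  by rewrite dvdn_gcd order_dvdn u1 -cS order_dvdG.
by rewrite -expn_min.
Qed.

Lemma card_roots_unity (M : nat) : N <= M ->
  #|[set c : 'I_M.+1 | [&& 0 < c < N, c != 1%N :> nat & c ^ (q ^ f) == 1 %[mod N]]]| =
  (q ^ m - 1)%N.
Proof.
move=> NM; pose h (u : U) : 'I_M.+1 := inord (FinRing.uval u).
have hE u : nat_of_ord (h u) = FinRing.uval u.
  by rewrite inordK // ltnS (leq_trans _ NM) // ltnW // N_lt.
have hi : injective h.
  by move=> u v /(congr1 (@nat_of_ord _)); rewrite !hE => e; apply/val_inj/val_inj.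
rewrite -H_card.
set H := [set u : U | _]; have H1 : 1 \in H by rewrite inE expg1n.
rewrite (cardsD1 1 H) H1 addKn -(card_imset _ hi); apply: eq_card => c.
rewrite inE; apply/idP/imsetP.
  case/and3P=> /andP[c0 cN] c1 /eqP ce.
  have cu : (c%:R : 'Z_N)%R \is a GRing.unit.
    rewrite unitZpE // coprime_sym; apply: coprime_pow1 ce.
    by rewrite expn_gt0 prime_gt0.
  pose u : U := FinRing.unit 'Z_N cu.
  have uE : nat_of_ord (FinRing.uval u) = c by rewrite /= val_Zp_nat // modn_small.
  exists u; last by apply: val_inj; rewrite /= hE uE.
  rewrite !inE; apply/andP; split.
    by apply: contra c1 => /eqP u1; rewrite -uE u1.
  by apply/eqP/uval_eq1; rewrite uX uE.
case=> u; rewrite !inE => /andP[u1 /eqP ue] ->; rewrite hE N_lt andbT.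
have ue' : nat_of_ord (FinRing.uval u) ^ (q ^ f) = 1 %[mod N].
  by rewrite -uX ue; apply: uval1.
apply/and3P; split; last exact/eqP.
  rewrite lt0n; apply/eqP=> u0; move: ue'.
  by rewrite u0 exp0n ?expn_gt0 ?prime_gt0 // mod0n modn_small.
by apply: contra u1 => /eqP e; apply/eqP/uval_eq1; rewrite e.
Qed.
End RootsOfUnity.

Lemma commute_bigprod (gT : finGroupType) (s : seq nat) (xi : nat -> gT) (u : gT) :
  (forall q, q \in s -> commute u (xi q)) -> commute u (\prod_(q <- s) xi q).
Proof.
elim: s => [|q s IH] h; first by rewrite big_nil; apply: commute1.
rewrite big_cons; apply: commuteM; first by apply: h; rewrite mem_head.
by apply: IH => q' q's; apply: h; rewrite inE q's orbT.
Qed.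

Section ProductFamily.
Variables (gT : finGroupType) (s : seq nat) (xi : nat -> gT).
Hypothesis cxi : forall p q, p \in s -> q \in s -> commute (xi p) (xi q).

Lemma expg_bigprod n : (forall p, p \in s -> xi p ^+ n = 1) ->
  (\prod_(p <- s) xi p) ^+ n = 1.
Proof.
elim: s cxi => [|p r IH] c h; first by rewrite big_nil expg1n.
rewrite big_cons expgMn; last first.
  by apply: commute_bigprod => q qr; apply: c; rewrite ?mem_head // inE qr orbT.
rewrite h ?mem_head // mul1g IH // => [q q' qr q'r|q qr].
  by apply: c; rewrite inE ?qr ?q'r orbT.
by apply: h; rewrite inE qr orbT.
Qed.

Lemma constt_bigprod (p : nat) : uniq s -> all prime s -> prime p ->
    (forall q : nat, q \in s -> q.-elt (xi q)) ->
  (\prod_(q <- s) xi q).`_p = if p \in s then xi p else 1.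
Proof.
elim: s cxi => [|q r IH] c /=; first by rewrite big_nil constt1.
case/andP=> qr ur /andP[qp ar] pp h.
rewrite big_cons consttM; last first.
  by apply: commute_bigprod => q' q'r; apply: c; rewrite ?mem_head // inE q'r orbT.
rewrite IH // => [|a b ar' br|a ar']; last 2 first.
- by apply: c; rewrite inE ?ar' ?br orbT.
- by apply: h; rewrite inE ar' orbT.
rewrite inE; have [->|npq] := eqVneq p q.
  by rewrite (negbTE qr) mulg1 constt_p_elt // h ?mem_head.
rewrite (constt1P _) ?mul1g //.
have := h q (mem_head _ _); rewrite /p_elt; apply: sub_in_pnat => a _.
by rewrite !inE => /eqP->; rewrite eq_sym.
Qed.
End ProductFamily.

(** The p-part of the product of the commuting elements [xi p] is [xi p] itself, so orders and
    intersections can be checked one prime at a time. *)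
Theorem brel_exists (n : nat) (g : nat -> ltype n) (l : nat -> nat -> nat) :
    0 < n -> 8 %| n -> bgood g l ->
  exists (gT : finGroupType) (x t : gT), isobicyclic n x t /\ brel g l x (x ^ t).
Proof.
move=> n0 n8 good.
have [gT [xi [t [tt cxi rxi pxi [lxi ind]]]]] := family_exists n0 n8 good (fun p pn => pn).
have pr p : p \in primes n -> prime p by rewrite mem_primes => /andP[].
pose x := \prod_(p <- primes n) xi p.
have xp (p : nat) : p \in primes n -> x.`_p = xi p.
  move=> pn; rewrite constt_bigprod ?primes_uniq ?pr ?pn //.
    by apply/allP=> q /pr.
  move=> q qn; rewrite /p_elt; apply: (@pnat_dvd _ (q ^ logn q n)).
    by rewrite order_dvdn pxi.
  by rewrite pnatX pnat_id ?pr.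
have yp (p : nat) : p \in primes n -> (x ^ t).`_p = xi p ^ t by move=> pn; rewrite consttJ xp.
have xn : x ^+ n = 1.
  by apply: expg_bigprod => // p pn; apply: expg_dvd (pxi p pn) _; apply: pfactor_dvdnn.
have xyi i j : x ^+ i = (x ^ t) ^+ j -> n %| i.
  move=> e; apply/(dvdn_partP _ n0) => p; rewrite /= => pn.
  rewrite p_part; apply: (ind p pn pn i j).
  by rewrite -(yp p pn) -(xp p pn) -!consttX e.
have rel : brel g l x (x ^ t).
  split=> //; first by rewrite -conjXg xn conj1g.
    by move=> q qn; rewrite xp ?yp //; apply: rxi.
  move=> q p qn pn qp; rewrite !xp ?yp // lxi //; split=> //.
  have := congr1 (fun u => u ^ t) (lxi q p qn pn qp).
  by rewrite /= conjJg (conjXg (xi p)) -(conjgM (xi q)) tt conjg1.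
exists gT, x, t; split=> //; split=> //.
- apply/eqP; rewrite eqn_dvd order_dvdn xn eqxx /=.
  by apply: (xyi _ 0%N); rewrite expg_order expg0.
- apply/trivgP/subsetP=> u; rewrite inE => /andP[/cycleP[i ->] /cycleP[j e]].
  by apply/set1P; apply: expg_dvd xn (xyi i j e).
by apply: brel_commute rel _ => //; have [] := good.
Qed.

(** * Regular maps and isobicyclic triples *)

Section RegularMap.
Variables (n : nat) (m : {perm Dart n} * {perm Dart n}).
Hypothesis n0 : 0 < n.
Hypothesis reg : reg_Knn m.
Local Notation R := m.1.
Local Notation L := m.2.
Local Notation y := (R ^ L).

Let LK d : L (L d) = d.
Proof. by case/andP: reg => /andP[/forallP/(_ d)/andP[/eqP]]. Qed.

Lemma map_L2 : L * L = 1.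
Proof. by apply/permP=> d; rewrite permM LK perm1. Qed.

Let LV : L^-1 = L.
Proof. by apply: (mulgI L); rewrite mulgV map_L2. Qed.

Let label : exists v : Dart n -> 'I_n + 'I_n,
  [/\ forall d d', v d = v d' <-> d' \in porbit R d,
      forall d, side (v d) != side (v (L d))
    & injective (fun d => (v d, v (L d)))].
Proof.
case/andP: reg => /andP[_ /existsP[v /andP[/andP[h1 h2] h3]]] _.
exists v; split.
- move=> d d'; have /eqP e := forallP (forallP h1 d) d'.
  by split=> [/eqP|h]; [rewrite e | apply/eqP; rewrite e].
- exact/forallP.
- by apply/injectiveP.
Qed.

Let yX j d : (y ^+ j) d = L ((R ^+ j) (L d)).
Proof. by rewrite -conjXg conjgE LV !permM. Qed.

Lemma card_side_pairs :
  #|[set a : ('I_n + 'I_n) * ('I_n + 'I_n) | side a.1 != side a.2]| = (2 * n * n)%N.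
Proof.
pose f (a : bool * ('I_n * 'I_n)) : ('I_n + 'I_n) * ('I_n + 'I_n) :=
  if a.1 then (inl a.2.1, inr a.2.2) else (inr a.2.1, inl a.2.2).
have fi : injective f.
  by case=> -[] [i j] [[] [i' j']] //= [-> ->].
rewrite (_ : [set a | _] = f @: setT).
  by rewrite card_imset // cardsT !card_prod card_bool !card_ord mulnA.
apply/setP=> -[[i|i] [j|j]]; rewrite inE /=; apply/esym/imsetP => //=.
- by case=> -[[] [? ?]].
- by exists (true, (i, j)).
- by exists (false, (i, j)).
- by case=> -[[] [? ?]].
Qed.

(** There are as many darts as ordered pairs of vertices on opposite sides, so an injective
    labelling is onto. *)
Let labels_onto (v : Dart n -> 'I_n + 'I_n) : (forall d, side (v d) != side (v (L d))) ->
    injective (fun d => (v d, v (L d))) ->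
  forall a b, side a != side b -> exists d, v d = a /\ v (L d) = b.
Proof.
move=> h2 h3 a b ab; pose f d := (v d, v (L d)).
have : (a, b) \in f @: setT.
  suff -> : f @: setT = [set a | side a.1 != side a.2] by rewrite inE.
  apply/eqP; rewrite eqEcard card_side_pairs card_imset // cardsT card_ord leqnn andbT.
  by apply/subsetP=> _ /imsetP[d _ ->]; rewrite inE h2.
by case/imsetP=> d _ [-> ->]; exists d.
Qed.

(** This bicentralizer contains R and L, and its elements commute with all automorphisms. As these
    are transitive on darts, it acts freely ([map_semireg]). *)
Let C := 'C('C([set R; L])).

Let RC : R \in C.
Proof. by apply/centP=> u /centP/(_ R); rewrite !inE eqxx => /(_ isT)/commute_sym. Qed.

Let LC : L \in C.
Proof. by apply/centP=> u /centP/(_ L); rewrite !inE eqxx orbT => /(_ isT)/commute_sym. Qed.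

Let yC : y \in C. Proof. by rewrite groupJ. Qed.

Lemma map_semireg w w' d : w \in C -> w' \in C -> w d = w' d -> w = w'.
Proof.
move=> wC w'C e; apply/permP=> d'.
case/andP: reg => _ /forallP/(_ d)/forallP/(_ d')/existsP[g /and3P[/eqP gR /eqP gL /eqP <-]].
have gC : g \in 'C([set R; L]).
  by apply/centP=> u; rewrite !inE => /orP[]/eqP->.
have cg u : u \in C -> u (g d) = g (u d).
  by move=> /centP/(_ g gC) e'; rewrite -!permM e'.
by rewrite !cg // e.
Qed.

Let d0 : Dart n. Proof. by apply: (@Ordinal _ 0); rewrite !muln_gt0 n0. Qed.

Lemma card_opposite (u : 'I_n + 'I_n) : #|[set w : 'I_n + 'I_n | side u != side w]| = n.
Proof.
case: u => i.
  rewrite (_ : [set w | _] = (@inr 'I_n 'I_n) @: setT).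
    by rewrite card_imset ?cardsT ?card_ord // => ? ? [].
  by apply/setP=> -[j|j]; rewrite inE; apply/esym/imsetP; [case | exists j].
rewrite (_ : [set w | _] = (@inl 'I_n 'I_n) @: setT).
  by rewrite card_imset ?cardsT ?card_ord // => ? ? [].
by apply/setP=> -[j|j]; rewrite inE; apply/esym/imsetP; [exists j | case].
Qed.

Lemma map_porbit d : #|porbit R d| = n.
Proof.
have [v [h1 h2 h3]] := label.
have -> : porbit R d = [set d' | v d' == v d].
  apply/setP=> d'; rewrite inE; apply/idP/eqP => [/h1->//|/esym/h1//].
pose f d' := v (L d').
have fi : {in [set d' | v d' == v d] &, injective f}.
  by move=> a b; rewrite !inE => /eqP ea /eqP eb e; apply: h3; rewrite /= ea eb; congr pair.
rewrite -(card_in_imset fi); apply: etrans (card_opposite (v d)).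
apply: eq_card => w.
apply/imsetP/idP => [[d' + ->]|]; rewrite inE.
  by move/eqP <-; rewrite ?inE h2.
move=> h; have [d' [e1 e2]] := labels_onto h2 h3 h.
by exists d'; rewrite ?inE ?e1.
Qed.

Lemma map_ordR : #[R] = n.
Proof.
apply/eqP; rewrite eqn_dvd; apply/andP; split.
  rewrite order_dvdn; apply/eqP/permP=> d.
  by have := iter_porbit R d; rewrite map_porbit permX perm1.
by have := dvdn_orbit 'P <[R]> d0; rewrite -porbitE map_porbit.
Qed.

(** R^i preserves the label of d and y^j that of L d; a permutation doing both fixes every dart. *)
Lemma map_ti i j : R ^+ i = y ^+ j -> R ^+ i = 1.
Proof.
have [v [h1 h2 h3]] := label.
move=> e; apply/permP=> d; rewrite perm1; apply: h3 => /=; congr pair.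
  by apply/h1; rewrite porbit_sym; apply: mem_porbit.
rewrite e yX LK; apply/h1; rewrite porbit_sym; exact: mem_porbit.
Qed.

Lemma map_reach d d' :
  (exists a b, d' = (y ^+ a * R ^+ b) d) \/ (exists a b, d' = (L * y ^+ a * R ^+ b) d).
Proof.
have [v [h1 h2 h3]] := label.
have main e : side (v e) = side (v d') -> exists a b, d' = (y ^+ a * R ^+ b) e.
  move=> se; have : side (v d') != side (v (L e)) by rewrite -se.
  case/(labels_onto h2 h3)=> d2 [/h1/porbitP[b e2] /esym/h1/porbitP[a e1]].
  exists a, b; rewrite permM yX e2; congr (_ _).
  by rewrite -e1 LK.
have [/main h|h] := eqVneq (side (v d)) (side (v d')); first by left.
right; have [|a [b e]] := main (L d).
  by have := h2 d; move: h; case: (side _); case: (side _); case: (side _).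
by exists a, b; rewrite -mulgA permM.
Qed.

Lemma map_side (v : Dart n -> 'I_n + 'I_n) a b d :
    (forall d d', v d = v d' <-> d' \in porbit R d) ->
    (forall d, side (v d) != side (v (L d))) ->
  side (v ((y ^+ a * R ^+ b) d)) = side (v d).
Proof.
move=> h1 h2; have vR k e : v ((R ^+ k) e) = v e by apply/esym/h1; apply: mem_porbit.
rewrite permM vR yX; have := h2 d.
have := h2 ((R ^+ a) (L d)); rewrite vR.
by case: (side _); case: (side _); case: (side _).
Qed.

(** R^i y keeps d0 on its side, so [map_reach] gives the same image under some y^a R^b, and freeness
    turns this into an equality of permutations. *)
Theorem map_isobicyclic : isobicyclic n R L.
Proof.
split; first exact: map_L2.
- exact: map_ordR.
- apply/trivgP/subsetP=> u; rewrite inE => /andP[/cycleP[i ->] /cycleP[j e]].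
  by apply/set1P; apply: map_ti e.
apply: commute_cycles => i.
have [v [h1 h2 h3]] := label.
have s0 : side (v ((R ^+ i * y) d0)) = side (v d0).
  have e1 := map_side 1 0 ((R ^+ i) d0) h1 h2; have e2 := map_side 0 i d0 h1 h2.
  rewrite expg0 mul1g in e2; rewrite expg1 expg0 mulg1 in e1.
  by rewrite permM e1 e2.
have [[a [b e]]|[a [b e]]] := map_reach d0 ((R ^+ i * y) d0).
  have -> : R ^+ i * y = y ^+ a * R ^+ b.
    exact: map_semireg (groupM (groupX i RC) yC) (groupM (groupX a yC) (groupX b RC)) e.
  by rewrite mem_mulg ?mem_cycle.
have := h2 d0; rewrite -s0 e.
have := map_side a b (L d0) h1 h2; rewrite -!permM mulgA => ->.
by rewrite eqxx.
Qed.

Lemma map_word_inj (e e' : bool) (a b a' b' : nat) d :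
    (L ^+ e * y ^+ a * R ^+ b) d = (L ^+ e' * y ^+ a' * R ^+ b') d ->
  [/\ e = e', a = a' %[mod n] & b = b' %[mod n]].
Proof.
have [v [h1 h2 h3]] := label => E.
have sv (f : bool) c1 c2 : side (v ((L ^+ f * y ^+ c1 * R ^+ c2) d)) = f (+) side (v d).
  rewrite -mulgA permM map_side //; case: f; rewrite ?expg0 ?perm1 // expg1.
  by have := h2 d; case: (side _); case: (side _).
have ee : e = e' by have := sv e a b; rewrite E sv => /addIb.
have wC (f : bool) c1 c2 : L ^+ f * y ^+ c1 * R ^+ c2 \in C.
  exact: groupM (groupM (groupX f LC) (groupX c1 yC)) (groupX c2 RC).
have := map_semireg (wC e a b) (wC e' a' b') E.
rewrite -ee -!mulgA => /mulgI E'.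
have E2 : (y ^+ a')^-1 * y ^+ a = R ^+ b' * (R ^+ b)^-1.
  by apply: (mulgI (y ^+ a')); rewrite mulKVg mulgA -E' mulgK.
have [_ _ ti _] := map_isobicyclic.
have E3 : (y ^+ a')^-1 * y ^+ a = 1.
  have : (y ^+ a')^-1 * y ^+ a \in <[R]> :&: <[y]>.
    by rewrite inE {1}E2 !groupM ?groupV ?mem_cycle.
  by rewrite ti => /set1P.
have oy : #[y] = n by rewrite orderJ map_ordR.
split=> //; apply/eqP.
  have := eq_expg_mod_order y a a'; rewrite oy => <-.
  apply/eqP/(mulgI (y ^+ a')^-1).
  by rewrite E3 mulVg.
have := eq_expg_mod_order R b b'; rewrite map_ordR eq_sym => <-.
apply/eqP/(mulIg (R ^+ b)^-1).
by rewrite -E2 E3 mulgV.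
Qed.

(** In the coordinates (e, a, b) of a dart R merely adds 1 to b; L depends only on how R^a y^b is
    rewritten in the other order. *)
Lemma map_word_L (e : bool) (a b a' b' : nat) d : R ^+ a * y ^+ b = y ^+ a' * R ^+ b' ->
  L ((L ^+ e * y ^+ a * R ^+ b) d) = (L ^+ (~~ e) * y ^+ a' * R ^+ b') d.
Proof.
move=> E; rewrite -permM; congr (fun_of_perm _ _).
have {E} E : y ^+ a * R ^+ b * L = L * (y ^+ a' * R ^+ b').
  rewrite -E (conjgC _ L); congr (_ * _); rewrite conjMg !(conjXg _ L).
  by rewrite -(conjgM R) map_L2 conjg1.
rewrite -!mulgA [y ^+ a * _]mulgA E; case: e => /=; rewrite ?expg1 ?expg0 ?mul1g //.
by rewrite mulgA map_L2 mul1g.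
Qed.
End RegularMap.

(** Darts of either map are the words L^e y^a R^b applied to d0. Matching equal words respects R at
    once, and respects L by the common rewriting of [brel_same]. *)
Theorem map_iso_brel (n : nat) (p q : {perm Dart n} * {perm Dart n})
    (g : nat -> ltype n) (l : nat -> nat -> nat) :
    0 < n -> 8 %| n -> (forall q : nat, q \in primes n -> ltype_ok q (logn q n) (g q)) ->
    reg_Knn p -> reg_Knn q -> brel g l p.1 (p.1 ^ p.2) -> brel g l q.1 (q.1 ^ q.2) ->
  map_iso p q.
Proof.
move=> n0 n8 ok rp rq bp bq.
have d0 : Dart n by apply: (@Ordinal _ 0); rewrite !muln_gt0 n0.
pose W (m : {perm Dart n} * {perm Dart n}) (c : bool * ('I_n * 'I_n)) :=
  (m.2 ^+ c.1 * (m.1 ^ m.2) ^+ c.2.1 * m.1 ^+ c.2.2) d0.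
have cT : #|{: bool * ('I_n * 'I_n)}| = #|Dart n|.
  by rewrite !card_prod card_bool !card_ord mulnA.
have Wi m : reg_Knn m -> injective (W m).
  move=> rm [e [a b]] [e' [a' b']] /(map_word_inj n0 rm)[/= -> ea eb].
  rewrite !modn_small // in ea; rewrite !modn_small // in eb.
  by congr (_, (_, _)); apply: val_inj.
have [Wp' pK Kp] := inj_card_bij (Wi p rp) (eq_leq (esym cT)).
pose h d := W q (Wp' d).
have hi : injective h by move=> d d' /(Wi q rq) /(can_inj Kp).
have mn k : k %% n < n by rewrite ltn_mod.
have hW (e : bool) (a b : nat) : h ((p.2 ^+ e * (p.1 ^ p.2) ^+ a * p.1 ^+ b) d0) =
    (q.2 ^+ e * (q.1 ^ q.2) ^+ a * q.1 ^+ b) d0.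
  have red m : reg_Knn m -> (m.2 ^+ e * (m.1 ^ m.2) ^+ a * m.1 ^+ b) d0 =
      W m (e, (Ordinal (mn a), Ordinal (mn b))).
    move=> rm; rewrite /W /= -{1}(expg_mod_order m.1) -(expg_mod_order (m.1 ^ m.2)).
    by rewrite orderJ (map_ordR n0 rm).
  by rewrite (red p rp) (red q rq) /h pK.
have all_d d : exists (e : bool) a b, d = (p.2 ^+ e * (p.1 ^ p.2) ^+ a * p.1 ^+ b) d0.
  by rewrite -[d]Kp; case: (Wp' d) => e [a b]; exists e, a, b.
apply/existsP; exists (perm hi).
have conj_eq (u u' : {perm Dart n}) : (forall d, h (u d) = u' (h d)) -> u' = u ^ perm hi.
  move=> e; apply: (mulgI (perm hi)); rewrite -conjgC; apply/permP=> d.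
  by rewrite !permM !permE e.
apply/andP; split; apply/eqP/conj_eq => d; have [e [a [b ->]]] := all_d d.
  by rewrite -[p.1 _]permM -mulgA -expgSr !hW -permM -[in RHS]mulgA -expgSr.
have [a' [b' [e1 e2]]] := brel_same a b n8 n0 ok bp bq.
by rewrite (map_word_L rp e d0 e1) !hW (map_word_L rq e d0 e2).
Qed.

Lemma map_iso_transport (n : nat) (p q : {perm Dart n} * {perm Dart n})
    (g : nat -> ltype n) (l : nat -> nat -> nat) :
  map_iso p q -> brel g l p.1 (p.1 ^ p.2) -> brel g l q.1 (q.1 ^ q.2).
Proof.
case/existsP=> u /andP[/eqP -> /eqP ->]; rewrite -conjJg.
exact: (brel_morph (conjgm_morphism [group of [set: {perm Dart n}]] u)
  (in_setT p.1) (in_setT (p.1 ^ p.2))).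
Qed.

(** * The regular map of an isobicyclic triple *)

Section MapOfGroup.
Variables (n : nat) (gT : finGroupType) (x t : gT).
Hypothesis iso : isobicyclic n x t.
Local Notation y := (x ^ t).
Local Notation G := (bigrp x y).
Let n0 : 0 < n. Proof. exact: iso_gt0 iso. Qed.
(** The flag replaces t, which may lie in G: R and L below are right multiplications by x and by an
    external involution acting on G as t. The vertices are the cosets u<x>, each with a side. *)
Let S := [set a : bool * gT | a.2 \in G].

Let cS : #|S| = (2 * n * n)%N.
Proof.
rewrite (_ : S = setX [set: bool] G); last by apply/setP=> a; rewrite !inE.
by rewrite cardsX cardsT card_bool (iso_card iso) mulnA.
Qed.

Let S1 : (true, 1) \in S. Proof. by rewrite inE group1. Qed.

Let dec (d : Dart n) : bool * gT := enum_val (cast_ord (esym cS) d).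
Let enc (a : bool * gT) : Dart n := cast_ord cS (enum_rank_in S1 a).

Let decG d : (dec d).2 \in G.
Proof. by have := enum_valP (cast_ord (esym cS) d); rewrite inE. Qed.

Let encK a : a.2 \in G -> dec (enc a) = a.
Proof. by move=> aG; rewrite /dec /enc cast_ordK enum_rankK_in // inE. Qed.

Let decK d : enc (dec d) = d.
Proof. by rewrite /dec /enc enum_valK_in cast_ordKV. Qed.

Let dec_inj d d' : dec d = dec d' -> d = d'.
Proof. by move=> e; rewrite -[d]decK e decK. Qed.

Let lift_inj (F : bool * gT -> bool * gT) :
  (forall a, a.2 \in G -> (F a).2 \in G) -> injective F ->
  injective (fun d => enc (F (dec d))).
Proof.
move=> FG Fi d d' /(congr1 dec); rewrite !encK ?FG //.
by move/Fi/dec_inj.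
Qed.

Let tG u : u \in G -> u ^ t \in G.
Proof. by move=> uG; rewrite memJ_norm // (iso_Gt iso). Qed.

Let Ft (a : bool * gT) := (~~ a.1, a.2 ^ t).
Let FtG a : a.2 \in G -> (Ft a).2 \in G. Proof. exact: tG. Qed.
Let Fti : injective Ft.
Proof. by case=> b u [b' u'] [/negb_inj -> /conjg_inj ->]. Qed.

Let Fr (g : gT) (a : bool * gT) := (a.1, a.2 * (if g \in G then g else 1)).
Let FrG g a : a.2 \in G -> (Fr g a).2 \in G.
Proof. by move=> aG; rewrite groupM //; case: ifP. Qed.
Let Fri g : injective (Fr g).
Proof. by case=> b u [b' u'] [-> /mulIg ->]. Qed.

Let theta g : {perm Dart n} := perm (lift_inj (@FrG g) (@Fri g)).
Let Lm : {perm Dart n} := perm (lift_inj FtG Fti).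

Let thetaE g d : g \in G -> dec (theta g d) = ((dec d).1, (dec d).2 * g).
Proof. by move=> gG; rewrite permE encK ?FrG // /Fr gG. Qed.

Let LmE d : dec (Lm d) = (~~ (dec d).1, (dec d).2 ^ t).
Proof. by rewrite permE encK ?FtG. Qed.

Let thetaM : {in G &, {morph theta : u v / u * v}}.
Proof.
move=> u v uG vG; apply/permP=> d; rewrite permM; apply: dec_inj.
by rewrite !thetaE ?groupM //= mulgA.
Qed.

Canonical theta_morphism := Morphism thetaM.

Let theta_t g : g \in G -> theta g ^ Lm = theta (g ^ t).
Proof.
move=> gG; apply: (mulgI Lm); rewrite -conjgC; apply/permP=> d; rewrite !permM.
by apply: dec_inj; rewrite LmE !thetaE ?tG //= LmE conjMg.
Qed.

Let xG : x \in G := mem_bigrp_l x y.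
Let R := theta x.

Let idx_ex g : g \in G -> exists b : 'I_n, y ^- b * g \in <[x]>.
Proof.
case/(iso_GrP iso)=> i [j ->].
exists (Ordinal (ltn_pmod i n0)) => /=.
by rewrite -{1}(iso_ordy iso) expg_mod_order mulKg mem_cycle.
Qed.

Let idx g : 'I_n := odflt (Ordinal n0) [pick b : 'I_n | y ^- b * g \in <[x]>].

Let idxP g : g \in G -> y ^- idx g * g \in <[x]>.
Proof.
move=> gG; rewrite /idx; case: pickP => [b //|h].
by have [b] := idx_ex gG; rewrite h.
Qed.

Let idx_eq g g' : g \in G -> g' \in G -> idx g = idx g' <-> g^-1 * g' \in <[x]>.
Proof.
move=> gG g'G; split=> [e|h].
  have h1 := idxP gG; have h2 := idxP g'G; rewrite -e in h2.
  have := groupM (groupVr h1) h2; rewrite invMg invgK -mulgA mulKVg.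
  by [].
have h2 := idxP g'G; have := groupM (idxP gG) h; rewrite -mulgA mulKVg => h1.
have : y ^- idx g * y ^+ idx g' \in <[x]> :&: <[y]>.
  rewrite inE; apply/andP; split; last by rewrite groupM ?groupV ?mem_cycle.
  have := groupM h1 (groupVr h2); rewrite invMg invgK -mulgA mulKVg.
  by [].
case: (iso) => _ _ -> _ /set1P e; apply: val_inj; apply/eqP => /=.
have := eq_expg_mod_order y (idx g) (idx g'); rewrite (iso_ordy iso) !modn_small // => <-.
by apply/eqP/(mulgI (y ^- idx g)); rewrite mulVg e.
Qed.

Let vlab (d : Dart n) : 'I_n + 'I_n :=
  if (dec d).1 then inl (idx (dec d).2) else inr (idx (dec d).2).

Let vlabE d d' : vlab d = vlab d' <->
  (dec d).1 = (dec d').1 /\ (dec d).2^-1 * (dec d').2 \in <[x]>.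
Proof.
rewrite -idx_eq // /vlab; case: (dec d).1; case: (dec d').1.
- by split=> [[]|[_ ->]].
- by split=> [|[]].
- by split=> [|[]].
- by split=> [[]|[_ ->]].
Qed.

Let thetaXE k d : dec ((R ^+ k) d) = ((dec d).1, (dec d).2 * x ^+ k).
Proof.
have -> : R ^+ k = theta (x ^+ k) by rewrite morphX.
by rewrite thetaE ?groupX.
Qed.

Let side_vlab d : side (vlab d) = (dec d).1.
Proof. by rewrite /vlab; case: (dec d).1. Qed.

Lemma map_of_group_Knn : KnnMap (R, Lm).
Proof.
apply/andP; split.
  apply/forallP=> d; apply/andP; split=> /=.
    apply/eqP/dec_inj; rewrite !LmE /= negbK (iso_tK iso).
    by case: (dec d).
  by apply/eqP=> /(congr1 dec); rewrite LmE => /(congr1 fst) /=; case: (_.1).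
apply/existsP; exists [ffun d => vlab d]; apply/andP; split; first (apply/andP; split).
- apply/forallP=> d; apply/forallP=> d'; rewrite !ffunE /=; apply/eqP; apply/idP/idP.
    move=> /eqP/vlabE[e1 /cycleP[k e2]]; apply/porbitP; exists k; apply: dec_inj.
    by rewrite thetaXE -e2 e1 mulKVg; case: (dec d').
  case/porbitP=> k ->; apply/eqP/vlabE; rewrite thetaXE /= mulKg mem_cycle.
  by split.
- by apply/forallP=> d; rewrite !ffunE !side_vlab LmE /=; case: (_.1).
apply/injectiveP=> d d' /=; rewrite !ffunE => -[/vlabE[e1 h1] /vlabE[_]].
rewrite !LmE /= -conjVg -conjMg => h2; apply: dec_inj.
have : (dec d).2^-1 * (dec d').2 \in <[x]> :&: <[y]>.
  by rewrite inE h1 cycleJ -(iso_tK iso (_ * _)) memJ_conjg.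
case: (iso) => _ _ -> _ /set1P e2.
case: (dec d) (dec d') e1 e2 => b u [b' u'] /= -> e2.
by rewrite -[u]mulg1 -e2 mulKVg.
Qed.

(** These are left multiplications, by k on the side [e] and by its t-conjugate on the other,
    followed by an exchange of sides if [s] holds. *)
Let aut (k : gT) (e s : bool) (a : bool * gT) : bool * gT :=
  (a.1 (+) s, (if a.1 == e then k else k ^ t) * a.2).

Lemma map_of_group_regular : regular_map (R, Lm).
Proof.
apply/forallP=> d; apply/forallP=> d'; apply/existsP.
pose k := (dec d').2 * (dec d).2^-1.
have kG : k \in G by rewrite groupM ?groupV.
pose F := aut k (dec d).1 ((dec d).1 (+) (dec d').1).
have FG a : a.2 \in G -> (F a).2 \in G.
  by move=> aG; rewrite groupM //; case: ifP => _ //; apply: tG.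
have Fi : injective F.
  by case=> b u [b' u'] [/addIb -> /mulgI ->].
pose f := perm (lift_inj FG Fi).
have fE a : dec (f a) = F (dec a) by rewrite permE encK ?FG.
exists f => /=; apply/and3P; split.
- apply/eqP/permP=> a; rewrite !permM; apply: dec_inj.
  by rewrite (thetaE _ xG) !fE (thetaE _ xG) /F /aut /= mulgA.
- apply/eqP/permP=> a; rewrite !permM; apply: dec_inj.
  rewrite LmE !fE LmE /F /aut /=; congr pair; first by rewrite addNb.
  rewrite conjMg; congr (_ * _).
  by case: ((dec a).1); case: ((dec d).1) => //=; rewrite (iso_tK iso).
apply/eqP/dec_inj; rewrite fE /F /aut eqxx /k mulgKV.
by rewrite addbA addbb addFb; case: (dec d').
Qed.

Theorem map_exists (g : nat -> ltype n) (l : nat -> nat -> nat) : brel g l x y ->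
  exists2 p : {perm Dart n} * {perm Dart n}, reg_Knn p & brel g l p.1 (p.1 ^ p.2).
Proof.
move=> rel; exists (R, Lm).
  by rewrite /reg_Knn map_of_group_Knn map_of_group_regular.
rewrite /= theta_t //.
exact: (brel_morph theta_morphism xG (tG xG) rel).
Qed.
End MapOfGroup.

Local Open Scope nat_scope.

(** * Counting parameters by their gcd with a prime power *)

Lemma sum_multiples (a b : nat) (G : nat -> nat) : 0 < a ->
  (forall k, ~~ (a %| k) -> G k = 0) ->
  \sum_(0 <= k < a * b) G k = \sum_(0 <= u < b) G (a * u).
Proof.
move=> a0 G0; elim: b => [|b IH]; first by rewrite muln0 !big_geq.
rewrite big_nat_recr //= -IH mulnS addnC (@big_cat_nat _ _ _ (a * b)) ?leq_addr //=.
congr (_ + _); rewrite big_ltn; last by rewrite -[X in X < _]addn0 ltn_add2l.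
rewrite big_nat big1 ?addn0 // => k /andP[h1 h2]; apply: G0.
apply/negP=> /dvdnP[c kc]; move: h1 h2; rewrite kc [c * a]mulnC.
by rewrite ltn_pmul2l // -mulnSr ltn_pmul2l // ltnS => h1 h2; rewrite leqNgt h1 in h2.
Qed.

Section TotientSum.
Variables (q : nat).
Hypothesis pq : prime q.
Let lg e k := logn q (gcdn k (q ^ e)).

Let gcd_lg e k : gcdn k (q ^ e) = q ^ lg e k.
Proof.
have : gcdn k (q ^ e) %| q ^ e by apply: dvdn_gcdr.
by case/(dvdn_pfactor _ _ pq)=> i _ E; rewrite /lg E pfactorK.
Qed.

Let lg_le e k : lg e k <= e.
Proof.
have := dvdn_leq_log q (_ : 0 < q ^ e) (dvdn_gcdr k (q ^ e)).
by rewrite expn_gt0 prime_gt0 // pfactorK //; apply.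
Qed.

Let dvd_lg e k m : m <= e -> (q ^ m %| k) = (m <= lg e k).
Proof.
move=> me; have -> : (q ^ m %| k) = (q ^ m %| gcdn k (q ^ e)).
  by rewrite dvdn_gcd (dvdn_exp2l _ me) andbT.
by rewrite gcd_lg dvdn_Pexp2l ?prime_gt1.
Qed.

(** Writing k = q^f u turns the condition into u prime to q^(e-f). For f = e it counts k = 0
    alone. *)
Let count_lg e f : f <= e -> \sum_(0 <= k < q ^ e) (lg e k == f) = totient (q ^ (e - f)).
Proof.
move=> fe; rewrite totient_count_coprime -{1}(subnKC fe) expnD sum_multiples.
- apply: eq_bigr => u _; congr nat_of_bool.
  have eE : q ^ e = q ^ f * q ^ (e - f) by rewrite -expnD subnKC.
  rewrite /lg eE -muln_gcdr lognM ?expn_gt0 ?(prime_gt0 pq) //; last first.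
    by rewrite gcdn_gt0 expn_gt0 (prime_gt0 pq) orbT.
  rewrite pfactorK // -[X in _ == X]addn0 eqn_add2l.
  rewrite -/(lg (e - f) u) coprime_sym /coprime gcd_lg.
  by rewrite -[X in _ = (_ == X)](expn0 q) eqn_exp2l ?prime_gt1.
- by rewrite expn_gt0 prime_gt0.
move=> k; rewrite (@dvd_lg e) //; case: eqP => [-> |//].
by rewrite leqnn.
Qed.

Lemma sum_gcd_totient (e m n : nat) (F : nat -> nat) : m <= e -> q ^ e <= n ->
  \sum_(k < n | (k < q ^ e) && (q ^ m %| k)) F (logn q (gcdn k (q ^ e))) =
  \sum_(m <= f < e.+1) totient (q ^ (e - f)) * F f.
Proof.
move=> me en.
transitivity (\sum_(0 <= k < q ^ e) \sum_(m <= f < e.+1) (lg e k == f) * F f).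
  rewrite (eq_bigl (fun k : 'I_n => (q ^ m %| k) && (k < q ^ e))); last first.
    by move=> k; rewrite andbC.
  rewrite -(@big_ord_widen_cond _ _ _ (q ^ e) n (fun k => q ^ m %| k) (fun k => F (lg e k)) en).
  rewrite -(@big_mkord _ _ _ (q ^ e) (fun k => q ^ m %| k) (fun k => F (lg e k))) big_mkcond /=.
  apply: eq_bigr => k _; rewrite (@dvd_lg e) //; case: ifP => [ml|/negbT ml].
    rewrite (bigD1_seq (lg e k)) ?iota_uniq //=; last first.
      by rewrite mem_index_iota ml ltnS lg_le.
    rewrite eqxx mul1n big1 ?addn0 // => f nf.
    by rewrite eq_sym (negbTE nf) mul0n.
  rewrite big_nat big1 // => f /andP[mf _].
  by case: eqP => [E|]; rewrite ?mul0n //; rewrite E mf in ml.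
rewrite exchange_big /= big_nat [RHS]big_nat; apply: eq_bigr => f /andP[_ fe].
by rewrite -big_distrl /= count_lg.
Qed.
End TotientSum.

Lemma short_arcP (n : nat) (A : {set 'I_n.+1 * 'I_n.+1}) (a : 'I_n.+1 * 'I_n.+1) :
    0 < n -> short_spanning A -> a \in A ->
  [/\ (a.1 : nat) \in primes n, (a.2 : nat) \in primes n, a.1 < a.2 & a.1 %| a.2.-1].
Proof.
move=> n0 /andP[/forall_inP h _] /h /and5P[qp pp qn pn d].
have p1 := prime_gt1 pp.
rewrite !mem_primes qp pp qn pn n0; split=> //.
by rewrite -(ltn_predK p1) ltnS dvdn_leq // ltn_predRL.
Qed.

(** * Counting the invariants *)

Section Data.
Variable n : nat.
Hypotheses (n0 : 0 < n) (n8 : 8 %| n).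
Local Notation I := 'I_n.+1.
Implicit Types (A : {set I * I}) (G : {ffun I -> ltype n}) (La : {ffun I * I -> I}).

Definition data := ({set I * I} * ({ffun I -> ltype n} * {ffun I * I -> I}))%type.

(** Terminal primes have the trivial type, and indices that are not primes of n receive it as a
    default; likewise [arc_ok] fixes the exponent 1 off A. So data are counted as full families
    without redundancy. *)
Definition source_ok A (q : I) : pred (ltype n) :=
  fun tau => if ((q : nat) \in primes n) && nonterminal A q
             then ltype_ok q (logn q n) tau else ltriv tau.

Definition arc_ok A G (a : I * I) : pred I :=
  fun c => if a \in A then
      [&& 0 < c < a.2 ^ logn a.2 n, c != 1 :> nat
        & c ^ (a.1 ^ ltexp a.1 (logn a.1 n) (G a.1)) == 1 %[mod a.2 ^ logn a.2 n]]
    else c == 1 :> nat.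

Definition data_ok : {set data} :=
  [set d | [&& short_spanning d.1, d.2.1 \in family (source_ok d.1)
             & d.2.2 \in family (arc_ok d.1 d.2.1)]].

Definition gof (d : data) (q : nat) : ltype n := d.2.1 (inord q).
Definition lof (d : data) (q p : nat) : nat := d.2.2 (inord q, inord p).

Let primeP (q : nat) : q \in primes n -> prime q.
Proof. by rewrite mem_primes => /andP[]. Qed.

Let prime_le (q : nat) : q \in primes n -> q < n.+1.
Proof. by rewrite mem_primes ltnS => /and3P[_ _ qn]; apply: dvdn_leq. Qed.

Let inordE (q : nat) : q \in primes n -> nat_of_ord (inord q : I) = q.
Proof. by move=> qn; rewrite inordK ?prime_le. Qed.

Let pow_gt1 (p : nat) : p \in primes n -> 1 < p ^ logn p n.
Proof.
by move=> pn; rewrite -(exp1n (logn p n)) ltn_exp2r ?logn_gt0 ?prime_gt1 ?primeP.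
Qed.

Let arc_path A (a b : I * I) : short_spanning A -> a \in A -> b \in A ->
  (a.2 : nat) <> b.1.
Proof. by move=> /andP[_ /forall_inP h] /h /forall_inP h' /h' /eqP. Qed.

Lemma data_good d : d \in data_ok -> bgood (gof d) (lof d).
Proof.
case: d => A [G La]; rewrite inE /= => /and3P[sA /familyP hG /familyP hL].
have lE (q p : nat) : q \in primes n -> p \in primes n ->
    lof (A, (G, La)) q p != 1 -> (inord q, inord p) \in A.
  move=> qn pn l1; have := hL (inord q, inord p); rewrite unfold_in /arc_ok.
  by case: ifP => // _ /eqP e; move: l1; rewrite /lof /= e.
split.
- move=> q qn; have := hG (inord q); rewrite unfold_in /source_ok inordE // qn /= /gof /=.
  case: ifP => // _; case: (G _) => [k|//] /= /eqP ->.
  by rewrite expn_gt0 prime_gt0 ?primeP // !dvdn0 implybT.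
- move=> q p qn pn qp; have := hL (inord q, inord p); rewrite unfold_in /arc_ok /= !inordE //.
  case: ifP => [_ /and3P[h1 _ /eqP h2]|_ /eqP e]; first by split.
  by rewrite /lof /= e /= pow_gt1 // exp1n.
- move=> q p qn pn qp /(lE q p qn pn) qpA.
  have [_ _ _] := short_arcP n0 sA qpA; rewrite /= !inordE // => d; split=> //.
  have := hG (inord p); rewrite unfold_in /source_ok.
  suff /negbTE-> : ~~ nonterminal A (inord p : I) by rewrite andbF.
  by rewrite negb_forall_in; apply/exists_inP; exists (inord q, inord p); rewrite ?negbK.
move=> r q p rn qn pn rq qp /(lE r q rn qn) rA; apply/eqP/negPn/negP => /(lE q p qn pn) qA.
exact: (arc_path sA rA qA).
Qed.

Let triv_eq (tau tau' : ltype n) : ltriv tau -> ltriv tau' -> tau = tau'.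
Proof.
case: tau tau' => [k|//] [k'|//] /= /eqP e /eqP e'.
by congr inl; apply: val_inj; rewrite /= e e'.
Qed.

Lemma data_surj (g : nat -> ltype n) (l : nat -> nat -> nat) : bgood g l ->
  exists2 d, d \in data_ok &
    (forall q : nat, q \in primes n -> gof d q = g q) /\
    (forall q p : nat, q \in primes n -> p \in primes n -> q < p -> lof d q p = l q p).
Proof.
move=> [ok lb ar np].
pose A := [set a : I * I | [&& (a.1 : nat) \in primes n, (a.2 : nat) \in primes n,
  a.1 < a.2 & l a.1 a.2 != 1]].
pose tr : ltype n := inl (Ordinal n0).
pose G := [ffun q : I => if ((q : nat) \in primes n) && nonterminal A q then g q else tr].
pose La := [ffun a : I * I => if a \in A then inord (l a.1 a.2) else inord 1 : I].
have sA : short_spanning A.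
  apply/andP; split; apply/forall_inP => a; rewrite inE => /and4P[qn pn qp l1].
    have [d _] := ar _ _ qn pn qp l1.
    by move: qn pn; rewrite !mem_primes /Pi_arc => /and3P[-> _ ->] /and3P[-> _ ->].
  apply/forall_inP => b; rewrite inE => /and4P[qn' pn' qp' l1'].
  apply/eqP => e; rewrite -e in qn' qp' l1'.
  by move/eqP: l1'; apply; apply: (np a.1 a.2 b.2).
have gE (q : nat) : q \in primes n -> gof (A, (G, La)) q = g q.
  move=> qn; rewrite /gof /= ffunE inordE // qn /=; case: ifP => // /negbT.
  rewrite negb_forall_in => /exists_inP[a]; rewrite inE negbK => /and4P[q1 p1 qp l1] /eqP e.
  have [_ tg] := ar _ _ q1 p1 qp l1; rewrite e in tg.
  exact: triv_eq.
have l_lt (q p : nat) : q \in primes n -> p \in primes n -> q < p -> l q p < n.+1.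
  move=> qn pn qp; have [/andP[_ h] _] := lb q p qn pn qp.
  apply: leq_trans h _; apply: leq_trans (leqnSn n).
  by rewrite dvdn_leq // pfactor_dvdnn.
have lE (q p : nat) : q \in primes n -> p \in primes n -> q < p ->
    lof (A, (G, La)) q p = l q p.
  move=> qn pn qp; rewrite /lof /= ffunE inE /= !inordE // qn pn qp /=.
  by case: eqP => [->|_] /=; rewrite inordK // l_lt.
exists (A, (G, La)) => //; rewrite inE /= sA /=; apply/andP; split.
  apply/familyP => q; rewrite unfold_in /source_ok /G ffunE.
  by case: ifP => [c|c]; rewrite c /= ?eqxx //; case/andP: c => qn _; apply: ok.
apply/familyP => a; rewrite unfold_in /arc_ok /La ffunE.
case: ifP => [aA|c]; rewrite ?aA ?c; last by rewrite inordK.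
move: (aA); rewrite inE => /and4P[qn pn qp l1].
have [h1 h2] := lb _ _ qn pn qp.
rewrite inordK ?l_lt // h1 l1 /=; apply/eqP.
by have := gE _ qn; rewrite /gof /= inord_val => ->.
Qed.

Lemma data_inj d d' : d \in data_ok -> d' \in data_ok ->
    (forall q : nat, q \in primes n -> gof d q = gof d' q) ->
    (forall q p : nat, q \in primes n -> p \in primes n -> q < p -> lof d q p = lof d' q p) ->
  d = d'.
Proof.
case: d d' => A [G La] [A' [G' La']]; rewrite !inE /=.
move=> /and3P[sA /familyP hG /familyP hL] /and3P[sA' /familyP hG' /familyP hL'] eg el.
have sub (B B' : {set I * I}) (H H' : {ffun I -> ltype n}) (Lb Lb' : {ffun I * I -> I}) :
    short_spanning B -> (forall a, Lb a \in arc_ok B H a) ->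
    (forall a, Lb' a \in arc_ok B' H' a) ->
    (forall q p : nat, q \in primes n -> p \in primes n -> q < p ->
      lof (B, (H, Lb)) q p = lof (B', (H', Lb')) q p) ->
    forall a, a \in B -> a \in B'.
  move=> sB hB hB' e a aB; have [qn pn qp _] := short_arcP n0 sB aB.
  have := e _ _ qn pn qp; rewrite /lof /= !inord_val -surjective_pairing => ea.
  have := hB a; have := hB' a; rewrite -!topredE /= /arc_ok aB -ea.
  by case: ifP => // _ /eqP -> /and3P[_ /eqP].
have eA : A = A'.
  apply/setP=> a; apply/idP/idP; first exact: sub sA hL hL' el a.
  by apply: sub sA' hL' hL _ a => q p qn pn qp; rewrite el.
subst A'; congr (_, (_, _)).
  apply/ffunP=> q; have := hG q; have := hG' q; rewrite -!topredE /= /source_ok.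
  case: ifP => [/andP[qn _] _ _|_]; last exact: (fun a b => triv_eq b a).
  by have := eg q qn; rewrite /gof /= inord_val.
apply/ffunP=> a; have := hL a; have := hL' a; rewrite -!topredE /= /arc_ok.
case: ifP => [aA _ _|_ /eqP e1 /eqP e2]; last by apply: val_inj; rewrite /= e1 e2.
have [qn pn qp _] := short_arcP n0 sA aA.
have := el _ _ qn pn qp; rewrite /lof /= !inord_val -surjective_pairing => e.
exact: val_inj.
Qed.

Lemma brel_ext (g g' : nat -> ltype n) (l l' : nat -> nat -> nat) (gT : finGroupType) (x y : gT) :
    (forall q : nat, q \in primes n -> g q = g' q) ->
    (forall q p : nat, q \in primes n -> p \in primes n -> q < p -> l q p = l' q p) ->
  brel g l x y -> brel g' l' x y.
Proof.
move=> eg el [xn yn rT rl]; split=> // [q qn|q p qn pn qp].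
  by rewrite -eg //; apply: rT.
by rewrite -el //; apply: rl.
Qed.

(** One map [P d] is chosen for each datum. Distinct data give distinct classes because the
    invariants of a map are unique and isomorphism preserves them; every class occurs because a map
    with the invariants of d is isomorphic to [P d]. *)
Theorem nu_card_data : nu n = #|data_ok|.
Proof.
have [P PE] : exists P : data -> {perm Dart n} * {perm Dart n}, forall d, d \in data_ok ->
    reg_Knn (P d) /\ brel (gof d) (lof d) (P d).1 ((P d).1 ^ (P d).2)%g.
  pose Q d (p : {perm Dart n} * {perm Dart n}) := d \in data_ok ->
    reg_Knn p /\ brel (gof d) (lof d) p.1 (p.1 ^ p.2)%g.
  apply: (@fin_all_exists _ _ Q) => d; rewrite /Q.
  have [dok|_] := boolP (d \in data_ok); last by exists (1, 1)%g.
  have [gT [x [t [iso rel]]]] := brel_exists n0 n8 (data_good dok).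
  by have [p rp bp] := map_exists iso rel; exists p.
pose cls (p : {perm Dart n} * {perm Dart n}) := [set q | reg_Knn q && map_iso p q].
have refl p : map_iso p p.
  by apply/existsP; exists 1%g; rewrite !conjg1 !eqxx.
have ok d : d \in data_ok -> forall q : nat, q \in primes n -> ltype_ok q (logn q n) (gof d q).
  by move=> /data_good[].
have Pi : {in data_ok &, injective (cls \o P)}.
  move=> d d' dok d'ok /= e; have [rp bp] := PE d dok; have [rp' bp'] := PE d' d'ok.
  have : P d \in cls (P d') by rewrite -e inE rp refl.
  rewrite inE => /andP[_ /map_iso_transport/(_ bp') bp2].
  have iso := map_isobicyclic n0 rp.
  have [eg el] := brel_unique n8 iso (data_good dok) (data_good d'ok) bp bp2.
  exact: data_inj.
rewrite -(card_in_imset Pi) /nu; apply: eq_card => c.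
apply/imsetP/imsetP => [[p]|[d dok ->]]; last first.
  by have [rp _] := PE d dok; exists (P d); rewrite ?inE.
rewrite inE => rp ->; have iso := map_isobicyclic n0 rp.
have [g [l [rel good]]] := iso_analysis iso n8.
have [d dok [eg el]] := data_surj good.
exists d => //=; have [rP bP] := PE d dok.
have bp : brel (gof d) (lof d) p.1 (p.1 ^ p.2)%g.
  by apply: brel_ext rel => [q qn|q p' qn pn qp]; rewrite ?eg ?el.
apply/setP=> q; rewrite !inE; apply/andP/andP => -[rq pq]; split=> //.
  exact: (map_iso_brel n0 n8 (ok d dok) rP rq bP (map_iso_transport pq bp)).
exact: (map_iso_brel n0 n8 (ok d dok) rp rq bp (map_iso_transport pq bP)).
Qed.
End Data.

Section Count.
Variable n : nat.
Hypotheses (n0 : 0 < n) (n8 : 8 %| n).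
Local Notation I := 'I_n.+1.
Implicit Types (A : {set I * I}) (G : {ffun I -> ltype n}).

Lemma card_data_ok : #|@data_ok n| =
  \sum_(A : {set I * I} | short_spanning A) \sum_(G in family (source_ok A)) #|family (arc_ok A G)|.
Proof.
rewrite -sum1_card (eq_bigl (fun d : data n => short_spanning d.1 &&
    ((d.2.1 \in family (source_ok d.1)) && (d.2.2 \in family (arc_ok d.1 d.2.1))))); last first.
  by move=> d; rewrite inE.
rewrite -(pair_big_dep (fun A : {set I * I} => short_spanning A)
  (fun (A : {set I * I}) (e : {ffun I -> ltype n} * {ffun I * I -> I}) =>
   (e.1 \in family (source_ok A)) && (e.2 \in family (arc_ok A e.1))) (fun _ _ => 1)) /=.
apply: eq_bigr => A _.
rewrite -(pair_big_dep (fun G => G \in family (source_ok A))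
  (fun G (La : {ffun I * I -> I}) => La \in family (arc_ok A G)) (fun _ _ => 1)) /=.
by apply: eq_bigr => G _; rewrite sum1_card.
Qed.

Lemma card_arc_ok A G (a : I * I) : short_spanning A -> a \in A ->
  #|arc_ok A G a| = a.1 ^ minn (ltexp a.1 (logn a.1 n) (G a.1)) (logn a.1 a.2.-1) - 1.
Proof.
move=> sA aA; have [qn pn qp _] := short_arcP n0 sA aA.
move: (qn) (pn); rewrite !mem_primes => /and3P[pq _ _] /and3P[pp _ dp].
have qp' : (a.1 : nat) != a.2 by rewrite ltn_eqF.
have l0 : 0 < logn a.2 n by rewrite logn_gt0.
have le : a.2 ^ logn a.2 n <= n by rewrite dvdn_leq // pfactor_dvdnn.
rewrite -(card_roots_unity _ pp pq qp' l0 le) cardsE; apply: eq_card => c.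
by rewrite -!topredE /= /arc_ok aA.
Qed.

Lemma card_arc_notin A G (a : I * I) : a \notin A -> #|arc_ok A G a| = 1.
Proof.
move=> aA; rewrite -(card1 (inord 1 : I)); apply: eq_card => c.
by rewrite -!topredE /= /arc_ok (negbTE aA) -val_eqE /= inordK.
Qed.

Lemma card_family_arc A G : short_spanning A ->
  #|family (arc_ok A G)| = \prod_(q : I) arc_prod A q (ltexp q (logn q n) (G q)).
Proof.
move=> sA; rewrite card_family foldrE big_map big_enum /=.
rewrite (bigID (mem A)) /= mulnC big1 ?mul1n; last by move=> a; apply: card_arc_notin.
rewrite (partition_big (fun a : I * I => a.1) predT) //=.
apply: eq_bigr => q _; rewrite /arc_prod.
apply: eq_big => [a|a /andP[aA /eqP <-]]; first by rewrite val_eqE.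
by rewrite card_arc_ok.
Qed.

(** An arc leaving q would make q a prime of n and, by shortness, non-terminal. *)
Lemma arc_prod_inactive A (q : I) f : short_spanning A ->
  ~~ ((val q \in primes n) && nonterminal A q) -> arc_prod A q f = 1.
Proof.
move=> sA nq; rewrite /arc_prod big_pred0 // => a; apply/negbTE/negP => /andP[aA /eqP e].
have [qn _ _ _] := short_arcP n0 sA aA.
case/negP: nq; rewrite /= -e qn /=; apply/forall_inP => b bA.
by move: sA => /andP[_ /forall_inP/(_ b bA)/forall_inP]; apply.
Qed.

(** Since 2 divides p - 1, each factor is 2^1 - 1. This is why the exceptional types contribute 4
    without a product over arcs. *)
Lemma arc_prod2 A : short_spanning A -> arc_prod A 2 1 = 1.
Proof.
move=> sA; rewrite /arc_prod big1 // => a /andP[aA /eqP e].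
have [_ pn qp d] := short_arcP n0 sA aA; rewrite e in qp d.
have p0 : 0 < (val a.2).-1 by rewrite ltn_predRL (ltn_trans _ qp).
have : 0 < logn 2 a.2.-1 by rewrite logn_gt0 mem_primes p0.
by case: (logn _ _) => // k _; rewrite minnSS min0n.
Qed.

Lemma sum_source_inactive A (q : I) : short_spanning A ->
  ~~ ((val q \in primes n) && nonterminal A q) ->
  \sum_(tau | source_ok A q tau) arc_prod A q (ltexp q (logn q n) tau) = 1.
Proof.
move=> sA nq; rewrite (eq_bigl (pred1 (inl (Ordinal n0) : ltype n))); last first.
  move=> tau; rewrite /source_ok (negbTE nq) /=.
  by case: tau.
by rewrite big_pred1_eq arc_prod_inactive.
Qed.

Lemma sum_ltype_inl A (q : nat) (m : nat) : prime q -> m <= logn q n ->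
    (forall k, (q %| k) && ((q == 2) ==> (4 %| k)) = (q ^ m %| k)) ->
  \sum_(k < n | ltype_ok q (logn q n) (inl k : ltype n))
     arc_prod A q (ltexp q (logn q n) (inl k : ltype n)) =
  \sum_(m <= f < (logn q n).+1) totient (q ^ (logn q n - f)) * arc_prod A q f.
Proof.
move=> pq me mE; rewrite -(sum_gcd_totient pq (n := n)) //.
  by apply: eq_bigl => k /=; rewrite mE.
by rewrite dvdn_leq // pfactor_dvdnn.
Qed.

Lemma sum_source_odd A (q : I) : val q \in primes n -> nonterminal A q -> val q != 2 ->
  \sum_(tau | source_ok A q tau) arc_prod A q (ltexp q (logn q n) tau) =
  \sum_(1 <= f < (logn q n).+1) totient (q ^ (logn q n - f)) * arc_prod A q f.
Proof.
move=> qn tq q2; have pq : prime q by move: qn; rewrite mem_primes => /andP[].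
rewrite (eq_bigl (ltype_ok q (logn q n))); last by move=> tau; rewrite /source_ok qn tq.
rewrite big_sumType /= [X in _ + X]big_pred0 ?addn0; last by move=> ab /=; apply: negbTE.
rewrite -(@sum_ltype_inl A q 1) ?logn_gt0 //.
by move=> k; rewrite (negbTE q2) implyFb andbT expn1.
Qed.

Lemma sum_source_two A (q : I) : short_spanning A -> val q = 2 ->
  \sum_(tau | source_ok A q tau) arc_prod A q (ltexp q (logn q n) tau) =
  (\sum_(2 <= f < (logn 2 n).+1) totient (2 ^ (logn 2 n - f)) * arc_prod A 2 f) + 4.
Proof.
move=> sA q2; have d2 : 2 %| n by apply: dvdn_trans n8.
(* No arc ends at 2, the smallest prime. *)
have n2 : nonterminal A 2.
  apply/forall_inP => a /(short_arcP n0 sA)[qn _ qp _].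
  rewrite neq_ltn orbC (leq_ltn_trans _ qp) // prime_gt1 //.
  by move: qn; rewrite mem_primes => /andP[].
rewrite /= in q2.
rewrite (eq_bigl (ltype_ok q (logn q n))); last first.
  by move=> tau; rewrite /source_ok q2 n2 mem_primes n0 d2.
rewrite q2 big_sumType /=; congr (_ + _); last first.
  rewrite arc_prod2 // sum1_card.
  by rewrite (eq_card (B := predT)) // card_prod card_bool.
rewrite -(@sum_ltype_inl A 2 2) //.
  by rewrite -(@pfactor_dvdn 2) //; apply: dvdn_trans n8.
move=> k; rewrite (_ : 2 ^ 2 = 4) //; have [d4|] := boolP (4 %| k); last by rewrite andbF.
by rewrite (dvdn_trans _ d4).
Qed.

Lemma card_data_sum : #|@data_ok n| =
  \sum_(A : {set 'I_n.+1 * 'I_n.+1} | short_spanning A)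
    ((\sum_(2 <= f < (logn 2 n).+1) totient (2 ^ (logn 2 n - f)) * arc_prod A 2 f) + 4)
    * \prod_(q <- primes n | (q != 2) && nonterminal A q)
        (\sum_(1 <= f < (logn q n).+1) totient (q ^ (logn q n - f)) * arc_prod A q f).
Proof.
rewrite card_data_ok; apply: eq_bigr => A sA.
(* The number of exponents factors over the sources of arcs and depends at each source on its type
   only, so the sum over families of types becomes a product of sums. *)
have -> : \sum_(G in family (source_ok A)) #|family (arc_ok A G)| =
    \prod_(q : I) \sum_(tau | source_ok A q tau) arc_prod A q (ltexp q (logn q n) tau).
  rewrite bigA_distr_big_dep; apply: eq_bigr => G _.
  exact: card_family_arc.
have n2 : 2 < n.+1 by rewrite ltnS (leq_trans _ (dvdn_leq n0 n8)).
rewrite (bigD1 (Ordinal n2)) //= sum_source_two //; congr (_ * _).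
rewrite (bigID (fun q : I => (val q \in primes n) && nonterminal A q)) /=.
rewrite mulnC big1 ?mul1n; last by move=> q /andP[_ nq]; apply: sum_source_inactive.
pose F q := \sum_(1 <= f < (logn q n).+1) totient (q ^ (logn q n - f)) * arc_prod A q f.
transitivity (\prod_(q < n.+1 |
    ((q : nat) \in primes n) && ((q != 2 :> nat) && nonterminal A q)) F q).
  apply: eq_big => [q|q /andP[q2 /andP[qn tq]]]; first by rewrite -val_eqE /= andbCA.
  exact: sum_source_odd.
rewrite -(big_mkord (fun q => (q \in primes n) && ((q != 2) && nonterminal A q)) F).
rewrite -big_filter -[RHS]big_filter; apply: perm_big; apply: uniq_perm.
- by rewrite filter_uniq ?iota_uniq.
- by rewrite filter_uniq ?primes_uniq.
move=> q; rewrite !mem_filter mem_index_iota /= -andbA andbC [RHS]andbC.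
rewrite -!andbA; case qn: (q \in primes n) => //=; rewrite ?andbF //.
suff -> : q < n.+1 by rewrite ?andbT.
by move: qn; rewrite mem_primes ltnS => /and3P[_ _ /dvdn_leq->].
Qed.
End Count.

Theorem theorem12p2 (n : nat) (n_gt0 : 0 < n) (h8 : 8 %| n) :
  nu n =
  \sum_(A : {set 'I_n.+1 * 'I_n.+1} | short_spanning A)
    ((\sum_(2 <= f < (logn 2 n).+1) totient (2 ^ (logn 2 n - f)) * arc_prod A 2 f) + 4)
    * \prod_(q <- primes n | (q != 2) && nonterminal A q)
        (\sum_(1 <= f < (logn q n).+1) totient (q ^ (logn q n - f)) * arc_prod A q f).
Proof. by rewrite nu_card_data // card_data_sum. Qed.
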